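(* Sending an XC-tangle to its XC-Gauss diagram (one chord per 4-valent vertex, oriented from overpass to underpass and carrying the sign of the vertex, and one diamond of sign $\pm$ per edge of rotation number $\pm1$) defines an isomorphism of strict symmetric monoidal categories $$\mathcal{T}^{\mathrm{XC}}\xrightarrow{\ \cong\ }\mathcal{GD}^{\mathrm{XC}}$$ between the category of XC-tangles and the category of XC-Gauss diagrams on polarised open 1-manifolds.
   Context: **XC-tangle diagrams.** An XC-tangle diagram is a finite directed graph $T$ with vertices of valence 1, 2 or 4 such that: (i) each 4-valent vertex (''crossing'') carries a sign $\pm$ and a cyclic order of its four half-edges in which two adjacent ones are incoming and the other two outgoing. Writing the cyclic order (counterclockwise in pictures) as $(\mathrm{in}_L,\mathrm{in}_R,\mathrm{out}_R,\mathrm{out}_L)$, the straight passages are $\mathrm{in}_L\to\mathrm{out}_R$ and $\mathrm{in}_R\to\mathrm{out}_L$; at a $+$ vertex $\mathrm{in}_L\to\mathrm{out}_R$ is the overpass and the other the underpass, at a $-$ vertex $\mathrm{in}_R\to\mathrm{out}_L$ is the overpass. (ii) Each edge carries a rotation number in $\{-1,0,1\}$. (iii) Each bivalent vertex has one incoming and one outgoing half-edge. (iv) Each maximal directed path going straight at the 4-valent vertices (a strand) starts and ends at univalent vertices. (v) The set $V_{out}$ of initial univalent vertices of strands and the set $V_{in}$ of final ones are each totally ordered. Strands are ordered via $V_{out}$. **XC-moves.** Traversing a strand, record a word in the letters $o_c$ (overpass at crossing $c$), $u_c$ (underpass), $r$ (edge of rotation number $+1$), $\bar r$ (edge of rotation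 number $-1$); edges of rotation number $0$ and bivalent vertices contribute no letter. An XC-tangle is an equivalence class of XC-tangle diagrams under isomorphism and the following local moves. Each replaces subwords on disjoint consecutive portions of strands (portions are separated by '';'' and may lie on the same or on different strands), everything else being unchanged. - $\widehat\Omega 0r$: two consecutive edges of rotation numbers $i,j$ meeting at a bivalent vertex, with $|i+j|\le1$, may be replaced by one edge of rotation number $i+j$, and conversely. - $\widehat\Omega 0a,0b$ ($c$ of any sign): $o_c\,;\,u_c\leftrightarrow r\,o_c\,\bar r\,;\,r\,u_c\,\bar r$. - $\widehat\Omega1f$ ($c$ positive): $o_c\,\bar r\,u_c\leftrightarrow u_c\,r\,o_c$. - $\widehat\Omega2a,2b$ ($c,d$ of opposite signs): $o_co_d\,;\,u_cu_d\leftrightarrow\emptyset\,;\,\emptyset$. - $\widehat\Omega2c$ ($c$ positive, $d$ negative): $o_do_c\,;\,u_c\,r\,u_d\leftrightarrow\emptyset\,;\,r$. - $\widehat\Omega2d$ ($c$ positive, $d$ negative): $o_c\,\bar r\,o_d\,;\,u_du_c\leftrightarrow\bar r\,;\,\emptyset$. - $\widehat\Omega3$ ($c,d,e$ positive): $o_do_c\,;\,o_eu_c\,;\,u_eu_d\leftrightarrow o_co_d\,;\,u_co_e\,;\,u_du_e$. **The category $\mathcal{T}^{\mathrm{XC}}$.** Objects: nonnegative integers. Only endomorphisms; $\mathrm{End}(n)$ is the set of XC-tangles with $n$ strands. $T_2\circ T_1$ glues the $i$-th vertex of $V_{in}(T_1)$ to the $i$-th vertex of $V_{out}(T_2)$.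 The identity is $n$ ordered edges of rotation number $0$. The monoidal product is addition on objects and ordered disjoint union on arrows. The symmetry $P_{n,m}$ consists of $n+m$ edges of rotation number $0$, the $i$-th going from the $i$-th vertex of $V_{out}$ to the $(i+m)$-th (mod $n+m$) vertex of $V_{in}$. **XC-Gauss diagrams.** Let $X$ be a disjoint union of finitely many oriented intervals. An XC-Gauss diagram on $X$ is a finite set of oriented chords, each with a sign $\pm$, whose distinct endpoints lie in the interior of $X$, together with finitely many further marked points (''diamonds'') with signs $\pm$ in the interior of $X$, away from chord endpoints; everything is taken up to orientation-preserving homeomorphism respecting all data. Reading along a component gives a word in $o_c$ (tail of chord $c$), $u_c$ (head of $c$), $r$ ($+$ diamond), $\bar r$ ($-$ diamond). $\mathcal{GD}^{\mathrm{XC}}(X)$ is the set of XC-Gauss diagrams on $X$ modulo the same word moves as for XC-tangles (with $\widehat\Omega0r$ replaced by $r\bar r\leftrightarrow\emptyset\leftrightarrow\bar rr$). **The category $\mathcal{GD}^{\mathrm{XC}}$.** Objects: nonnegative integers; only endomorphisms. $\mathrm{End}(n)$ is the disjoint union of the sets $\mathcal{GD}^{\mathrm{XC}}(X)$ over homeomorphism classes of polarised $X$ with $n$ components: $X$ is a disjoint union of $n$ oriented intervals whose set of starting points (''bottom'') and set of end points (''top'') are each totally ordered. Composition $D_2\circ D_1$ glues the top points of $D_1$ to the bottom points of $D_2$ in order; the identity has no chords or diamonds, and the $i$-th interval joins bottom point $i$ to top point $i$. The monoidal product is addition and ordered disjoint union; the symmetry $P_{n,m}$ has no chords or diamonds,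 with intervals joining bottom point $i$ to top point $i+m$ (mod $n+m$). **The functor.** It is the identity on objects. For an XC-tangle $T$ the skeleton $X$ has one interval per strand, with bottom/top points identified with $V_{out}$/$V_{in}$ with their orders, and chords and diamonds placed in the order in which the strands meet the crossings and the edges of rotation number $\pm1$. *)

(* Defs.v *)
From HB Require Import structures.
From mathcomp Require Import all_boot all_order all_algebra.
From mathcomp Require Import all_classical all_reals topology
  normedtype.
From mathcomp Require Import lra.
From Stdlib Require Import Relation_Operators.

Set Implicit Arguments.
Unset Strict Implicit.
Unset Printing Implicit Defensive.

Import Order.TTheory GRing.Theory Num.Theory.
Import numFieldNormedType.Exports.

Local Open Scope classical_set_scope.
Local Open Scope ring_scope.

(* [comp g f] is g o f, for f : a -> b and g : b -> c. *)
Record smc_data := SmcData {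
  ob : Type;
  hom : ob -> ob -> Type;
  idm : forall a, hom a a;
  comp : forall a b c, hom b c -> hom a b -> hom a c;
  unt : ob;
  tob : ob -> ob -> ob;
  tens : forall a b c d, hom a b -> hom c d -> hom (tob a c) (tob b d);
  braid : forall a b, hom (tob a b) (tob b a)
}.

Arguments idm {s} a.
Arguments comp {s a b c} g f.
Arguments unt {s}.
Arguments tob {s} a b.
Arguments tens {s a b c d} f g.
Arguments braid {s} a b.

(* Transport of an arrow along equalities of objects: strictness makes the two
   sides of an axiom have sources (targets) that are only propositionally
   equal. *)
Definition cast_hom (C : smc_data) (a a' b b' : ob C)
    (ea : a = a') (eb : b = b') (f : hom a b) : hom a' b' :=
  ecast x (hom x b') ea (ecast y (hom a y) eb f).

Record is_ssmc (C : smc_data) : Prop := IsSsmc {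
  ssmc_compA : forall (a b c d : ob C) (h : hom c d) (g : hom b c) (f : hom a b),
    comp h (comp g f) = comp (comp h g) f;
  ssmc_comp1l : forall (a b : ob C) (f : hom a b), comp (idm b) f = f;
  ssmc_comp1r : forall (a b : ob C) (f : hom a b), comp f (idm a) = f;
  ssmc_tens1 : forall a b : ob C, tens (idm a) (idm b) = idm (tob a b);
  ssmc_tens_comp : forall (a b c a' b' c' : ob C)
      (g : hom b c) (f : hom a b) (g' : hom b' c') (f' : hom a' b'),
    tens (comp g f) (comp g' f') = comp (tens g g') (tens f f');
  ssmc_tobA : forall a b c : ob C, tob a (tob b c) = tob (tob a b) c;
  ssmc_tob1l : forall a : ob C, tob unt a = a;
  ssmc_tob1r : forall a : ob C, tob a unt = a;
  ssmc_tensA : forall (a b c a' b' c' : ob C)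
      (f : hom a a') (g : hom b b') (h : hom c c') ea eb,
    cast_hom ea eb (tens f (tens g h)) = tens (tens f g) h;
  ssmc_tens1l : forall (a b : ob C) (f : hom a b) ea eb,
    cast_hom ea eb (tens (idm unt) f) = f;
  ssmc_tens1r : forall (a b : ob C) (f : hom a b) ea eb,
    cast_hom ea eb (tens f (idm unt)) = f;
  ssmc_braid_nat : forall (a b c d : ob C) (f : hom a c) (g : hom b d),
    comp (braid c d) (tens f g) = comp (tens g f) (braid a b);
  ssmc_braidK : forall a b : ob C, comp (braid b a) (braid a b) = idm (tob a b);
  ssmc_hexagon : forall (a b c : ob C) e1 e2 e3,
    cast_hom e1 e2 (braid a (tob b c)) =
      comp (tens (idm b) (braid a c))
           (cast_hom (erefl _) e3 (tens (braid a b) (idm c)))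
}.

Record smc_map (C D : smc_data) := SmcMap {
  fob : ob C -> ob D;
  fhom : forall a b, hom a b -> hom (fob a) (fob b)
}.

Record is_ssm_functor (C D : smc_data) (F : smc_map C D) : Prop := IsSsmFunctor {
  ssmf_id : forall a, fhom F (idm a) = idm (fob F a);
  ssmf_comp : forall (a b c : ob C) (g : hom b c) (f : hom a b),
    fhom F (comp g f) = comp (fhom F g) (fhom F f);
  ssmf_unt : fob F unt = unt;
  ssmf_tob : forall a b, fob F (tob a b) = tob (fob F a) (fob F b);
  ssmf_tens : forall (a b c d : ob C) (f : hom a b) (g : hom c d) e1 e2,
    cast_hom e1 e2 (fhom F (tens f g)) = tens (fhom F f) (fhom F g);
  ssmf_braid : forall (a b : ob C) e1 e2,
    cast_hom e1 e2 (fhom F (braid a b)) = braid (fob F a) (fob F b)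
}.

Definition left_inverse_map (C D : smc_data) (F : smc_map C D) (G : smc_map D C) :
    Prop :=
  (forall a, fob G (fob F a) = a) /\
  (forall (a b : ob C) (f : hom a b) e1 e2,
     cast_hom e1 e2 (fhom G (fhom F f)) = f).

Definition is_ssm_isomorphism (C D : smc_data) (F : smc_map C D) : Prop :=
  is_ssm_functor F /\
  exists G : smc_map D C,
    [/\ is_ssm_functor G, left_inverse_map F G & left_inverse_map G F].

(* [generic_quotient] needs a choiceType; the types of diagrams below live in
   too large a universe for that. *)
Definition eqclass (T : Type) (r : T -> T -> Prop) : Type :=
  {P : T -> Prop | exists x, P = r x}.

Definition cls (T : Type) (r : T -> T -> Prop) (x : T) : eqclass r :=
  exist _ (r x) (ex_intro _ x (erefl (r x))).

Definition class_repr (T : Type) (r : T -> T -> Prop) (c : eqclass r) : T :=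
  sval (cid (svalP c)).

(* Signs of crossings, chords and diamonds are booleans, true being +. *)

Variant letter (C : Type) : Type :=
  Over of C | Under of C | Rplus | Rminus.

Arguments Rplus {C}.
Arguments Rminus {C}.

Definition map_letter (C C' : Type) (f : C -> C') (l : letter C) : letter C' :=
  match l with
  | Over c => Over (f c)
  | Under c => Under (f c)
  | Rplus => Rplus
  | Rminus => Rminus
  end.

(* One side of a word move with k portions; [psign] is the sign of the
   crossings involved. *)
Record pattern (k : nat) := Pattern {
  plabel : finType;
  psign : plabel -> bool;
  pword : k.-tuple (seq (letter plabel))
}.

Definition no_crossing (x : void) : bool := true.

Definition Om0_lhs (s : bool) : pattern 2 :=
  @Pattern 2 unit (fun=> s) [tuple [:: Over tt]; [:: Under tt]].
Definition Om0_rhs (s : bool) : pattern 2 :=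
  @Pattern 2 unit (fun=> s)
    [tuple [:: Rplus; Over tt; Rminus]; [:: Rplus; Under tt; Rminus]].

Definition Om1f_lhs : pattern 1 :=
  @Pattern 1 unit (fun=> true) [tuple [:: Over tt; Rminus; Under tt]].
Definition Om1f_rhs : pattern 1 :=
  @Pattern 1 unit (fun=> true) [tuple [:: Under tt; Rplus; Over tt]].

(* In the moves Omega2 the crossing c is [true] and the crossing d is
   [false]. *)
Definition Om2ab_lhs (s : bool) : pattern 2 :=
  let c := true in let d := false in
  @Pattern 2 bool (fun x => if x then s else ~~ s)
    [tuple [:: Over c; Over d]; [:: Under c; Under d]].
Definition Om2ab_rhs : pattern 2 :=
  @Pattern 2 void no_crossing [tuple [::]; [::]].

Definition Om2c_lhs : pattern 2 :=
  let c := true in let d := false in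
  @Pattern 2 bool (fun x => x)
    [tuple [:: Over d; Over c]; [:: Under c; Rplus; Under d]].
Definition Om2c_rhs : pattern 2 :=
  @Pattern 2 void no_crossing [tuple [::]; [:: Rplus]].

Definition Om2d_lhs : pattern 2 :=
  let c := true in let d := false in
  @Pattern 2 bool (fun x => x)
    [tuple [:: Over c; Rminus; Over d]; [:: Under d; Under c]].
Definition Om2d_rhs : pattern 2 :=
  @Pattern 2 void no_crossing [tuple [:: Rminus]; [::]].

Definition Om3_lhs : pattern 3 :=
  let c := @Ordinal 3 0 isT in
  let d := @Ordinal 3 1 isT in
  let e := @Ordinal 3 2 isT in
  @Pattern 3 'I_3 (fun=> true)
    [tuple [:: Over d; Over c]; [:: Over e; Under c]; [:: Under e; Under d]].
Definition Om3_rhs : pattern 3 :=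
  let c := @Ordinal 3 0 isT in
  let d := @Ordinal 3 1 isT in
  let e := @Ordinal 3 2 isT in
  @Pattern 3 'I_3 (fun=> true)
    [tuple [:: Over c; Over d]; [:: Under c; Over e]; [:: Under d; Under e]].

Definition cancel_pm : pattern 1 :=
  @Pattern 1 void no_crossing [tuple [:: Rplus; Rminus]].
Definition cancel_mp : pattern 1 :=
  @Pattern 1 void no_crossing [tuple [:: Rminus; Rplus]].
Definition cancel_none : pattern 1 :=
  @Pattern 1 void no_crossing [tuple [::]].

(* The moves common to XC-tangles and XC-Gauss diagrams. *)
Inductive xc_rule : forall k, pattern k -> pattern k -> Prop :=
| rule_Om0 s : xc_rule (Om0_lhs s) (Om0_rhs s)
| rule_Om1f : xc_rule Om1f_lhs Om1f_rhs
| rule_Om2ab s : xc_rule (Om2ab_lhs s) Om2ab_rhs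
| rule_Om2c : xc_rule Om2c_lhs Om2c_rhs
| rule_Om2d : xc_rule Om2d_lhs Om2d_rhs
| rule_Om3 : xc_rule Om3_lhs Om3_rhs.

Inductive gauss_rule : forall k, pattern k -> pattern k -> Prop :=
| rule_common k (p q : pattern k) : xc_rule p q -> gauss_rule p q
| rule_pm : gauss_rule cancel_pm cancel_none
| rule_mp : gauss_rule cancel_mp cancel_none.

(* A directed graph whose vertices are: univalent initial vertices (I),
   univalent final vertices (O), bivalent vertices (B) and crossings (C).
   Its edges are attached to slots for half-edges: [Endp i] is the half-edge of
   a univalent vertex, [Biv b] the outgoing (resp. incoming) half-edge of a
   bivalent vertex, and [Crs c s] the left (s = true) or right (s = false)
   outgoing (resp. incoming) half-edge of a crossing, so that the cyclic order
   (in_L, in_R, out_R, out_L) at c is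
     target slot (c, true), target slot (c, false),
     source slot (c, false), source slot (c, true). *)
Notation port I B C := (I + (B + C * bool))%type.
Notation Endp i := (inl i).
Notation Biv b := (inr (inl b)).
Notation Crs c s := (inr (inr (c, s))).

Record xgraph (I O : finType) := XGraph {
  xedge : finType;
  xbiv : finType;
  xcross : finType;
  xsign : xcross -> bool;
  xrot : xedge -> int;
  xsrc : xedge -> port I xbiv xcross;
  xtgt : xedge -> port O xbiv xcross
}.

(* e' follows e when going straight: in_L -> out_R and in_R -> out_L. *)
Definition xstep (I O : finType) (G : xgraph I O) (e e' : xedge G) : bool :=
  match xtgt e, xsrc e' with
  | Biv b, Biv b' => b == b'
  | Crs c s, Crs c' s' => (c == c') && (s' == ~~ s)
  | _, _ => false
  end.

Definition is_strand (I O : finType) (G : xgraph I O)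
    (i : I) (s : seq (xedge G)) (j : O) : Prop :=
  if s is e :: s' then
    [/\ xsrc e = Endp i, path (@xstep I O G) e s' & xtgt (last e s') = Endp j]
  else False.

Record is_diagram (I O : finType) (G : xgraph I O) : Prop := IsDiagram {
  diag_rot : forall e : xedge G, `|xrot e| <= 1;
  diag_src : bijective (@xsrc I O G);
  diag_tgt : bijective (@xtgt I O G);
  diag_strand : forall e : xedge G, exists i s j, @is_strand I O G i s j /\ e \in s
}.

(* m and n are the numbers of elements of V_out and V_in, so that the orders
   become numberings; see [tangle_diagram_eq] for m = n. *)
Record tangle_diagram (m n : nat) := TangleDiagram {
  tgraph :> xgraph 'I_m 'I_n;
  tgraphP : is_diagram tgraph
}.

(* The passage entering a crossing by its slot s is the
   overpass when s is left and the sign +, or s is right and the sign -. *)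
Definition edge_word (I O : finType) (G : xgraph I O) (e : xedge G) :
    seq (letter (xcross G)) :=
  (if xrot e == 1 then [:: Rplus] else if xrot e == -1 then [:: Rminus] else [::])
  ++ match xtgt e with
     | Crs c s => [:: if s == xsign c then Over c else Under c]
     | _ => [::]
     end.

Definition strand_word (I O : finType) (G : xgraph I O) (s : seq (xedge G)) :
    seq (letter (xcross G)) :=
  flatten [seq edge_word e | e <- s].

Definition port_map (I B C J B' C' : Type) (fi : I -> port J B' C')
    (fb : B -> B') (fc : C -> C') (p : port I B C) : port J B' C' :=
  match p with
  | Endp i => fi i
  | Biv b => Biv (fb b)
  | Crs c s => Crs (fc c) s
  end.

Definition xiso (I O : finType) (G H : xgraph I O) : Prop :=
  exists (fe : xedge G -> xedge H) (fb : xbiv G -> xbiv H)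
         (fc : xcross G -> xcross H),
    [/\ [/\ bijective fe, bijective fb & bijective fc],
        (forall c, xsign (fc c) = xsign c),
        (forall e, xrot (fe e) = xrot e),
        (forall e, xsrc (fe e) = port_map (fun i => Endp i) fb fc (xsrc e)) &
        (forall e, xtgt (fe e) = port_map (fun i => Endp i) fb fc (xtgt e))].

(* The edge e is subdivided by a new bivalent vertex [None] into an edge of
   rotation number a (still called e) followed by an edge [None] of rotation
   number b. *)
Definition xsplit (I O : finType) (G : xgraph I O) (e : xedge G) (a b : int) :
    xgraph I O :=
  @XGraph I O (option (xedge G)) (option (xbiv G)) (xcross G)
    (@xsign I O G)
    (fun x => if x is Some f then if f == e then a else xrot f else b)
    (fun x => if x is Some f then port_map (fun i => Endp i) some id (xsrc f)
              else Biv None)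
    (fun x => if x is Some f then
                if f == e then Biv None
                else port_map (fun j => Endp j) some id (xtgt f)
              else port_map (fun j => Endp j) some id (xtgt e)).

(* A graph K with k holes has, besides its m initial and n final vertices, k
   more initial vertices (where the diagram filling the holes is left) and k
   more final vertices (where it is entered).  Filling the holes turns all
   these vertices into bivalent ones; any portion of a strand can be brought
   to this form by subdividing the edges at its ends. *)
Definition xplug (m n k : nat)
    (K : xgraph ('I_m + 'I_k)%type ('I_n + 'I_k)%type) (L : xgraph 'I_k 'I_k) :
    xgraph 'I_m 'I_n :=
  let entry (j : 'I_k) := inr (inl j) in
  let exit (j : 'I_k) := inr (inr j) in
  @XGraph 'I_m 'I_n (xedge K + xedge L)%type
    ((xbiv K + xbiv L) + ('I_k + 'I_k))%type (xcross K + xcross L)%type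
    (fun c => match c with inl c => xsign c | inr c => xsign c end)
    (fun e => match e with inl e => xrot e | inr e => xrot e end)
    (fun e => match e with
      | inl e => port_map
          (fun i => match i with inl i => Endp i | inr j => Biv (exit j) end)
          (fun b => inl (inl b)) inl (xsrc e)
      | inr e => port_map (fun j => Biv (entry j)) (fun b => inl (inr b)) inr (xsrc e)
      end)
    (fun e => match e with
      | inl e => port_map
          (fun i => match i with inl i => Endp i | inr j => Biv (entry j) end)
          (fun b => inl (inl b)) inl (xtgt e)
      | inr e => port_map (fun j => Biv (exit j)) (fun b => inl (inr b)) inr (xtgt e)
      end).

(* The k strands of L are portions spelling the k words of the pattern, and
   these portions contain all the crossings of the pattern and no other. *)
Definition realizes (k : nat) (L : tangle_diagram k k) (p : pattern k) : Prop :=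
  exists f : plabel p -> xcross L,
    [/\ bijective f, (forall x, xsign (f x) = psign x) &
        forall j : 'I_k, exists s, @is_strand _ _ L j s j /\
          strand_word s = map (map_letter f) (tnth (pword p) j)].

Inductive tangle_move (m n : nat) (T T' : tangle_diagram m n) : Prop :=
| move_iso of xiso T T'
| move_Om0r (e : xedge T') (a b : int) of
    a + b = xrot e & xiso T (xsplit e a b)
| move_rule (k : nat) (p q : pattern k)
    (K : xgraph ('I_m + 'I_k)%type ('I_n + 'I_k)%type)
    (L L' : tangle_diagram k k) of
    xc_rule p q & realizes L p & realizes L' q &
    xiso T (xplug K L) & xiso T' (xplug K L').

Definition tangle_equiv (m n : nat) : tangle_diagram m n -> tangle_diagram m n -> Prop :=
  clos_refl_sym_trans _ (@tangle_move m n).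

Definition xc_tangle (m n : nat) : Type := eqclass (@tangle_equiv m n).

Definition id_graph (n : nat) : xgraph 'I_n 'I_n :=
  @XGraph 'I_n 'I_n 'I_n void void (fun=> true) (fun=> 0)
    (fun i => Endp i) (fun i => Endp i).

(* The i-th final vertex of G and the i-th initial vertex of H become one
   bivalent vertex [inr i]. *)
Definition comp_graph (m n p : nat) (H : xgraph 'I_n 'I_p) (G : xgraph 'I_m 'I_n) :
    xgraph 'I_m 'I_p :=
  @XGraph 'I_m 'I_p (xedge G + xedge H)%type
    ((xbiv G + xbiv H) + 'I_n)%type (xcross G + xcross H)%type
    (fun c => match c with inl c => xsign c | inr c => xsign c end)
    (fun e => match e with inl e => xrot e | inr e => xrot e end)
    (fun e => match e with
      | inl e => port_map (fun i => Endp i) (fun b => inl (inl b)) inl (xsrc e)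
      | inr e => port_map (fun i => Biv (inr i)) (fun b => inl (inr b)) inr (xsrc e)
      end)
    (fun e => match e with
      | inl e => port_map (fun i => Biv (inr i)) (fun b => inl (inl b)) inl (xtgt e)
      | inr e => port_map (fun i => Endp i) (fun b => inl (inr b)) inr (xtgt e)
      end).

Definition tens_graph (m n p q : nat) (G : xgraph 'I_m 'I_n) (H : xgraph 'I_p 'I_q) :
    xgraph 'I_(m + p) 'I_(n + q) :=
  @XGraph 'I_(m + p) 'I_(n + q) (xedge G + xedge H)%type
    (xbiv G + xbiv H)%type (xcross G + xcross H)%type
    (fun c => match c with inl c => xsign c | inr c => xsign c end)
    (fun e => match e with inl e => xrot e | inr e => xrot e end)
    (fun e => match e with
      | inl e => port_map (fun i => Endp (lshift p i)) inl inl (xsrc e)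
      | inr e => port_map (fun i => Endp (rshift m i)) inr inr (xsrc e)
      end)
    (fun e => match e with
      | inl e => port_map (fun i => Endp (lshift q i)) inl inl (xtgt e)
      | inr e => port_map (fun i => Endp (rshift n i)) inr inr (xtgt e)
      end).

Lemma swap_subproof (n m : nat) (i : 'I_(n + m)) : ((i + m) %% (n + m) < m + n)%N.
Proof. by rewrite [(m + n)%N]addnC ltn_pmod // (leq_ltn_trans _ (ltn_ord i)). Qed.

Definition swap_ord (n m : nat) (i : 'I_(n + m)) : 'I_(m + n) :=
  Ordinal (swap_subproof i).

Definition sym_graph (n m : nat) : xgraph 'I_(n + m) 'I_(m + n) :=
  @XGraph 'I_(n + m) 'I_(m + n) 'I_(n + m) void void (fun=> true) (fun=> 0)
    (fun i => Endp i) (fun i => Endp (swap_ord i)).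

Lemma swap_ordK (n m : nat) : cancel (@swap_ord n m) (@swap_ord m n).
Proof.
move=> i; apply: val_inj => /=; have lti := ltn_ord i.
rewrite [(m + n)%N]addnC modnDml -addnA [(m + n)%N]addnC modnDr modn_small //.
Qed.

Lemma id_graphP n : is_diagram (id_graph n).
Proof.
have bij : bijective (fun i : 'I_n => Endp i : port 'I_n void void).
  exists (fun p => match p with
    | Endp i => i | Biv b => of_void _ b
    | Crs c _ => of_void _ c end).
    by [].
  by case=> [//|[[]|[[] s]]].
split=> //= e; exists e, [:: e], e; split; last by rewrite inE.
by split.
Qed.

Lemma sym_graphP n m : is_diagram (sym_graph n m).
Proof.
split=> //=.
- exists (fun p : port 'I_(n + m) void void => match p with
    | Endp i => i | Biv b => of_void _ b
    | Crs c _ => of_void _ c end).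
    by [].
  by case=> [//|[[]|[[] s]]].
- exists (fun p : port 'I_(m + n) void void => match p with
    | Endp i => swap_ord i | Biv b => of_void _ b
    | Crs c _ => of_void _ c end).
    by move=> i; rewrite swap_ordK.
  by case=> [i|[[]|[[] s]]]; rewrite swap_ordK.
- by move=> e; exists e, [:: e], (swap_ord e); split; rewrite ?inE.
Qed.

Section Strands.
Variables (I O : finType) (G : xgraph I O).
Hypothesis GP : is_diagram G.

Lemma strand_from (i : I) : exists s j, @is_strand I O G i s j.
Proof.
case: (diag_src GP) => g _ Kg; case: (diag_strand GP (g (Endp i))).
move=> i' [s [j [Hs Hin]]]; exists s, j; case: s Hs Hin => // e s [He Hp Ht].
rewrite inE => /orP[/eqP Ee|].
  by split=> //; rewrite -Ee Kg.
move=> Hin; exfalso; elim: s e {He Ht} Hp Hin => //= f s IHs e /andP[Hs Hp].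
rewrite inE => /orP[/eqP Ef|/(IHs f Hp)//].
by move: Hs; rewrite /xstep -Ef Kg; case: (xtgt e) => // -[|[]].
Qed.

Lemma strand_to (j : O) : exists i s, @is_strand I O G i s j.
Proof.
case: (diag_tgt GP) => g _ Kg; case: (diag_strand GP (g (Endp j))).
move=> i [s [j' [Hs Hin]]]; exists i, s; case: s Hs Hin => // e s [He Hp Ht] Hin.
split=> //; move: Hp Ht Hin; clear He; elim: s e => [|f s IHs] e /=.
  by rewrite inE => _ Ht /eqP <-; rewrite Kg.
move=> /andP[Hs Hp] Ht; rewrite inE => /orP[/eqP Ee|/(IHs f Hp Ht)//].
by move: Hs; rewrite /xstep -Ee Kg.
Qed.

End Strands.

Lemma is_strand_map (I O I' O' : finType) (G : xgraph I O) (G' : xgraph I' O')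
    (f : xedge G -> xedge G') (i : I) (i' : I') (j : O) (j' : O') s :
  (forall e e', xstep e e' -> xstep (f e) (f e')) ->
  (forall e, xsrc e = Endp i -> xsrc (f e) = Endp i') ->
  (forall e, xtgt e = Endp j -> xtgt (f e) = Endp j') ->
  @is_strand I O G i s j -> @is_strand I' O' G' i' (map f s) j'.
Proof.
move=> Hst Hi Hj; case: s => //= e s [/Hi-> Hp]; rewrite last_map => /Hj->.
by split=> //; rewrite path_map; apply: sub_path Hp.
Qed.

Lemma tens_graphP m n p q (G : tangle_diagram m n) (H : tangle_diagram p q) :
  is_diagram (tens_graph G H).
Proof.
case: G H => G GP [H HP] /=; split.
- by case=> e /=; [exact: (diag_rot GP)|exact: (diag_rot HP)].
- case: (diag_src GP) (diag_src HP) => g gK Kg [h hK Kh].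
  exists (fun x => match x with
    | Endp i => match fintype.split i with inl i => inl (g (Endp i)) | inr i => inr (h (Endp i)) end
    | Biv (inl b) => inl (g (Biv b)) | Biv (inr b) => inr (h (Biv b))
    | Crs (inl c) s => inl (g (Crs c s)) | Crs (inr c) s => inr (h (Crs c s)) end).
  + case=> e /=.
      case E: (xsrc e) => [i|[b|[c s]]] /=; rewrite -?E ?gK //.
      by rewrite (unsplitK (inl _)) -E gK.
    case E: (xsrc e) => [i|[b|[c s]]] /=; rewrite -?E ?hK //.
    by rewrite (unsplitK (inr _)) -E hK.
  + case=> [i|[[b|b]|[[c|c] s]]] /=; rewrite ?Kg ?Kh //.
    by case: (splitP i) => k Ek; rewrite ?Kg ?Kh /=; congr inl; apply: val_inj.
- case: (diag_tgt GP) (diag_tgt HP) => g gK Kg [h hK Kh].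
  exists (fun x => match x with
    | Endp i => match fintype.split i with inl i => inl (g (Endp i)) | inr i => inr (h (Endp i)) end
    | Biv (inl b) => inl (g (Biv b)) | Biv (inr b) => inr (h (Biv b))
    | Crs (inl c) s => inl (g (Crs c s)) | Crs (inr c) s => inr (h (Crs c s)) end).
  + case=> e /=.
      case E: (xtgt e) => [i|[b|[c s]]] /=; rewrite -?E ?gK //.
      by rewrite (unsplitK (inl _)) -E gK.
    case E: (xtgt e) => [i|[b|[c s]]] /=; rewrite -?E ?hK //.
    by rewrite (unsplitK (inr _)) -E hK.
  + case=> [i|[[b|b]|[[c|c] s]]] /=; rewrite ?Kg ?Kh //.
    by case: (splitP i) => k Ek; rewrite ?Kg ?Kh /=; congr inl; apply: val_inj.
- case=> e.
  + case: (diag_strand GP e) => i [s [j [Hs Hin]]].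
    exists (lshift p i), (map inl s), (lshift q j); split; last exact: map_f.
    apply: is_strand_map Hs => [e1 e2|e1|e1] /=.
    * rewrite /xstep /=; case: (xtgt e1) => [?|[b|[c s1]]];
      by case: (xsrc e2) => [?|[b'|[c' s2]]].
    * by move=> ->.
    * by move=> ->.
  + case: (diag_strand HP e) => i [s [j [Hs Hin]]].
    exists (rshift m i), (map inr s), (rshift n j); split; last exact: map_f.
    apply: is_strand_map Hs => [e1 e2|e1|e1] /=.
    * rewrite /xstep /=; case: (xtgt e1) => [?|[b|[c s1]]];
      by case: (xsrc e2) => [?|[b'|[c' s2]]].
    * by move=> ->.
    * by move=> ->.
Qed.

Lemma comp_strand m n p (G : xgraph 'I_m 'I_n) (H : xgraph 'I_n 'I_p) i s j s' k :
  @is_strand _ _ G i s j -> @is_strand _ _ H j s' k ->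
  @is_strand _ _ (comp_graph H G) i (map inl s ++ map inr s') k.
Proof.
case: s => //= e s [He Hp Ht]; case: s' => //= f s' [Hf Hp' Ht'].
split; first by rewrite He.
- rewrite cat_path /= !path_map last_map; apply/and3P; split.
  + apply: sub_path Hp => e1 e2 /=; rewrite /xstep /=.
    by case: (xtgt e1) => [?|[b|[c s1]]]; case: (xsrc e2) => [?|[b'|[c' s2]]].
  + by rewrite /xstep /= Ht Hf /=.
  + apply: sub_path Hp' => e1 e2 /=; rewrite /xstep /=.
    by case: (xtgt e1) => [?|[b|[c s1]]]; case: (xsrc e2) => [?|[b'|[c' s2]]].
- by rewrite last_cat /= last_map /= Ht'.
Qed.

Lemma comp_graphP m n p (H : tangle_diagram n p) (G : tangle_diagram m n) :
  is_diagram (comp_graph H G).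
Proof.
case: G H => G GP [H HP] /=; split.
- by case=> e /=; [exact: (diag_rot GP)|exact: (diag_rot HP)].
- case: (diag_src GP) (diag_src HP) => g gK Kg [h hK Kh].
  exists (fun x => match x with
    | Endp i => inl (g (Endp i))
    | Biv (inr i) => inr (h (Endp i))
    | Biv (inl (inl b)) => inl (g (Biv b)) | Biv (inl (inr b)) => inr (h (Biv b))
    | Crs (inl c) s => inl (g (Crs c s)) | Crs (inr c) s => inr (h (Crs c s)) end).
  + by case=> e /=; case E: (xsrc e) => [i|[b|[c s]]] /=; rewrite -E ?gK ?hK.
  + by case=> [i|[[[b|b]|i]|[[c|c] s]]] /=; rewrite ?Kg ?Kh.
- case: (diag_tgt GP) (diag_tgt HP) => g gK Kg [h hK Kh].
  exists (fun x => match x with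
    | Endp i => inr (h (Endp i))
    | Biv (inr i) => inl (g (Endp i))
    | Biv (inl (inl b)) => inl (g (Biv b)) | Biv (inl (inr b)) => inr (h (Biv b))
    | Crs (inl c) s => inl (g (Crs c s)) | Crs (inr c) s => inr (h (Crs c s)) end).
  + by case=> e /=; case E: (xtgt e) => [i|[b|[c s]]] /=; rewrite -E ?gK ?hK.
  + by case=> [i|[[[b|b]|i]|[[c|c] s]]] /=; rewrite ?Kg ?Kh.
- case=> e.
  + case: (diag_strand GP e) => i [s [j [Hs Hin]]].
    have [s' [k Hs']] := strand_from HP j.
    exists i, (map inl s ++ map inr s'), k; split; first exact: comp_strand Hs Hs'.
    by rewrite mem_cat map_f.
  + case: (diag_strand HP e) => j [s' [k [Hs' Hin]]].
    have [i [s Hs]] := strand_to GP j.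
    exists i, (map inl s ++ map inr s'), k; split; first exact: comp_strand Hs Hs'.
    by rewrite mem_cat orbC map_f.
Qed.

Definition id_diagram n := TangleDiagram (id_graphP n).
Definition sym_diagram n m := TangleDiagram (sym_graphP n m).
Definition tens_diagram m n p q (G : tangle_diagram m n) (H : tangle_diagram p q) :=
  TangleDiagram (tens_graphP G H).
Definition comp_diagram m n p (H : tangle_diagram n p) (G : tangle_diagram m n) :=
  TangleDiagram (comp_graphP H G).

(* All morphisms of the category of XC-tangles are endomorphisms. *)
Lemma tangle_diagram_eq m n (G : tangle_diagram m n) : m = n.
Proof.
have /bij_eq_card E1 := diag_src (tgraphP G).
have /bij_eq_card := diag_tgt (tgraphP G); rewrite {}E1 !card_sum !card_ord.
exact: addIn.
Qed.

(* The operations on classes are computed on representatives; that they do not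
   depend on the choice is [TXC_operations_on_classes]. *)
Definition TXC : smc_data := {|
  ob := nat;
  hom := xc_tangle;
  idm := fun n => cls _ (id_diagram n);
  comp := fun m n p T2 T1 =>
    cls _ (comp_diagram (class_repr T2) (class_repr T1));
  unt := 0%N;
  tob := addn;
  tens := fun m n p q T1 T2 =>
    cls _ (tens_diagram (class_repr T1) (class_repr T2));
  braid := fun n m => cls _ (sym_diagram n m)
|}.

Definition TXC_operations_on_classes : Prop :=
  (forall m n p (T2 : tangle_diagram n p) (T1 : tangle_diagram m n),
     @comp TXC m n p (cls _ T2) (cls _ T1) = cls _ (comp_diagram T2 T1)) /\
  (forall m n p q (T1 : tangle_diagram m n) (T2 : tangle_diagram p q),
     @tens TXC m n p q (cls _ T1) (cls _ T2) = cls _ (tens_diagram T1 T2)).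

(* The points placed on the 1-manifold: tails of chords, heads of chords,
   diamonds. *)
Notation mark C D := (C + C + D)%type.
Notation Tail c := (inl (inl c)).
Notation Head c := (inl (inr c)).
Notation Dmd d := (inr d).

Section GaussDiagrams.
Variable R : realType.

(* The polarised 1-manifold X consists of m copies of the oriented interval
   [0, 1], numbered by the order of their starting points; [glast j] is the
   interval ending at the j-th end point.  A point of X is a pair
   (number of an interval, coordinate).  See [gauss_diagram_eq] for m = n. *)
Record gauss_diagram (m n : nat) := GaussDiagram {
  glast : 'I_n -> 'I_m;
  glast_bij : bijective glast;
  gchord : finType;
  gsign : gchord -> bool;
  gdia : finType;
  gdsign : gdia -> bool;
  gpos : mark gchord gdia -> 'I_m * R;
  gpos_inj : injective gpos;
  gpos_interior : forall a, 0 < (gpos a).2 < 1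
}.

Lemma gauss_diagram_eq m n (D : gauss_diagram m n) : m = n.
Proof. by have /bij_eq_card := glast_bij D; rewrite !card_ord. Qed.

Definition orientation_preserving_homeo (f : R -> R) : Prop :=
  exists g : R -> R,
    [/\ {within `[0, 1]%classic, continuous f} /\
        {within `[0, 1]%classic, continuous g},
        {homo f : x / x \in `[0, 1]} /\ {homo g : x / x \in `[0, 1]},
        {in `[0, 1], cancel f g} /\ {in `[0, 1], cancel g f} &
        {in `[0, 1] &, {homo f : x y / x < y}}].

(* Equality up to orientation-preserving homeomorphism of X respecting the
   orders of the starting and end points, hence preserving each interval. *)
Definition gauss_homeo (m n : nat) (D D' : gauss_diagram m n) : Prop :=
  exists (fc : gchord D -> gchord D') (fd : gdia D -> gdia D') (h : 'I_m -> R -> R),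
    [/\ glast D =1 glast D', bijective fc /\ bijective fd,
        (forall c, gsign (fc c) = gsign c) /\ (forall d, gdsign (fd d) = gdsign d),
        (forall i, orientation_preserving_homeo (h i)) &
        forall a : mark (gchord D) (gdia D),
          gpos (match a with
                | Tail c => Tail (fc c)
                | Head c => Head (fc c)
                | Dmd d => Dmd (fd d)
                end : mark (gchord D') (gdia D'))
          = ((gpos a).1, h (gpos a).1 (gpos a).2)].

Definition mark_letter (m n : nat) (D : gauss_diagram m n)
    (a : mark (gchord D) (gdia D)) : letter (gchord D) :=
  match a with
  | Tail c => Over c
  | Head c => Under c
  | Dmd d => if gdsign d then Rplus else Rminus
  end.

Definition gauss_word (m n : nat) (D : gauss_diagram m n) (i : 'I_m) :
    seq (letter (gchord D)) :=
  [seq mark_letter a |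
     a <- sort (fun a b => (gpos a).2 <= (gpos b).2)
            [seq a <- enum {: mark (gchord D) (gdia D)} | (gpos a).1 == i]].

(* Words with k holes, each hole occurring exactly once. *)
Definition holes_once (m k : nat) (C : Type) (W : 'I_m -> seq (letter C + 'I_k)) : Prop :=
  forall j : 'I_k,
    (\sum_(i < m) count (fun x => if x is inr j' then j' == j else false) (W i))%N = 1%N.

Definition fill_word (k : nat) (C : Type) (p : pattern k) (w : seq (letter C + 'I_k)) :
    seq (letter (C + plabel p)) :=
  flatten [seq match x with
               | inl l => [:: map_letter inl l]
               | inr j => map (map_letter inr) (tnth (pword p) j)
               end | x <- w].

(* The words of D are obtained by putting the words of p into the holes of W;
   s gives the signs of the chords not involved in p. *)
Definition gauss_reads (m n k : nat) (D : gauss_diagram m n) (C : finType)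
    (s : C -> bool) (W : 'I_m -> seq (letter C + 'I_k)) (p : pattern k) : Prop :=
  exists f : C + plabel p -> gchord D,
    [/\ bijective f,
        (forall x, gsign (f x) = match x with inl c => s c | inr c => psign c end) &
        forall i, gauss_word D i = map (map_letter f) (fill_word p (W i))].

Inductive gauss_move (m n : nat) (D D' : gauss_diagram m n) : Prop :=
| gmove_homeo of gauss_homeo D D'
| gmove_rule (k : nat) (p q : pattern k) (C : finType) (s : C -> bool)
    (W : 'I_m -> seq (letter C + 'I_k)) of
    gauss_rule p q & glast D =1 glast D' & holes_once W &
    gauss_reads D s W p & gauss_reads D' s W q.

Definition gauss_equiv (m n : nat) : gauss_diagram m n -> gauss_diagram m n -> Prop :=
  clos_refl_sym_trans _ (@gauss_move m n).

Definition xc_gauss (m n : nat) : Type := eqclass (@gauss_equiv m n).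

Definition void_pos (m : nat) (a : mark void void) : 'I_m * R :=
  match a with Tail c => of_void _ c | Head c => of_void _ c | Dmd d => of_void _ d end.

Lemma void_pos_inj m : injective (@void_pos m).
Proof. by case=> [[[]|[]]|[]]. Qed.

Lemma void_pos_interior m a : 0 < (@void_pos m a).2 < 1.
Proof. by case: a => [[[]|[]]|[]]. Qed.

Lemma id_bij n : bijective (@id 'I_n).
Proof. by exists id. Qed.

Lemma swap_bij n m : bijective (@swap_ord m n).
Proof. by exists (@swap_ord n m); apply: swap_ordK. Qed.

Definition id_gauss (n : nat) : gauss_diagram n n :=
  GaussDiagram (@id_bij n) (fun=> true) (fun=> true)
    (@void_pos_inj n) (@void_pos_interior n).

(* The interval from i ends at [swap_ord i], so the interval ending at j is the
   one starting at its inverse image. *)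
Definition sym_gauss (n m : nat) : gauss_diagram (n + m) (m + n) :=
  GaussDiagram (@swap_bij n m) (fun=> true) (fun=> true)
    (@void_pos_inj (n + m)) (@void_pos_interior (n + m)).

Definition mark_split (C1 C2 D1 D2 : Type) (a : mark (C1 + C2) (D1 + D2)) :
    mark C1 D1 + mark C2 D2 :=
  match a with
  | Tail (inl c) => inl (Tail c) | Tail (inr c) => inr (Tail c)
  | Head (inl c) => inl (Head c) | Head (inr c) => inr (Head c)
  | Dmd (inl d) => inl (Dmd d)   | Dmd (inr d) => inr (Dmd d)
  end.

Lemma mark_split_inj C1 C2 D1 D2 : injective (@mark_split C1 C2 D1 D2).
Proof. by move=> [[[a|a]|[a|a]]|[a|a]] [[[b|b]|[b|b]]|[b|b]] //= [->]. Qed.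

Section Operations.
Variables (m n p q : nat).

(* Glued intervals are rescaled to [0, 1]: first half for D, second for E. *)
Definition comp_pos (E : gauss_diagram n p) (D : gauss_diagram m n)
    (a : mark (gchord D + gchord E) (gdia D + gdia E)) : 'I_m * R :=
  match mark_split a with
  | inl a => ((gpos a).1, (gpos a).2 / 2)
  | inr a => (glast D (gpos a).1, (1 + (gpos a).2) / 2)
  end.

Lemma comp_pos_inj E D : injective (@comp_pos E D).
Proof.
move=> a b; rewrite /comp_pos => H; apply: mark_split_inj; move: H.
case: (mark_split a) (mark_split b) => [x|x] [y|y].
- case=> E1 E2; congr inl; apply: (@gpos_inj _ _ D).
  by apply/eqP; rewrite -pair_eqE /= E1 eqxx /=; apply/eqP; lra.
- case=> _ E2; exfalso; have /andP[? ?] := gpos_interior x; have /andP[? ?] := gpos_interior y; lra.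
- case=> _ E2; exfalso; have /andP[? ?] := gpos_interior x; have /andP[? ?] := gpos_interior y; lra.
- case=> E1 E2; congr inr; apply: (@gpos_inj _ _ E).
  have /bij_inj/(_ _ _ E1) {}E1 := glast_bij D.
  by apply/eqP; rewrite -pair_eqE /= E1 eqxx /=; apply/eqP; lra.
Qed.

Lemma comp_pos_interior E D a : 0 < (@comp_pos E D a).2 < 1.
Proof.
rewrite /comp_pos; case: (mark_split a) => x /=;
  by have /andP[? ?] := gpos_interior x; lra.
Qed.

Lemma comp_last_bij (E : gauss_diagram n p) (D : gauss_diagram m n) :
  bijective (fun j => glast D (glast E j)).
Proof. exact: bij_comp (glast_bij D) (glast_bij E). Qed.

Definition comp_gauss (E : gauss_diagram n p) (D : gauss_diagram m n) :
    gauss_diagram m p :=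
  GaussDiagram (comp_last_bij E D)
    (fun c => match c with inl c => gsign c | inr c => gsign c end)
    (fun d => match d with inl d => gdsign d | inr d => gdsign d end)
    (@comp_pos_inj E D) (@comp_pos_interior E D).

Definition tens_pos (D : gauss_diagram m n) (E : gauss_diagram p q)
    (a : mark (gchord D + gchord E) (gdia D + gdia E)) : 'I_(m + p) * R :=
  match mark_split a with
  | inl a => (lshift p (gpos a).1, (gpos a).2)
  | inr a => (rshift m (gpos a).1, (gpos a).2)
  end.

Lemma tens_pos_inj D E : injective (@tens_pos D E).
Proof.
move=> a b; rewrite /tens_pos => H; apply: mark_split_inj; move: H.
case: (mark_split a) (mark_split b) => [x|x] [y|y] [].
- move=> /ord_inj E1 E2; congr inl; apply: (@gpos_inj _ _ D).
  by apply/eqP; rewrite -pair_eqE /= E1 E2 !eqxx.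
- by move=> E1; have := ltn_ord (gpos x).1; rewrite E1 ltnNge leq_addr.
- by move=> E1; have := ltn_ord (gpos y).1; rewrite -E1 ltnNge leq_addr.
- move=> /addnI/ord_inj E1 E2; congr inr; apply: (@gpos_inj _ _ E).
  by apply/eqP; rewrite -pair_eqE /= E1 E2 !eqxx.
Qed.

Lemma tens_pos_interior D E a : 0 < (@tens_pos D E a).2 < 1.
Proof.
by rewrite /tens_pos; case: (mark_split a) => x /=; apply: gpos_interior.
Qed.

Definition tens_last (D : gauss_diagram m n) (E : gauss_diagram p q)
    (j : 'I_(n + q)) : 'I_(m + p) :=
  match fintype.split j with
  | inl j => lshift p (glast D j)
  | inr j => rshift m (glast E j)
  end.

Lemma tens_last_bij D E : bijective (@tens_last D E).
Proof.
case: (glast_bij D) (glast_bij E) => g gK Kg [h hK Kh].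
exists (fun i => match fintype.split i with
  | inl i => lshift q (g i) | inr i => rshift n (h i) end) => i.
  rewrite /tens_last; case: (fintype.splitP i) => k Ek.
    by rewrite (unsplitK (inl _)) gK; apply: val_inj.
  by rewrite (unsplitK (inr _)) hK; apply: val_inj.
rewrite /tens_last; case: (fintype.splitP i) => k Ek.
  by rewrite (unsplitK (inl _)) Kg; apply: val_inj.
by rewrite (unsplitK (inr _)) Kh; apply: val_inj.
Qed.

Definition tens_gauss (D : gauss_diagram m n) (E : gauss_diagram p q) :
    gauss_diagram (m + p) (n + q) :=
  GaussDiagram (@tens_last_bij D E)
    (fun c => match c with inl c => gsign c | inr c => gsign c end)
    (fun d => match d with inl d => gdsign d | inr d => gdsign d end)
    (@tens_pos_inj D E) (@tens_pos_interior D E).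

End Operations.

Definition GDXC : smc_data := {|
  ob := nat;
  hom := xc_gauss;
  idm := fun n => cls _ (id_gauss n);
  comp := fun m n p D2 D1 =>
    cls _ (comp_gauss (class_repr D2) (class_repr D1));
  unt := 0%N;
  tob := addn;
  tens := fun m n p q D1 D2 =>
    cls _ (tens_gauss (class_repr D1) (class_repr D2));
  braid := fun n m => cls _ (sym_gauss n m)
|}.

Definition GDXC_operations_on_classes : Prop :=
  (forall m n p (D2 : gauss_diagram n p) (D1 : gauss_diagram m n),
     @comp GDXC m n p (cls _ D2) (cls _ D1) = cls _ (comp_gauss D2 D1)) /\
  (forall m n p q (D1 : gauss_diagram m n) (D2 : gauss_diagram p q),
     @tens GDXC m n p q (cls _ D1) (cls _ D2) = cls _ (tens_gauss D1 D2)).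

(* D is the Gauss diagram of T.  The i-th interval is the strand starting at the
   i-th vertex of V_out.  That the points read along it spell the word of the
   strand says that tails, heads and diamonds come from overpasses, underpasses
   and edges of rotation number +1 or -1, in the order in which these are met. *)
Definition gauss_diagram_of (m n : nat) (T : tangle_diagram m n)
    (D : gauss_diagram m n) : Prop :=
  exists f : xcross T -> gchord D,
    [/\ bijective f, (forall c, gsign (f c) = xsign c) &
        forall i s j, @is_strand _ _ T i s j ->
          glast D j = i /\ gauss_word D i = map (map_letter f) (strand_word s)].

End GaussDiagrams.

(* Main.v *)
(** A Gauss diagram is determined up to homeomorphism by its gluing permutation and
    the words read along its intervals, and every family of words in which each
    chord has one tail and one head occurs.  It therefore suffices to show that two
    XC-tangle diagrams are equivalent if and only if their Gauss diagrams are.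

    A tangle diagram is determined up to isomorphism by the sequences of
    (rotation number, type of target) along its strands.  If two diagrams have the
    same words, these sequences acquire a common refinement after splitting edges
    by Omega0r, so that the diagrams are equivalent.  A move on tangles replaces the
    filling of a graph with holes, and reading off the words of that graph, with
    the holes as extra letters, gives the corresponding move on Gauss diagrams.
    Conversely words with holes are realized by an explicit graph whose edges are
    the positions in the words; the cancellation of opposite diamonds, which is
    not a move on tangles, comes from splitting a trivial edge.

    The axioms are checked on words for Gauss diagrams and transported to
    tangles along the resulting bijection. *)

Require Import Defs.
From HB Require Import structures.
From mathcomp Require Import all_boot all_order all_algebra.
From mathcomp Require Import all_classical all_reals topology normedtype.
From mathcomp Require Import ring lra zify.
From Stdlib Require Import Relation_Operators.

Set Implicit Arguments.
Unset Strict Implicit.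
Unset Printing Implicit Defensive.

Import Order.TTheory GRing.Theory Num.Theory.
Import numFieldNormedType.Exports.

Local Open Scope classical_set_scope.
Local Open Scope ring_scope.

(** * Bijections, classes, words and occurrences *)

(** The two kinds of diagrams name different things: a tangle diagram has edges and bivalent
    vertices, a Gauss diagram has diamonds and real coordinates, and the words name crossings only.
    All comparisons therefore go by place. In a diagram each crossing letter, each edge and each
    mark occurs exactly once on the strands or intervals, so entries at equal places correspond
    bijectively, and this supplies the maps that the words do not give.

    Merging two edges is subject to a bound on the sum of their rotation numbers, whereas any edge
    can be subdivided. Diagrams with equal words are for this reason compared by going up to a
    common subdivision, not down to a normal form.

    The passage from tangles to Gauss diagrams is handled as a relation between representatives,
    with total and surjective projections; a map appears only after passing to classes. *)

Lemma rel_bij (A B : Type) (r : A -> B -> Prop) :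
  (forall a, exists b, r a b) -> (forall b, exists a, r a b) ->
  (forall a b b', r a b -> r a b' -> b = b') ->
  (forall a a' b, r a b -> r a' b -> a = a') ->
  exists f, bijective f /\ forall a, r a (f a).
Proof.
move=> /boolp.choice[f rf] /boolp.choice[g rg] rfun rinj; exists f; split=> //.
by exists g => x; [apply: rinj (rg _) (rf _)|apply: rfun (rf _) (rg _)].
Qed.

Lemma inj_surj_bij (A B : Type) (f : A -> B) :
  injective f -> (forall b, exists a, f a = b) -> bijective f.
Proof.
by move=> finj /boolp.choice[g gK]; exists g => // x; apply: finj; rewrite gK.
Qed.

Lemma bij_inv (A B : Type) (f : A -> B) :
  bijective f -> exists g, [/\ bijective g, cancel f g & cancel g f].
Proof. by case=> g fK gK; exists g; split=> //; exists f. Qed.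

Lemma sum_bij (A A' B B' : Type) (f : A -> A') (g : B -> B') :
  bijective f -> bijective g ->
  bijective (fun x : A + B => match x with inl a => inl (f a) | inr b => inr (g b) end).
Proof.
case=> f' fK Kf [g' gK Kg].
by exists (fun x => match x with inl a => inl (f' a) | inr b => inr (g' b) end);
  case=> x; rewrite ?fK ?Kf ?gK ?Kg.
Qed.

Lemma sig_eq (A : Type) (P : A -> Prop) (u v : {x | P x}) : sval u = sval v -> u = v.
Proof.
case: u v => x px [y py] /= E; rewrite {}E in px *.
by rewrite (Prop_irrelevance px py).
Qed.

Section Classes.
Variables (T : Type) (r : T -> T -> Prop).

Lemma class_reprK (c : eqclass r) : cls r (class_repr c) = c.
Proof.
apply: sig_eq; rewrite /class_repr /=; by case: (cid _) => x /= ->.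
Qed.

Variable m : T -> T -> Prop.
Hypothesis rE : r = clos_refl_sym_trans _ m.

(** A class is the predicate [r x] itself, so equal classes can be evaluated at y; the converse uses
    that a closure is symmetric and transitive. *)
Lemma clsP x y : cls r x = cls r y <-> r x y.
Proof.
split; first by case=> /(congr1 (fun f => f y)) ->; rewrite rE; apply: rst_refl.
move=> rxy; apply: sig_eq; rewrite /= rE; rewrite rE in rxy.
apply/funext => z; apply/propext; split=> h.
  exact: rst_trans (rst_sym _ _ _ _ rxy) h.
exact: rst_trans rxy h.
Qed.

End Classes.

Lemma clos_map (A B : Type) (r : A -> A -> Prop) (r' : B -> B -> Prop) (f : A -> B) :
  (forall x y, r x y -> clos_refl_sym_trans _ r' (f x) (f y)) ->
  forall x y, clos_refl_sym_trans _ r x y -> clos_refl_sym_trans _ r' (f x) (f y).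
Proof.
move=> h x y; elim=> {x y} [x y /h//|x|x y _ ?|x y z _ ? _ ?].
- exact: rst_refl.
- exact: rst_sym.
- by apply: rst_trans; eassumption.
Qed.

(** An encoding into a sum type, from which letters inherit a decidable equality. *)
Definition letter_code (C : Type) (l : letter C) : C + C + bool :=
  match l with
  | Over c => inl (inl c) | Under c => inl (inr c) | Rplus => inr true | Rminus => inr false
  end.

Definition letter_decode (C : Type) (x : C + C + bool) : letter C :=
  match x with
  | inl (inl c) => Over c | inl (inr c) => Under c
  | inr true => Rplus | inr false => Rminus
  end.

Lemma letter_codeK (C : Type) : cancel (@letter_code C) (@letter_decode C).
Proof. by case. Qed.

HB.instance Definition _ (C : eqType) :=
  Equality.copy (letter C) (can_type (@letter_codeK C)).

Lemma map_letter_comp (A B C : Type) (f : A -> B) (g : B -> C) l :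
  map_letter g (map_letter f l) = map_letter (g \o f) l.
Proof. by case: l. Qed.

Lemma map_letter_id (A : Type) (f : A -> A) l : f =1 id -> map_letter f l = l.
Proof. by case: l => //= c ->. Qed.

Lemma map_letter_inj (A B : Type) (f : A -> B) : injective f -> injective (map_letter f).
Proof. by move=> fi [c|c||] [d|d||] //= [/fi ->]. Qed.

Lemma map_map_letter (A B C : Type) (f : A -> B) (g : B -> C) s :
  map (map_letter g) (map (map_letter f) s) = map (map_letter (g \o f)) s.
Proof. by rewrite -map_comp; apply: eq_map => l /=; rewrite map_letter_comp. Qed.

Lemma map_map_letter_id (A : Type) (f : A -> A) s : f =1 id -> map (map_letter f) s = s.
Proof. by move=> e; rewrite -[RHS]map_id; apply: eq_map => l; apply: map_letter_id. Qed.

Lemma eq_map_letter (A B : Type) (f g : A -> B) : f =1 g -> map_letter f =1 map_letter g.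
Proof. by move=> e [c|c||] //=; rewrite e. Qed.

Lemma eq_map_map_letter (A B : Type) (f g : A -> B) s :
  f =1 g -> map (map_letter f) s = map (map_letter g) s.
Proof. by move=> e; apply: eq_map; apply: eq_map_letter. Qed.

(** Occurrences are counted over the whole family, so that both the index of the word and the
    position in it are determined. *)
Definition once (I : finType) (T : eqType) (W : I -> seq T) (x : T) : Prop :=
  (\sum_i count_mem x (W i) = 1)%N.

Section Once.
Variables (I : finType) (T : eqType) (W : I -> seq T) (x : T).

Lemma count_memE (s : seq T) p : onth s p = Some x ->
  count_mem x s = (count_mem x (take p s) + (count_mem x (drop p.+1 s)).+1)%N.
Proof.
move=> h; have lt : (p < size s)%N by rewrite -onthTE h.
rewrite -{1}(cat_take_drop p s) count_cat (drop_nth x lt) /= (onth_nth x _ _ _ h) eqxx.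
by [].
Qed.

Lemma once_pos : once W x -> exists i p, onth (W i) p = Some x.
Proof.
rewrite /once => h; have [i hi] : exists i, (0 < count_mem x (W i))%N.
  apply: contrapT => h'; move: h; rewrite big1 // => i _.
  by apply/eqP; rewrite -leqn0 leqNgt; apply/negP => ?; apply: h'; exists i.
by move: hi; rewrite -has_count has_pred1 => /onthP[p hp]; exists i, p.
Qed.

(** Occurrences in two different words would contribute 2 to the sum; within one word, the later
    occurrence would survive in the part after the earlier one and be counted again. *)
Lemma once_uniq i p i' p' : once W x ->
  onth (W i) p = Some x -> onth (W i') p' = Some x -> i = i' /\ p = p'.
Proof.
rewrite /once => h hp hp'; have /eqP ei : i == i'.
  apply/negPn/negP => ne; move: h; rewrite (bigD1 i) //= (bigD1 i') 1?eq_sym //=.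
  by rewrite (count_memE hp) (count_memE hp'); lia.
subst i'; split=> //; wlog lt : p p' hp hp' / (p < p')%N.
  by move=> w; case: (ltngtP p p') => // lt; [|symmetry]; exact: w lt.
have : (count_mem x (W i) <= 1)%N by rewrite -h (bigD1 i) //= leq_addr.
rewrite (count_memE hp) => le.
have : x \in drop p.+1 (W i).
  by apply/onthP; exists (p' - p.+1)%N; rewrite -[LHS]/(onth _ _) onthE map_drop nth_drop
    subnKC // -onthE.
by rewrite -has_pred1 has_count; lia.
Qed.

End Once.

Lemma once_mem_uniq (I : finType) (T : eqType) (W : I -> seq T) x i i' :
  once W x -> x \in W i -> x \in W i' -> i = i'.
Proof.
by move=> h /onthP[p hp] /onthP[p' hp']; have [] := once_uniq h hp hp'.
Qed.

Lemma eq_once (I : finType) (T T' : eqType) (W : I -> seq T) (W' : I -> seq T') x x' :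
  (forall i, count_mem x (W i) = count_mem x' (W' i)) -> once W x -> once W' x'.
Proof. by move=> e; rewrite /once => <-; apply: eq_bigr => i _; rewrite e. Qed.

Lemma once_at (I : finType) (T : eqType) (W : I -> seq T) x i0 :
  (forall i, count_mem x (W i) = (i == i0)) -> once W x.
Proof.
move=> h; rewrite /once (bigD1 i0) //= h eqxx big1 // => i /negbTE ne.
by rewrite h ne.
Qed.

Lemma count_inr_inl (A B : eqType) (s : seq A) (b : B) :
  count_mem (inr b : A + B) (map inl s) = 0%N.
Proof. by rewrite count_map; elim: s. Qed.

Lemma sum_count_eq (T : eqType) (x : T) s : (\sum_(y <- s) (y == x) = count_mem x s)%N.
Proof. by rewrite -sum1_count [RHS]big_mkcond; apply: eq_bigr => y _ /=; case: (y == x). Qed.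

Lemma count_flatten_map (S T : Type) (a : pred T) (g : S -> seq T) s :
  count a (flatten (map g s)) = (\sum_(x <- s) count a (g x))%N.
Proof. by rewrite count_flatten sumnE !big_map. Qed.

Lemma holes_onceP (m k : nat) (C : eqType) (W : 'I_m -> seq (letter C + 'I_k)) :
  holes_once W <-> forall j, once W (inr j).
Proof.
have e (j : 'I_k) : (fun x : letter C + 'I_k => if x is inr j' then j' == j else false)
    =1 pred1 (inr j) by case.
by split=> h j; have := h j; rewrite /once => <-; apply: eq_bigr => i _; rewrite (eq_count (e j)).
Qed.

Lemma sum_count_inr (S : eqType) (Y : finType) (F : S + Y -> nat) (v : seq (S + Y)) :
  (\sum_(x <- v) F x =
   \sum_(x <- v) (if x is inl _ then F x else 0) + \sum_y F (inr y) * count_mem (inr y) v)%N.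
Proof.
elim: v => [|x v ih]; first by rewrite !big_nil /= big1 // => y _; rewrite muln0.
rewrite !big_cons ih; case: x => [l|y] /=.
  by rewrite -addnA; congr (_ + (_ + _))%N; apply: eq_bigr.
rewrite add0n addnCA; congr (_ + _)%N; rewrite (bigD1 y) //= [in RHS](bigD1 y) //= eqxx.
rewrite mulnDr muln1 addnA; congr (_ + _)%N; apply: eq_bigr => z ne.
by congr (_ * _)%N; case: eqP => // -[e]; rewrite e eqxx in ne.
Qed.

(** After exchanging the sums, the total multiplicity of each y is 1, so its contribution no longer
    depends on where it sits. With F counting a letter in the filling of an item, this computes
    occurrences in words whose holes have been filled. *)
Lemma sum_once_inr (I : finType) (S : eqType) (Y : finType)
    (V : I -> seq (S + Y)) (F : S + Y -> nat) :
  (forall y, once V (inr y)) ->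
  (\sum_i \sum_(x <- V i) F x =
   \sum_i \sum_(x <- V i) (if x is inl _ then F x else 0) + \sum_y F (inr y))%N.
Proof.
move=> h; under eq_bigr => i _ do rewrite sum_count_inr.
rewrite big_split /= exchange_big /=; congr (_ + _)%N.
by apply: eq_bigr => y _; rewrite -big_distrr /= h muln1.
Qed.

Lemma map_flatten_map (A B C : Type) (f : A -> B) (g : C -> seq A) s :
  map f (flatten (map g s)) = flatten (map (map f \o g) s).
Proof. by rewrite map_flatten -map_comp. Qed.

Lemma flatten_flatten_map (A B C : Type) (f : A -> seq B) (g : C -> seq A) s :
  flatten (map f (flatten (map g s))) = flatten (map (fun c => flatten (map f (g c))) s).
Proof. by elim: s => //= c s ih; rewrite map_cat flatten_cat ih. Qed.

Lemma flatten_map_seq1 (A B : Type) (f : A -> B) s :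
  flatten [seq [:: f x] | x <- s] = map f s.
Proof. by elim: s => //= x s ->. Qed.

(** * Matching two families of words by position *)

Section Aligned.
Variables (I : finType) (T T' : eqType) (W : I -> seq T) (W' : I -> seq T').
Hypotheses (W1 : forall x, once W x) (W1' : forall x, once W' x).
Hypothesis sizeW : forall i, size (W i) = size (W' i).

(** Under the hypotheses of the section this is the graph of a bijection. It produces the maps on
    diamonds and on edges when only words or edge data are known to agree. *)
Definition aligned (x : T) (x' : T') : Prop :=
  exists i p, onth (W i) p = Some x /\ onth (W' i) p = Some x'.

Lemma aligned_total x : exists x', aligned x x'.
Proof.
have [i [p h]] := once_pos (W1 x).
have : onth (W' i) p by rewrite onthTE -sizeW -onthTE h.
by case h' : (onth _ _) => [x'|//] _; exists x', i, p.
Qed.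

Lemma aligned_surj x' : exists x, aligned x x'.
Proof.
have [i [p h]] := once_pos (W1' x').
have : onth (W i) p by rewrite onthTE sizeW -onthTE h.
by case h' : (onth _ _) => [x|//] _; exists x, i, p.
Qed.

Lemma aligned_fun x y y' : aligned x y -> aligned x y' -> y = y'.
Proof.
move=> [i [p [h1 h2]]] [i' [p' [h1' h2']]].
by have [ei ep] := once_uniq (W1 x) h1 h1'; subst; move: h2'; rewrite h2 => -[].
Qed.

Lemma aligned_inj x x' y : aligned x y -> aligned x' y -> x = x'.
Proof.
move=> [i [p [h1 h2]]] [i' [p' [h1' h2']]].
by have [ei ep] := once_uniq (W1' y) h2 h2'; subst; move: h1'; rewrite h1 => -[].
Qed.

End Aligned.

(** * Gauss diagrams and their words *)

Section PiecewiseLinear.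
Variable R : realType.

(* The piecewise linear map that is the identity up to a, has vertices at a and
   b, and sends b to c and 1 to 1. *)
Definition kink (a b c x : R) : R :=
  x + ((c - a) / (b - a) - 1) * Num.max (x - a) 0
    + ((1 - c) / (1 - b) - (c - a) / (b - a)) * Num.max (x - b) 0.

Section Kink.
Variables a b c : R.
Hypothesis abc : [/\ a < b, b < 1, a < c & c < 1].

Lemma kink_low x : x <= a -> kink a b c x = x.
Proof.
have [ab b1 ac c1] := abc.
move=> h; rewrite /kink.
have -> : Num.max (x - a) 0 = 0 by apply: max_r; lra.
have -> : Num.max (x - b) 0 = 0 by apply: max_r; lra.
by rewrite !mulr0 !addr0.
Qed.

Lemma kink_mid x : a <= x -> x <= b -> kink a b c x = a + (c - a) / (b - a) * (x - a).
Proof.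
have [ab b1 ac c1] := abc.
move=> h1 h2; rewrite /kink.
have -> : Num.max (x - a) 0 = x - a by apply: max_l; lra.
have -> : Num.max (x - b) 0 = 0 by apply: max_r; lra.
by rewrite mulr0 addr0; ring.
Qed.

Lemma kink_high x : b <= x -> kink a b c x = c + (1 - c) / (1 - b) * (x - b).
Proof.
have [ab b1 ac c1] := abc.
move=> h; rewrite /kink.
have -> : Num.max (x - a) 0 = x - a by apply: max_l; lra.
have -> : Num.max (x - b) 0 = x - b by apply: max_l; lra.
have : b - a != 0 by apply/eqP; lra.
have : 1 - b != 0 by apply/eqP; lra.
by move=> ? ?; field; apply/andP.
Qed.

Lemma kink_vertex : kink a b c b = c.
Proof. by rewrite kink_high // subrr mulr0 addr0. Qed.

Lemma kink_one : kink a b c 1 = 1.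
Proof.
have [ab b1 ac c1] := abc; rewrite kink_high ?(ltW b1) // divfK; first by rewrite subrKC.
by apply/eqP; lra.
Qed.

Lemma kink_homo : {homo kink a b c : x y / x < y}.
Proof.
have [ab b1 ac c1] := abc.
have s1 : 0 < (c - a) / (b - a) by apply: divr_gt0; lra.
have s2 : 0 < (1 - c) / (1 - b) by apply: divr_gt0; lra.
(* The middle piece reaches c at b, which compares points on the two sides of b. *)
have e : (c - a) / (b - a) * (b - a) = c - a by rewrite divfK //; apply/eqP; lra.
move=> x y xy; case: (leP x a) => xa; [|case: (leP x b) => xb].
- rewrite (kink_low xa); case: (leP y a) => ya; [by rewrite kink_low|].
  case: (leP y b) => yb.
    rewrite (@kink_mid y) ?(ltW ya) //.
    have : 0 < (c - a) / (b - a) * (y - a) by rewrite mulr_gt0 // subr_gt0.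
    by lra.
  rewrite (@kink_high y) ?(ltW yb) //.
  have : 0 < (1 - c) / (1 - b) * (y - b) by rewrite mulr_gt0 // subr_gt0.
  by lra.
- rewrite (@kink_mid x) ?(ltW xa) //; case: (leP y b) => yb.
    by rewrite (@kink_mid y) ?ler_ltD ?ltr_pM2l //; lra.
  rewrite (@kink_high y) ?(ltW yb) //.
  have : 0 < (1 - c) / (1 - b) * (y - b) by rewrite mulr_gt0 // subr_gt0.
  have : (c - a) / (b - a) * (x - a) <= (c - a) / (b - a) * (b - a).
    by rewrite ler_pM2l //; lra.
  by rewrite e; lra.
- by rewrite !kink_high ?ler_ltD ?ltr_pM2l //; lra.
Qed.

Lemma kink_continuous : continuous (kink a b c).
Proof.
have [ab b1 ac c1] := abc.
have cmax (d : R) : continuous (fun x : R => Num.max (x - d) 0).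
  move=> x; apply: (@continuous_max _ _ (fun x : R => x - d) (fun=> 0)).
    by apply: continuousB; [exact: cvg_id|exact: cvg_cst].
  exact: cvg_cst.
move=> x; rewrite /continuous_at /kink; apply: cvgD; [apply: cvgD; first exact: cvg_id|];
  by apply: cvgM; [exact: cvg_cst|exact: cmax].
Qed.

End Kink.

(** Exchanging the vertex b with its image c inverts both slopes; monotonicity tells on which piece
    of [kink a c b] the image of x lies. *)
Lemma kinkK a b c x : a < b -> b < 1 -> a < c -> c < 1 -> kink a c b (kink a b c x) = x.
Proof.
move=> ab b1 ac c1; have abc := And4 ab b1 ac c1; have hom := kink_homo abc.
have ba : b - a != 0 by apply/eqP; lra.
have ca : c - a != 0 by apply/eqP; lra.
have bb : 1 - b != 0 by apply/eqP; lra.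
have cc : 1 - c != 0 by apply/eqP; lra.
have e : kink a b c a = a by rewrite kink_low.
case: (leP x a) => xa; first by rewrite !kink_low.
have ka : a <= kink a b c x by rewrite -[leLHS]e ltW // hom.
have kb := kink_vertex abc.
case: (leP x b) => xb.
  have kc : kink a b c x <= c.
    by rewrite -[leRHS]kb; move: xb; rewrite le_eqVlt => /orP[/eqP->//|/hom/ltW].
  rewrite (@kink_mid a c b) // (@kink_mid a b c) ?(ltW xa) //.
  by field; apply/andP.
have kc : c <= kink a b c x by rewrite -[leLHS]kb ltW // hom.
rewrite (@kink_high a c b) // (@kink_high a b c) ?(ltW xb) //.
by field; apply/andP.
Qed.

(* Global homeomorphisms of the line fixing 0 and 1: unlike those of the interval
   they compose without domain conditions. *)
Definition line_homeo (h : R -> R) : Prop :=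
  exists g : R -> R, [/\ continuous h /\ continuous g, cancel h g /\ cancel g h,
    {homo h : x y / x < y} & h 0 = 0 /\ h 1 = 1].

Lemma line_homeo_comp h k : line_homeo h -> line_homeo k -> line_homeo (k \o h).
Proof.
move=> [g [[ch cg] [gK hK] hh [h0 h1]]] [l [[ck cl] [lK kK] hk [k0 k1]]].
exists (g \o l); split.
- by split=> x; apply: continuous_comp; [apply: ch|apply: ck|apply: cl|apply: cg].
- by split; apply: can_comp.
- by move=> x y /hh/hk.
- by rewrite /= h0 h1.
Qed.

Lemma line_homeo_interval h : line_homeo h -> orientation_preserving_homeo h.
Proof.
move=> [g [[ch cg] [gK hK] hh [h0 h1]]]; exists g.
have hle : {homo h : x y / x <= y}.
  by move=> x y; rewrite le_eqVlt => /orP[/eqP->//|/hh/ltW].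
have gle : {homo g : x y / x <= y}.
  by move=> x y xy; rewrite leNgt; apply/negP => /hh; rewrite !hK ltNge xy.
have g0 : g 0 = 0 by rewrite -[in LHS]h0 gK.
have g1 : g 1 = 1 by rewrite -[in LHS]h1 gK.
split.
- by split; apply: continuous_subspaceT.
- split=> x; rewrite !in_itv /= => /andP[x0 x1].
    by have := hle _ _ x0; have := hle _ _ x1; rewrite h0 h1 => -> ->.
  by have := gle _ _ x0; have := gle _ _ x1; rewrite g0 g1 => -> ->.
- by split=> x _; [apply: gK|apply: hK].
- by move=> x y _ _; apply: hh.
Qed.

Lemma line_homeo_kink a b c : 0 <= a -> a < b -> b < 1 -> a < c -> c < 1 ->
  line_homeo (kink a b c).
Proof.
move=> a0 ab b1 ac c1; exists (kink a c b); split.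
- by split; apply: kink_continuous.
- by split=> x; rewrite kinkK.
- exact: kink_homo (And4 ab b1 ac c1).
- by rewrite kink_low // kink_one.
Qed.

(** The points are moved into place from left to right, one kink for each. Carrying the clause that
    h fixes everything up to a through the induction ensures that later kinks do not disturb the
    points already placed. *)
Lemma line_homeo_seq (a : R) (xs ys : seq R) : 0 <= a -> size xs = size ys ->
  path <%R a xs -> path <%R a ys -> all (< 1) xs -> all (< 1) ys ->
  exists h, [/\ line_homeo h, forall x, x <= a -> h x = x & map h xs = ys].
Proof.
elim: ys a xs => [|y ys ih] a [|x xs] //= a0.
  move=> _ _ _ _ _; exists id; split=> //; exists id; split=> //.
  by split=> x; apply: cvg_id.
move=> [sz] /andP[ax pxs] /andP[ay pys] /andP[x1 xs1] /andP[y1 ys1].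
have abc := And4 ax x1 ay y1; have hom := kink_homo abc.
have kx := kink_vertex abc.
have [||||h [hl hid hm]] := ih y (map (kink a x y) xs) _ _ _ pys _ ys1.
- by rewrite (le_trans a0) // ltW.
- by rewrite size_map.
- by rewrite -[X in path _ X]kx path_map; apply: sub_path pxs => ? ? /= /hom.
- rewrite all_map; apply: sub_all xs1 => z /= z1.
  by rewrite -(kink_one abc); apply: hom.
exists (h \o kink a x y); split.
- by apply: line_homeo_comp => //; apply: line_homeo_kink.
- by move=> z za /=; rewrite kink_low // hid // (le_trans za) // ltW.
- by rewrite /= kx hid // map_comp hm.
Qed.

End PiecewiseLinear.

(** * Gauss diagrams up to homeomorphism and their words *)

Section GaussWords.
Variable R : realType.

Notation gmark D := (mark (gchord D) (gdia D)).

Definition map_mark (C C' D D' : Type) (f : C -> C') (g : D -> D') (a : mark C D) :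
    mark C' D' :=
  match a with Tail c => Tail (f c) | Head c => Head (f c) | Dmd d => Dmd (g d) end.

Lemma map_mark_bij (C C' D D' : Type) (f : C -> C') (g : D -> D') :
  bijective f -> bijective g -> bijective (map_mark f g).
Proof.
case=> f' fK Kf [g' gK Kg].
by exists (map_mark f' g'); case=> [[c|c]|d] /=; rewrite ?fK ?gK ?Kf ?Kg.
Qed.

Section OneDiagram.
Variables (m n : nat) (D : gauss_diagram R m n).

(** The sorted list behind [gauss_word], kept before marks become letters: as letters, diamonds of
    equal sign can no longer be told apart. *)
Definition gseq (i : 'I_m) : seq (gmark D) :=
  sort (fun a b => (gpos a).2 <= (gpos b).2)
    [seq a <- enum {: gmark D} | (gpos a).1 == i].

Lemma gauss_wordE i : gauss_word D i = map (@mark_letter _ _ _ D) (gseq i).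
Proof. by []. Qed.

Lemma mem_gseq i a : (a \in gseq i) = ((gpos a).1 == i).
Proof. by rewrite mem_sort mem_filter mem_enum andbT. Qed.

Lemma gpos2_inj i a b : (gpos a).1 == i -> (gpos b).1 == i ->
  (gpos a).2 = (gpos b).2 -> a = b :> gmark D.
Proof.
move=> /eqP ea /eqP eb e2; apply: (@gpos_inj _ _ _ D).
by rewrite [LHS]surjective_pairing [RHS]surjective_pairing ea eb e2.
Qed.

Lemma gseq_uniq i : uniq (gseq i).
Proof. by rewrite sort_uniq filter_uniq // enum_uniq. Qed.

Lemma gseq_sorted i : sorted <%R [seq (gpos a).2 | a <- gseq i].
Proof.
rewrite lt_sorted_uniq_le map_inj_in_uniq ?gseq_uniq /=; last first.
  by move=> a b; rewrite !mem_gseq; apply: gpos2_inj.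
by rewrite sorted_map; apply: sort_sorted => a b; apply: le_total.
Qed.

(** Marks on one interval have distinct coordinates, so sorting has a single outcome. To compute a
    word it is enough to exhibit an increasing list of the right marks. *)
Lemma gseq_eq i (s : seq (gmark D)) :
  sorted <%R [seq (gpos a).2 | a <- s] -> (forall a, (a \in s) = ((gpos a).1 == i)) ->
  gseq i = s.
Proof.
rewrite lt_sorted_uniq_le => /andP[us ss] ms.
have {}us := map_uniq us; rewrite sorted_map in ss.
have tr : transitive (fun a b : gmark D => (gpos a).2 <= (gpos b).2).
  by move=> b a c; apply: le_trans.
rewrite -[RHS](sorted_sort tr ss); apply/perm_sort_inP.
- by move=> a b _ _; apply: le_total.
- by move=> a b c _ _ _; apply: tr.
- move=> a b; rewrite !mem_filter => /andP[ha _] /andP[hb _] /le_anti.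
  exact: gpos2_inj ha hb.
- apply: uniq_perm => // [|a]; first exact: filter_uniq (enum_uniq _).
  by rewrite mem_filter mem_enum andbT ms.
Qed.

Lemma gseq_once a : once gseq a.
Proof.
rewrite /once (bigD1 (gpos a).1) //= big1 => [|i ne].
  by rewrite count_uniq_mem ?gseq_uniq // mem_gseq eqxx.
by rewrite count_uniq_mem ?gseq_uniq // mem_gseq eq_sym (negbTE ne).
Qed.

Lemma gauss_word_once_over c : once (gauss_word D) (Over c).
Proof.
apply: eq_once (gseq_once (Tail c)) => i; rewrite gauss_wordE count_map.
by apply: eq_count => -[[b|b]|d] //=; case: (gdsign d).
Qed.

Lemma gauss_word_once_under c : once (gauss_word D) (Under c).
Proof.
apply: eq_once (gseq_once (Head c)) => i; rewrite gauss_wordE count_map.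
by apply: eq_count => -[[b|b]|d] //=; case: (gdsign d).
Qed.

End OneDiagram.

(* Equality of ordinals is compared in nat, so that diagrams related by the casts
   of a strict monoidal structure can be compared as well. *)
Definition giso m n m' n' (D : gauss_diagram R m n) (D' : gauss_diagram R m' n') :
    Prop :=
  exists f : gchord D -> gchord D',
    [/\ bijective f, (forall c, gsign (f c) = gsign c),
        (forall (j : 'I_n) (j' : 'I_n'), j = j' :> nat -> glast D j = glast D' j' :> nat) &
        (forall (i : 'I_m) (i' : 'I_m'), i = i' :> nat ->
           gauss_word D' i' = map (map_letter f) (gauss_word D i))].

(** The chord bijection is given, but diamonds have no names in the words and are matched by their
    places. On each interval the two increasing lists of coordinates then have the same length, and
    a piecewise linear homeomorphism carries one to the other. *)
Lemma giso_homeo m n (D D' : gauss_diagram R m n) : giso D D' -> gauss_homeo D D'.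
Proof.
case=> f [fbij fs fl fw]; pose al := aligned (gseq D) (gseq D').
have sz i : size (gseq D i) = size (gseq D' i).
  by have /(congr1 size) := fw i i erefl; rewrite !gauss_wordE !size_map.
have all_ a a' : al a a' -> mark_letter a' = map_letter f (mark_letter a).
  case=> i [p [h h']]; have := congr1 (fun s => onth s p) (fw i i erefl).
  by rewrite !gauss_wordE /= !onth_map h h' => -[].
have alf a : exists a', al a a' := aligned_total (@gseq_once _ _ D) sz a.
have als a : exists a', al a' a := aligned_surj (@gseq_once _ _ D') sz a.
have [] := @rel_bij _ _ (fun d d' => al (Dmd d) (Dmd d')).
- move=> d; have [[[c|c]|d'] h] := alf (Dmd d); last by exists d'.
    by have := all_ _ _ h => /=; case: (gdsign d).
  by have := all_ _ _ h => /=; case: (gdsign d).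
- move=> d; have [[[c|c]|d'] h] := als (Dmd d); last by exists d'.
    by have := all_ _ _ h => /=; case: (gdsign d).
  by have := all_ _ _ h => /=; case: (gdsign d).
- move=> d d1 d2 h1 h2.
  by have [] := aligned_fun (@gseq_once _ _ D) h1 h2.
- move=> d d1 d2 h1 h2.
  by have [] := aligned_inj (@gseq_once _ _ D') h1 h2.
move=> g [gbij gal].
(* The letter of a tail or head names its chord, so on chord ends alignment agrees with f. *)
have mal a : al a (map_mark f g a).
  case: a => [[c|c]|d]; last exact: gal.
  - have [a' h] := alf (Tail c); have := all_ _ _ h.
    case: a' h => [[c'|c']|d'] h //=; first by case=> <-.
    by case: (gdsign d').
  - have [a' h] := alf (Head c); have := all_ _ _ h.
    case: a' h => [[c'|c']|d'] h //=; first by case=> <-.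
    by case: (gdsign d').
have al1 a a' : al a a' -> (gpos a').1 = (gpos a).1.
  case=> i [p [h h']].
  have /eqP -> : (gpos a).1 == i by rewrite -mem_gseq; apply/onthP; exists p.
  by apply/eqP; rewrite -mem_gseq; apply/onthP; exists p.
have hex i : exists h : R -> R, line_homeo h /\
    map h [seq (gpos a).2 | a <- gseq D i] = [seq (gpos a).2 | a <- gseq D' i].
  have [||||||h [hl _ hm]] := @line_homeo_seq R 0 [seq (gpos a).2 | a <- gseq D i]
     [seq (gpos a).2 | a <- gseq D' i]; rewrite ?size_map //; last by exists h.
  - rewrite path_sortedE; last exact: lt_trans.
    rewrite gseq_sorted andbT; apply/allP => x /mapP[a _ ->].
    by have /andP[] := gpos_interior a.
  - rewrite path_sortedE; last exact: lt_trans.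
    rewrite gseq_sorted andbT; apply/allP => x /mapP[a _ ->].
    by have /andP[] := gpos_interior a.
  - by apply/allP => x /mapP[a _ ->]; have /andP[] := gpos_interior a.
  - by apply/allP => x /mapP[a _ ->]; have /andP[] := gpos_interior a.
have [h hP] := boolp.choice hex.
exists f, g, h; split=> //.
- by move=> j; apply: val_inj; apply: fl.
- split=> // d; have := all_ _ _ (gal d) => /=.
  by case: (gdsign d); case: (gdsign (g d)).
- by move=> i; apply: line_homeo_interval; case: (hP i).
move=> a; have := mal a; rewrite -/(map_mark f g a) => ala.
rewrite [LHS]surjective_pairing (al1 _ _ ala); congr pair.
case: ala => i [p [h1 h2]].
have -> : (gpos a).1 = i by apply/eqP; rewrite -mem_gseq; apply/onthP; exists p.
have [_ /(congr1 (fun s => onth s p))] := hP i.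
by rewrite -map_comp !onth_map h1 h2 /= => -[].
Qed.

(** The homeomorphisms increase on [0, 1], where all marks lie, so they carry the sorted list of
    marks of D to that of D'. *)
Lemma homeo_giso m n (D D' : gauss_diagram R m n) : gauss_homeo D D' -> giso D D'.
Proof.
case=> f [g [h [fl [fb gb] [fs gs] hh pos]]]; exists f; split=> //.
  by move=> j j' /val_inj <-; rewrite fl.
move=> i i' /val_inj <-.
have mb := map_mark_bij fb gb.
have -> : gauss_word D' i = map (@mark_letter _ _ _ D') (map (map_mark f g) (gseq D i)).
  rewrite gauss_wordE; congr map; apply: gseq_eq.
    rewrite -map_comp.
    have -> : map ((fun a : gmark D' => (gpos a).2) \o map_mark f g) (gseq D i)
       = map (h i) [seq (gpos a).2 | a <- gseq D i].
      rewrite -map_comp; apply/eq_in_map => a; rewrite mem_gseq => /eqP e /=.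
      by rewrite /map_mark pos e.
    rewrite sorted_map; have := gseq_sorted D i.
    move=> srt; apply: (@sub_in_sorted _ (fun x : R => x \in `[0, 1]) _ _ _ _ _ srt).
      by move=> x y hx hy; have [_ [_ _ _ H]] := hh i; apply: H.
    apply/allP => x /mapP[a _ ->]; rewrite /= in_itv /=.
    by have /andP[/ltW-> /ltW->] := gpos_interior a.
  move=> b; case: mb => k mK Km; rewrite -[b]Km (mem_map (can_inj mK)) mem_gseq.
  by rewrite /map_mark pos.
rewrite gauss_wordE -!map_comp; apply: eq_map => -[[c|c]|d] //=.
by rewrite gs; case: (gdsign d).
Qed.

Lemma giso_equiv m n (D D' : gauss_diagram R m n) : giso D D' -> gauss_equiv D D'.
Proof. by move=> /giso_homeo h; apply: rst_step; apply: gmove_homeo. Qed.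

End GaussWords.

(** * Realization of words; words of composites and products *)

Section GaussOperations.
Variable R : realType.

Notation gmark D := (mark (gchord D) (gdia D)).

(** Every letter becomes a mark at its own place. The chords are the elements of C; the diamonds,
    whose letters carry no name, are the places occupied by a rotation letter. *)
Lemma realize_gauss m n (last : 'I_n -> 'I_m) (C : finType) (s : C -> bool)
    (W : 'I_m -> seq (letter C)) :
  bijective last -> (forall c, once W (Over c)) -> (forall c, once W (Under c)) ->
  exists (D : gauss_diagram R m n) (f : C -> gchord D),
    [/\ bijective f, (forall c, gsign (f c) = s c), glast D =1 last &
        forall i, gauss_word D i = map (map_letter f) (W i)].
Proof.
move=> lb Wo Wu; pose at_ (x : 'I_m * nat) := onth (W x.1) x.2.
have /boolp.choice[ov ovP] : forall c, exists x, at_ x = Some (Over c).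
  by move=> c; have [i [p h]] := once_pos (Wo c); exists (i, p).
have /boolp.choice[un unP] : forall c, exists x, at_ x = Some (Under c).
  by move=> c; have [i [p h]] := once_pos (Wu c); exists (i, p).
pose is_rot x := if at_ x is Some l then (if l is (Rplus | Rminus) then true else false) else false.
pose L := [seq x <- [seq (i, p) | i <- enum 'I_m, p <- iota 0 (size (W i))] | is_rot x].
have memL x : (x \in L) = is_rot x.
  rewrite mem_filter; case e : (is_rot x) => //=; apply/allpairsPdep.
  exists x.1, x.2; rewrite mem_enum mem_iota /= add0n -onthTE; split=> //.
    by move: e; rewrite /is_rot /at_; case: (onth _ _).
  by case: (x).
pose place (a : mark C (seq_sub L)) : 'I_m * nat :=
  match a with Tail c => ov c | Head c => un c | Dmd d => ssval d end.
pose let_ (a : mark C (seq_sub L)) : letter C :=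
  match a with Tail c => Over c | Head c => Under c
  | Dmd d => if at_ (ssval d) == Some Rplus then Rplus else Rminus end.
have placeP a : at_ (place a) = Some (let_ a).
  case: a => [[c|c]|[d dL]] //=; move: dL; rewrite memL /is_rot.
  by case: (at_ d) => [[c|c||]|].
have place_inj : injective place.
  move=> a b e; have := placeP b; rewrite -e placeP => -[].
  case: a b e => [[c|c]|d] [[c'|c']|d'] //= e; rewrite -?ovP -?unP.
  - by case=> ->.
  - by case: ifP.
  - by case=> ->.
  - by case: ifP.
  - by case: ifP.
  - by case: ifP.
  - by move=> _; congr inr; apply: val_inj.
(* The p-th letter of a word of length l sits at (p + 1) / (l + 1): the two shifts by one keep it
   away from 0 and from 1. *)
pose pos a : 'I_m * R := ((place a).1, (place a).2.+1%:R / (size (W (place a).1)).+1%:R).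
have pos_inj : injective pos.
  move=> a b; rewrite /pos => -[e1]; rewrite e1 => e2; apply: place_inj.
  rewrite [LHS]surjective_pairing [RHS]surjective_pairing e1; congr pair.
  have : (size (W (place b).1)).+1%:R^-1 != 0 :> R by rewrite invr_eq0 pnatr_eq0.
  by move=> /mulIf/(_ _ _ e2)/eqP; rewrite eqr_nat => /eqP[].
have pos_int a : 0 < (pos a).2 < 1.
  rewrite /pos /= divr_gt0 ?ltr0Sn //= ltr_pdivrMr ?ltr0Sn // mul1r ltr_nat ltnS.
  by rewrite -onthTE -/(at_ _) placeP.
pose D := @GaussDiagram R m n last lb C s _ (fun d : seq_sub L => at_ (ssval d) == Some Rplus)
  pos pos_inj pos_int.
exists D, id; split=> //; first by exists id.
move=> i; rewrite map_map_letter_id //.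
(* Both lists are strictly increasing in the position and have the same members, hence coincide. *)
have lst : map place (gseq D i) = [seq (i, p) | p <- iota 0 (size (W i))].
  apply: (@irr_sorted_eq _ (fun x y : 'I_m * nat => x.2 < y.2)%N).
  - by move=> y x z; apply: ltn_trans.
  - by move=> x; apply: ltnn.
  - rewrite sorted_map; have := gseq_sorted D i; rewrite sorted_map => srt.
    apply: (@sub_in_sorted _ (mem (gseq D i)) _ _ _ _ _ srt); last exact/allP.
    move=> a b ha hb /=.
    have /eqP /= ea : (gpos a).1 == i by rewrite -mem_gseq.
    have /eqP /= eb : (gpos b).1 == i by rewrite -mem_gseq.
    rewrite ea eb.
    by rewrite ltr_pM2r ?invr_gt0 ?ltr0Sn // ltr_nat ltnS.
  - by rewrite sorted_map; apply: iota_ltn_sorted.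
  move=> x; apply/mapP/mapP => [[a]|[p]].
    move=> ha ->; have /eqP /= ea : (@gpos _ _ _ D a).1 == i by rewrite -mem_gseq.
    exists (place a).2; last first.
      by rewrite -ea -surjective_pairing.
    by rewrite mem_iota add0n -ea /= -onthTE -/(at_ _) placeP.
  rewrite mem_iota add0n => /= lt ->; have : at_ (i, p) by rewrite /at_ onthTE.
  case e : (at_ (i, p)) => [[c|c||]|] // _.
  - have [/= e1 e2] := once_uniq (Wo c) e (ovP c).
    exists (Tail c); last by rewrite /= e1 e2; case: (ov c).
    by rewrite (@mem_gseq _ _ _ D) /= e1.
  - have [/= e1 e2] := once_uniq (Wu c) e (unP c).
    exists (Head c); last by rewrite /= e1 e2; case: (un c).
    by rewrite (@mem_gseq _ _ _ D) /= e1.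
  - have xL : (i, p) \in L by rewrite memL /is_rot e.
    by exists (Dmd (SeqSub xL)); rewrite ?(@mem_gseq _ _ _ D) /=.
  - have xL : (i, p) \in L by rewrite memL /is_rot e.
    by exists (Dmd (SeqSub xL)); rewrite ?(@mem_gseq _ _ _ D) /=.
apply: (inj_map (@Some_inj _)); rewrite gauss_wordE -map_comp.
have -> : map (Some \o @mark_letter _ _ _ D) (gseq D i) = map at_ (map place (gseq D i)).
  by rewrite -map_comp; apply: eq_map => a; rewrite /= placeP; congr Some.
rewrite lst -map_comp; apply: (@eq_from_nth _ None); rewrite ?size_map ?size_iota // => p lt.
by rewrite (nth_map 0%N) ?size_iota //= nth_iota // add0n -[LHS]/(onth (W i) p) onthE.
Qed.

Section Inverse.
Variables (m n : nat) (D : gauss_diagram R m n).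

(** The number of the end point of the interval starting at i; in a composite it tells which
    interval continues the i-th one. *)
Definition glinv : 'I_m -> 'I_n := sval (cid (bij_inv (glast_bij D))).

Lemma glastK : cancel (glast D) glinv.
Proof. by rewrite /glinv; case: (cid _) => g []. Qed.

Lemma glinvK : cancel glinv (glast D).
Proof. by rewrite /glinv; case: (cid _) => g []. Qed.

Lemma glinv_eq i j : glast D j = i -> glinv i = j.
Proof. by move=> <-; rewrite glastK. Qed.

End Inverse.

Lemma mark_splitE C1 C2 D1 D2 (x : mark (C1 + C2) (D1 + D2)) :
  x = match mark_split x with inl a => map_mark inl inl a | inr a => map_mark inr inr a end.
Proof. by case: x => [[[c|c]|[c|c]]|[d|d]]. Qed.

Lemma mark_splitl C1 C2 D1 D2 (a : mark C1 D1) :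
  mark_split (map_mark inl inl a : mark (C1 + C2) (D1 + D2)) = inl a.
Proof. by case: a => [[c|c]|d]. Qed.

Lemma mark_splitr C1 C2 D1 D2 (a : mark C2 D2) :
  mark_split (map_mark inr inr a : mark (C1 + C2) (D1 + D2)) = inr a.
Proof. by case: a => [[c|c]|d]. Qed.

Lemma map_mark_inl_inj C1 C2 D1 D2 :
  injective (map_mark inl inl : mark C1 D1 -> mark (C1 + C2) (D1 + D2)).
Proof. by move=> [[c|c]|d] [[c'|c']|d'] //= [->]. Qed.

Lemma map_mark_inr_inj C1 C2 D1 D2 :
  injective (map_mark inr inr : mark C2 D2 -> mark (C1 + C2) (D1 + D2)).
Proof. by move=> [[c|c]|d] [[c'|c']|d'] //= [->]. Qed.

Lemma mem_map_inl (C1 C2 D1 D2 : eqType) (s : seq (mark C1 D1)) (x : mark (C1 + C2) (D1 + D2)) :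
  (x \in map (map_mark inl inl) s) = if mark_split x is inl a then a \in s else false.
Proof.
rewrite {1}(mark_splitE x); case: (mark_split x) => a.
  by rewrite mem_map //; apply: map_mark_inl_inj.
by apply/negbTE/mapP => -[b _ /(congr1 (@mark_split _ _ _ _))]; rewrite mark_splitl mark_splitr.
Qed.

Lemma mem_map_inr (C1 C2 D1 D2 : eqType) (s : seq (mark C2 D2)) (x : mark (C1 + C2) (D1 + D2)) :
  (x \in map (map_mark inr inr) s) = if mark_split x is inr a then a \in s else false.
Proof.
rewrite {1}(mark_splitE x); case: (mark_split x) => a; last first.
  by rewrite mem_map //; apply: map_mark_inr_inj.
by apply/negbTE/mapP => -[b _ /(congr1 (@mark_split _ _ _ _))]; rewrite mark_splitl mark_splitr.
Qed.

Section Words.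
Variables (m n p q : nat).

(** Rescaling puts the marks of D in the first half of the interval and those of E in the second
    half, so the concatenated lists are already sorted. *)
Lemma comp_gauss_word (E : gauss_diagram R n p) (D : gauss_diagram R m n) i :
  gauss_word (comp_gauss E D) i =
    map (map_letter inl) (gauss_word D i) ++ map (map_letter inr) (gauss_word E (glinv D i)).
Proof.
rewrite !gauss_wordE (@gseq_eq _ _ _ (comp_gauss E D) i
   (map (map_mark inl inl) (gseq D i) ++ map (map_mark inr inr) (gseq E (glinv D i)))).
- rewrite map_cat -!map_comp; congr (_ ++ _); apply: eq_map.
    by case=> [[c|c]|d] //=; case: (gdsign d).
  by case=> [[c|c]|d] //=; case: (gdsign d).
- rewrite map_cat -!map_comp sorted_pairwise; last exact: lt_trans.
  rewrite pairwise_cat -!sorted_pairwise; try exact: lt_trans; apply/and3P; split.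
  + apply/allrelP => _ _ /mapP[a _ ->] /mapP[b _ ->] /=; rewrite /comp_pos.
    rewrite mark_splitl mark_splitr /=.
    by have /andP[? ?] := gpos_interior a; have /andP[? ?] := gpos_interior b; lra.
  + have := gseq_sorted D i; rewrite !sorted_map; apply: sub_sorted => a b /=.
    by rewrite /comp_pos !mark_splitl /= => ?; lra.
  + have := gseq_sorted E (glinv D i); rewrite !sorted_map; apply: sub_sorted => a b /=.
    by rewrite /comp_pos !mark_splitr /= => ?; lra.
- move=> x; rewrite mem_cat mem_map_inl mem_map_inr /= /comp_pos.
  case: (mark_split x) => a /=; rewrite mem_gseq ?orbF //.
  by apply/eqP/eqP => [->|<-]; rewrite ?glinvK ?glastK.
Qed.

Lemma tens_gauss_word_l (D : gauss_diagram R m n) (E : gauss_diagram R p q) i :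
  gauss_word (tens_gauss D E) (lshift p i) = map (map_letter inl) (gauss_word D i).
Proof.
rewrite !gauss_wordE (@gseq_eq _ _ _ (tens_gauss D E) _ (map (map_mark inl inl) (gseq D i))).
- rewrite -!map_comp; apply: eq_map.
  by case=> [[c|c]|d] //=; case: (gdsign d).
- have := gseq_sorted D i; rewrite !sorted_map; apply: sub_sorted => a b /=.
  by rewrite /tens_pos !mark_splitl.
- move=> x; rewrite mem_map_inl /= /tens_pos.
  case: (mark_split x) => a /=; rewrite ?mem_gseq; last by rewrite eq_rlshift.
  by rewrite eq_lshift.
Qed.

Lemma tens_gauss_word_r (D : gauss_diagram R m n) (E : gauss_diagram R p q) i :
  gauss_word (tens_gauss D E) (rshift m i) = map (map_letter inr) (gauss_word E i).
Proof.
rewrite !gauss_wordE (@gseq_eq _ _ _ (tens_gauss D E) _ (map (map_mark inr inr) (gseq E i))).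
- rewrite -!map_comp; apply: eq_map.
  by case=> [[c|c]|d] //=; case: (gdsign d).
- have := gseq_sorted E i; rewrite !sorted_map; apply: sub_sorted => a b /=.
  by rewrite /tens_pos !mark_splitr.
- move=> x; rewrite mem_map_inr /= /tens_pos.
  case: (mark_split x) => a /=; rewrite ?mem_gseq; first by rewrite eq_lrshift.
  by rewrite eq_rshift.
Qed.

Lemma tens_last_l (D : gauss_diagram R m n) (E : gauss_diagram R p q) j :
  glast (tens_gauss D E) (lshift q j) = lshift p (glast D j).
Proof. by rewrite /= /tens_last (unsplitK (inl _)). Qed.

Lemma tens_last_r (D : gauss_diagram R m n) (E : gauss_diagram R p q) j :
  glast (tens_gauss D E) (rshift n j) = rshift m (glast E j).
Proof. by rewrite /= /tens_last (unsplitK (inr _)). Qed.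

Lemma glinv_tens_l (D : gauss_diagram R m n) (E : gauss_diagram R p q) i :
  glinv (tens_gauss D E) (lshift p i) = lshift q (glinv D i).
Proof. by apply: glinv_eq; rewrite tens_last_l glinvK. Qed.

Lemma glinv_tens_r (D : gauss_diagram R m n) (E : gauss_diagram R p q) i :
  glinv (tens_gauss D E) (rshift m i) = rshift n (glinv E i).
Proof. by apply: glinv_eq; rewrite tens_last_r glinvK. Qed.

Lemma comp_last (E : gauss_diagram R n p) (D : gauss_diagram R m n) j :
  glast (comp_gauss E D) j = glast D (glast E j).
Proof. by []. Qed.

Lemma glinv_comp (E : gauss_diagram R n p) (D : gauss_diagram R m n) i :
  glinv (comp_gauss E D) i = glinv E (glinv D i).
Proof. by apply: glinv_eq; rewrite /= !glinvK. Qed.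

End Words.

Lemma id_gauss_word n i : gauss_word (id_gauss R n) i = [::].
Proof. by rewrite gauss_wordE (@gseq_eq _ _ _ _ _ [::]) // => -[[[]|[]]|[]]. Qed.

Lemma sym_gauss_word n m i : gauss_word (sym_gauss R n m) i = [::].
Proof. by rewrite gauss_wordE (@gseq_eq _ _ _ _ _ [::]) // => -[[[]|[]]|[]]. Qed.

Lemma id_last n j : glast (id_gauss R n) j = j.
Proof. by []. Qed.

Lemma sym_last n m j : glast (sym_gauss R n m) j = swap_ord j.
Proof. by []. Qed.

Lemma glinv_id n i : glinv (id_gauss R n) i = i.
Proof. exact: glinv_eq. Qed.

Lemma glinv_sym n m i : glinv (sym_gauss R n m) i = swap_ord i.
Proof. by apply: glinv_eq; rewrite /= swap_ordK. Qed.

Lemma swap_lshift n m (i : 'I_n) : swap_ord (lshift m i) = rshift m i.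
Proof. by apply: val_inj; rewrite /= modn_small ?ltn_add2r // addnC. Qed.

Lemma swap_rshift n m (i : 'I_m) : swap_ord (rshift n i) = lshift n i.
Proof.
apply: val_inj; rewrite /= addnAC modnDl modn_small //.
exact: leq_trans (ltn_ord i) (leq_addl _ _).
Qed.

End GaussOperations.

(** * Congruence of the moves on Gauss diagrams *)

Section FillWord.

Definition fill_item (k : nat) (C : Type) (p : pattern k) (x : letter C + 'I_k) :
    seq (letter (C + plabel p)) :=
  match x with
  | inl l => [:: map_letter inl l]
  | inr j => map (map_letter inr) (tnth (pword p) j)
  end.

Lemma fill_wordE k C (p : pattern k) (w : seq (letter C + 'I_k)) :
  fill_word p w = flatten (map (fill_item p) w).
Proof. by []. Qed.

End FillWord.

Section Contexts.
Variable R : realType.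

Lemma gauss_move_last m n (D D' : gauss_diagram R m n) :
  gauss_move D D' -> glast D =1 glast D'.
Proof. by case=> [[f [g [h []]]]|]. Qed.

(** * Diagrams inserted into a fixed context *)

Section Substitution.
Variables (m m' : nat) (X : finType) (V : 'I_m' -> seq (letter X + 'I_m)).

(** V describes the surroundings: its letters, over X, stay fixed, and [inr i] is the slot for the
    whole i-th word. *)
Definition subst_word (C : Type) (w : 'I_m -> seq (letter C)) (i' : 'I_m') :
    seq (letter (C + X)) :=
  flatten [seq match x with
           | inl l => [:: map_letter inr l]
           | inr i => map (map_letter inl) (w i)
           end | x <- V i'].

(* The big diagram is obtained from D by inserting its strands into V, where
   each strand is used once when [once V (inr i)] holds. *)
Definition in_context n n' (sX : X -> bool)
    (D : gauss_diagram R m n) (E : gauss_diagram R m' n') : Prop :=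
  exists g : gchord D + X -> gchord E,
    [/\ bijective g,
        (forall x, gsign (g x) = match x with inl c => gsign c | inr x => sX x end) &
        (forall i', gauss_word E i' = map (map_letter g) (subst_word (gauss_word D) i'))].

Hypothesis V1 : forall i, once V (inr i).

(** Substitution is associative: the holes in the words of D become holes in the words of E. Only
    the labels have to be regrouped, the chords outside the pattern being now those of C together
    with X. *)
Lemma context_reads n n' (sX : X -> bool) (D : gauss_diagram R m n)
    (E : gauss_diagram R m' n') k (p : pattern k) (C : finType) (s : C -> bool)
    (W : 'I_m -> seq (letter C + 'I_k)) :
  in_context sX D E -> gauss_reads D s W p ->
  gauss_reads E (fun x : C + X => match x with inl c => s c | inr x => sX x end)
    (fun i' => flatten [seq match x with
       | inl l => [:: inl (map_letter inr l)]
       | inr i => [seq match y with inl l => inl (map_letter inl l) | inr j => inr j end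
                  | y <- W i]
       end | x <- V i']) p.
Proof.
case=> g [gb gs gw] [f [fb fs fw]].
pose e (x : C + X + plabel p) : C + plabel p + X :=
  match x with
  | inl (inl c) => inl (inl c) | inl (inr x) => inr x | inr l => inl (inr l) end.
have eb : bijective e.
  exists (fun x => match x with
    | inl (inl c) => inl (inl c) | inr x => inl (inr x) | inl (inr l) => inr l end).
    by case=> [[]|].
  by case=> [[]|].
pose f1 (x : C + plabel p + X) := match x with inl c => inl (f c) | inr x => inr x end.
have f1b : bijective f1 := sum_bij fb (Bijective (fun=> erefl) (fun=> erefl)).
exists (g \o (f1 \o e)); split.
- exact: bij_comp gb (bij_comp f1b eb).
- by move=> [[c|x]|l] /=; rewrite gs ?fs.
move=> i'; rewrite gw fill_wordE flatten_flatten_map /subst_word !map_flatten_map.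
congr flatten; apply: eq_map => -[l|i] /=.
  by rewrite !map_letter_comp; congr [:: _]; apply: eq_map_letter.
rewrite fw fill_wordE !map_flatten_map -!map_comp; congr flatten; apply: eq_map => -[l|j] /=.
  by rewrite !map_letter_comp; congr [:: _]; apply: eq_map_letter.
rewrite -!map_comp; apply: eq_map => l /=.
by rewrite !map_letter_comp; apply: eq_map_letter.
Qed.

(** Composition and product, in either argument, insert the varying diagram into a fixed context;
    this handles all four cases at once. A rule remains a rule because each hole lies on one strand
    of D and each strand is inserted once; a homeomorphism is replaced by its chord bijection,
    extended by the identity on X. *)
Lemma context_move n n' (sX : X -> bool) (D D' : gauss_diagram R m n)
    (E E' : gauss_diagram R m' n') :
  in_context sX D E -> in_context sX D' E' -> glast E =1 glast E' ->
  gauss_move D D' -> gauss_equiv E E'.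
Proof.
move=> cD cD' el [/homeo_giso|k p q C s W pq _ /holes_onceP W1 rD rD']; last first.
  apply: rst_step.
  apply: (gmove_rule pq el _ (context_reads cD rD) (context_reads cD' rD')).
  apply/holes_onceP => j; rewrite /once; under eq_bigr => i' _ do rewrite count_flatten_map.
  rewrite sum_once_inr // big1 ?add0n => [|i _]; last first.
    by apply: big1_seq => -[l|//] _ /=.
  rewrite -[RHS](W1 j); apply: eq_bigr => i _.
  by rewrite count_map; apply: eq_count => -[].
case: cD cD' => g [gb gs gw] [g' [gb' gs' gw']] [f [fb fs _ fw]].
have [h [hb gh hg]] := bij_inv gb.
pose f1 (x : gchord D + X) := match x with inl c => inl (f c) | inr x => inr x end.
have f1b : bijective f1 := sum_bij fb (Bijective (fun=> erefl) (fun=> erefl)).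
apply: giso_equiv; exists (g' \o (f1 \o h)); split.
- exact: bij_comp gb' (bij_comp f1b hb).
- by move=> c; rewrite -[in RHS](hg c) gs /= gs'; case: (h c) => //= c'; rewrite fs.
- by move=> j j' /val_inj->; rewrite el.
move=> i i' /val_inj <-; rewrite gw gw' /subst_word !map_flatten_map.
congr flatten; apply: eq_map => -[l|j] /=.
  rewrite !map_letter_comp; congr [:: _]; apply: eq_map_letter => x /=.
  by rewrite gh.
rewrite (fw j j erefl) -!map_comp; apply: eq_map => l /=.
by rewrite !map_letter_comp; apply: eq_map_letter => x /=; rewrite gh.
Qed.

End Substitution.

Lemma subst_word_inl (A B : Type) (w : B -> seq (letter A)) (X : Type) (s : seq (letter X)) :
  flatten [seq match x with
           | inl l => [:: map_letter inr l]
           | inr i => map (map_letter inl) (w i)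
           end | x <- map inl s] = map (map_letter (@inr A X)) s.
Proof. by rewrite -map_comp flatten_map_seq1. Qed.

(** * Compatibility of composition and product with the moves *)

Section Compatibility.
Variables (m n p q : nat).

(** The context appends to slot i the word of E at [glinv D i]. It serves for D' as well because a
    move leaves the gluing unchanged. *)
Lemma comp_gauss_equiv_r (E : gauss_diagram R n p) (D D' : gauss_diagram R m n) :
  gauss_equiv D D' -> gauss_equiv (comp_gauss E D) (comp_gauss E D').
Proof.
apply: (clos_map (f := fun D => comp_gauss E D)) => {}D {}D' mv.
have el := gauss_move_last mv.
pose V (i : 'I_m) : seq (letter (gchord E) + 'I_m) :=
  inr i :: map inl (gauss_word E (glinv D i)).
apply: (@context_move _ _ _ V _ _ _ (@gsign _ _ _ E) _ _ _ _ _ _ _ mv).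
- move=> i; apply: (@once_at _ _ _ _ i) => i' /=.
  by rewrite count_inr_inl addn0.
- exists id; split; [by exists id|by case|] => i.
  rewrite comp_gauss_word /subst_word /= subst_word_inl.
  by rewrite map_map_letter_id.
- exists id; split; [by exists id|by case|] => i.
  rewrite comp_gauss_word /subst_word /= subst_word_inl.
  rewrite map_map_letter_id //.
  by rewrite (@glinv_eq _ _ _ D' i (glinv D i)) // -el glinvK.
- by move=> j /=; rewrite el.
Qed.

Lemma comp_gauss_equiv_l (E E' : gauss_diagram R n p) (D : gauss_diagram R m n) :
  gauss_equiv E E' -> gauss_equiv (comp_gauss E D) (comp_gauss E' D).
Proof.
apply: (clos_map (f := fun E => comp_gauss E D)) => {}E {}E' mv.
have el := gauss_move_last mv.
pose V (i : 'I_m) : seq (letter (gchord D) + 'I_n) :=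
  map inl (gauss_word D i) ++ [:: inr (glinv D i)].
(* The varying diagram is the second summand of the composite, whereas a context lists its chords
   first. *)
pose sw (A B : Type) (x : A + B) : B + A := match x with inl a => inr a | inr b => inl b end.
have swb A B : bijective (sw A B) by exists (sw B A); case.
apply: (@context_move _ _ _ V _ _ _ (@gsign _ _ _ D) _ _ _ _ _ _ _ mv).
- move=> i; apply: (@once_at _ _ _ _ (glast D i)) => i'.
  rewrite count_cat count_inr_inl /= addn0; congr nat_of_bool.
  by apply/eqP/eqP => [[<-]|->]; rewrite ?glinvK ?glastK.
- exists (sw _ _); split; [exact: swb|by case|] => i.
  rewrite comp_gauss_word /subst_word /= map_cat flatten_cat subst_word_inl /= cats0.
  rewrite map_cat -!map_comp; congr (_ ++ _); apply: eq_map => l /=;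
    by rewrite map_letter_comp.
- exists (sw _ _); split; [exact: swb|by case|] => i.
  rewrite comp_gauss_word /subst_word /= map_cat flatten_cat subst_word_inl /= cats0.
  rewrite map_cat -!map_comp; congr (_ ++ _); apply: eq_map => l /=;
    by rewrite map_letter_comp.
- by move=> j /=; rewrite el.
Qed.

Lemma tens_gauss_equiv_l (D D' : gauss_diagram R m n) (E : gauss_diagram R p q) :
  gauss_equiv D D' -> gauss_equiv (tens_gauss D E) (tens_gauss D' E).
Proof.
apply: (clos_map (f := fun D => tens_gauss D E)) => {}D {}D' mv.
have el := gauss_move_last mv.
pose V (i : 'I_(m + p)) : seq (letter (gchord E) + 'I_m) :=
  match fintype.split i with inl i => [:: inr i] | inr i => map inl (gauss_word E i) end.
apply: (@context_move _ _ _ V _ _ _ (@gsign _ _ _ E) _ _ _ _ _ _ _ mv).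
- move=> i; apply: (@once_at _ _ _ _ (lshift p i)) => i'; rewrite /V.
  case: (fintype.split_ordP i') => k -> /=; first by rewrite eq_lshift addn0.
  by rewrite count_inr_inl eq_rlshift.
- exists id; split; [by exists id|by case|] => i.
  rewrite map_map_letter_id // /subst_word /V.
  case: (fintype.split_ordP i) => k -> /=; first by rewrite tens_gauss_word_l cats0.
  by rewrite tens_gauss_word_r subst_word_inl.
- exists id; split; [by exists id|by case|] => i.
  rewrite map_map_letter_id // /subst_word /V.
  case: (fintype.split_ordP i) => k -> /=; first by rewrite tens_gauss_word_l cats0.
  by rewrite tens_gauss_word_r subst_word_inl.
- by move=> j; rewrite /= /tens_last; case: fintype.split => // k; rewrite el.
Qed.

Lemma tens_gauss_equiv_r (D : gauss_diagram R m n) (E E' : gauss_diagram R p q) :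
  gauss_equiv E E' -> gauss_equiv (tens_gauss D E) (tens_gauss D E').
Proof.
apply: (clos_map (f := fun E => tens_gauss D E)) => {}E {}E' mv.
have el := gauss_move_last mv.
pose V (i : 'I_(m + p)) : seq (letter (gchord D) + 'I_p) :=
  match fintype.split i with inl i => map inl (gauss_word D i) | inr i => [:: inr i] end.
pose sw (A B : Type) (x : A + B) : B + A := match x with inl a => inr a | inr b => inl b end.
have swb A B : bijective (sw A B) by exists (sw B A); case.
apply: (@context_move _ _ _ V _ _ _ (@gsign _ _ _ D) _ _ _ _ _ _ _ mv).
- move=> i; apply: (@once_at _ _ _ _ (rshift m i)) => i'; rewrite /V.
  case: (fintype.split_ordP i') => k -> /=; last by rewrite eq_rshift addn0.
  by rewrite count_inr_inl eq_lrshift.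
- exists (sw _ _); split; [exact: swb|by case|] => i; rewrite /subst_word /V.
  case: (fintype.split_ordP i) => k -> /=.
    rewrite tens_gauss_word_l subst_word_inl -map_comp; apply: eq_map => l /=.
    by rewrite map_letter_comp.
  rewrite tens_gauss_word_r cats0 -map_comp; apply: eq_map => l /=.
  by rewrite map_letter_comp.
- exists (sw _ _); split; [exact: swb|by case|] => i; rewrite /subst_word /V.
  case: (fintype.split_ordP i) => k -> /=.
    rewrite tens_gauss_word_l subst_word_inl -map_comp; apply: eq_map => l /=.
    by rewrite map_letter_comp.
  rewrite tens_gauss_word_r cats0 -map_comp; apply: eq_map => l /=.
  by rewrite map_letter_comp.
- by move=> j; rewrite /= /tens_last; case: fintype.split => // k; rewrite el.
Qed.

End Compatibility.

Lemma gclsP m n (D D' : gauss_diagram R m n) :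
  cls (@gauss_equiv R m n) D = cls (@gauss_equiv R m n) D' <-> gauss_equiv D D'.
Proof. exact: clsP erefl D D'. Qed.

Lemma gauss_ops : GDXC_operations_on_classes R.
Proof.
split=> [m n p D2 D1|m n p q D1 D2] /=; apply/gclsP.
  apply: rst_trans (comp_gauss_equiv_l _ _) (comp_gauss_equiv_r _ _);
    exact/gclsP/class_reprK.
apply: rst_trans (tens_gauss_equiv_l _ _) (tens_gauss_equiv_r _ _);
  exact/gclsP/class_reprK.
Qed.

(** Eliminating the two equalities makes the cast disappear, so each axiom of strictness becomes a
    comparison of words and gluings. *)
Lemma giso_cast m n m' n' (ea : m = m') (eb : n = n') (D : gauss_diagram R m n)
    (D' : gauss_diagram R m' n') :
  giso D D' ->
  @cast_hom (GDXC R) m m' n n' ea eb (cls (@gauss_equiv R m n) D)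
  = cls (@gauss_equiv R m' n') D'.
Proof. by case: _ / ea D'; case: _ / eb => D' /giso_equiv/gclsP. Qed.

Lemma giso_cls m n (D D' : gauss_diagram R m n) :
  giso D D' -> cls (@gauss_equiv R m n) D = cls (@gauss_equiv R m n) D'.
Proof. by move=> /giso_equiv/gclsP. Qed.

End Contexts.

(** * The category of Gauss diagrams *)

Section GaussCategory.
Variable R : realType.

Lemma gcls_surj m n (c : xc_gauss R m n) :
  exists D, c = cls (@gauss_equiv R m n) D.
Proof. by exists (class_repr c); rewrite class_reprK. Qed.

Lemma gcompE m n p (E : gauss_diagram R n p) (D : gauss_diagram R m n) :
  @Defs.comp (GDXC R) m n p (cls _ E) (cls _ D) = cls (@gauss_equiv R m p) (comp_gauss E D).
Proof. exact: (gauss_ops R).1. Qed.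

Lemma gtensE m n p q (D : gauss_diagram R m n) (E : gauss_diagram R p q) :
  @tens (GDXC R) m n p q (cls _ D) (cls _ E)
  = cls (@gauss_equiv R (m + p) (n + q)) (tens_gauss D E).
Proof. exact: (gauss_ops R).2. Qed.

Lemma gidE n : @idm (GDXC R) n = cls (@gauss_equiv R n n) (id_gauss R n).
Proof. by []. Qed.

Lemma gbraidE n m :
  @braid (GDXC R) n m = cls (@gauss_equiv R (n + m) (m + n)) (sym_gauss R n m).
Proof. by []. Qed.

(** Provides a representative of a cast class; the hexagon casts an arrow before composing it, so
    the cast cannot be moved outside. *)
Lemma giso_ex m n m' n' (D : gauss_diagram R m n) : m = m' -> n = n' ->
  exists D' : gauss_diagram R m' n', giso D D'.
Proof.
move=> <- <-; exists D, id; split=> //; first by exists id.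
  by move=> j j' /val_inj->.
move=> i i' /val_inj->.
by rewrite map_map_letter_id.
Qed.

Lemma compA_giso a b c d (H : gauss_diagram R c d) (G : gauss_diagram R b c)
    (F : gauss_diagram R a b) :
  giso (comp_gauss H (comp_gauss G F)) (comp_gauss (comp_gauss H G) F).
Proof.
exists (fun x => match x with
  | inl (inl f) => inl f | inl (inr g) => inr (inl g) | inr h => inr (inr h) end); split.
- by exists (fun x => match x with
    | inl f => inl (inl f) | inr (inl g) => inl (inr g) | inr (inr h) => inr h end);
    do ?case.
- by do ?case.
- by move=> j j' /val_inj ->.
- move=> i i' /val_inj ->.
  rewrite !comp_gauss_word glinv_comp !map_cat !map_map_letter -catA.
  by congr (_ ++ (_ ++ _)); apply: eq_map_map_letter.
Qed.

Lemma comp1l_giso a b (F : gauss_diagram R a b) : giso (comp_gauss (id_gauss R b) F) F.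
Proof.
exists (fun x => match x with inl f => f | inr v => of_void _ v end); split.
- by exists inl => //; do ?case.
- by do ?case.
- by move=> j j' /val_inj ->.
- move=> i i' /val_inj ->; rewrite comp_gauss_word id_gauss_word cats0 map_map_letter.
  by rewrite map_map_letter_id.
Qed.

Lemma comp1r_giso a b (F : gauss_diagram R a b) : giso (comp_gauss F (id_gauss R a)) F.
Proof.
exists (fun x => match x with inr f => f | inl v => of_void _ v end); split.
- by exists inr => //; do ?case.
- by do ?case.
- by move=> j j' /val_inj ->.
- move=> i i' /val_inj ->; rewrite comp_gauss_word id_gauss_word glinv_id map_map_letter.
  by rewrite map_map_letter_id.
Qed.

Lemma tens1_giso a b : giso (tens_gauss (id_gauss R a) (id_gauss R b)) (id_gauss R (a + b)).
Proof.
exists (fun x => match x with inl v => v | inr v => v end); split.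
- by exists inl; do ?case.
- by do ?case.
- move=> j j' /val_inj <-; case: (fintype.split_ordP j) => k ->.
    by rewrite tens_last_l.
  by rewrite tens_last_r.
- move=> i i' _; rewrite id_gauss_word; case: (fintype.split_ordP i) => k ->.
    by rewrite tens_gauss_word_l id_gauss_word.
  by rewrite tens_gauss_word_r id_gauss_word.
Qed.

Lemma tens_comp_giso a b c a' b' c' (G : gauss_diagram R b c) (F : gauss_diagram R a b)
    (G' : gauss_diagram R b' c') (F' : gauss_diagram R a' b') :
  giso (tens_gauss (comp_gauss G F) (comp_gauss G' F'))
       (comp_gauss (tens_gauss G G') (tens_gauss F F')).
Proof.
exists (fun x => match x with
  | inl (inl f) => inl (inl f) | inl (inr g) => inr (inl g)
  | inr (inl f) => inl (inr f) | inr (inr g) => inr (inr g) end); split.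
- by exists (fun x => match x with
  | inl (inl f) => inl (inl f) | inl (inr g) => inr (inl g)
  | inr (inl f) => inl (inr f) | inr (inr g) => inr (inr g) end); do ?case.
- by do ?case.
- move=> j j' /val_inj <-; case: (fintype.split_ordP j) => k ->.
    by rewrite comp_last !tens_last_l.
  by rewrite comp_last !tens_last_r.
- move=> i i' /val_inj <-; rewrite comp_gauss_word.
  case: (fintype.split_ordP i) => k ->.
    rewrite glinv_tens_l !tens_gauss_word_l comp_gauss_word !map_cat !map_map_letter.
    by congr (_ ++ _); apply: eq_map_map_letter.
  rewrite glinv_tens_r !tens_gauss_word_r comp_gauss_word !map_cat !map_map_letter.
  by congr (_ ++ _); apply: eq_map_map_letter.
Qed.

Lemma tensA_giso a b c a' b' c' (F : gauss_diagram R a a') (G : gauss_diagram R b b')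
    (H : gauss_diagram R c c') :
  giso (tens_gauss F (tens_gauss G H)) (tens_gauss (tens_gauss F G) H).
Proof.
exists (fun x => match x with
  | inl f => inl (inl f) | inr (inl g) => inl (inr g) | inr (inr h) => inr h end); split.
- by exists (fun x => match x with
    | inl (inl f) => inl f | inl (inr g) => inr (inl g) | inr h => inr (inr h) end);
    do ?case.
- by do ?case.
- move=> j j'; case: (fintype.split_ordP j) => k ->; [|case: (fintype.split_ordP k) => l ->].
  + move=> e; have -> : j' = lshift c' (lshift b' k) by apply: val_inj.
    by rewrite !tens_last_l.
  + move=> e; have -> : j' = lshift c' (rshift a' l) by apply: val_inj.
    by rewrite tens_last_r !tens_last_l tens_last_r.
  + move=> e; have -> : j' = rshift (a' + b') l by apply: ord_inj; rewrite -e /= addnA.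
    by rewrite !tens_last_r /= addnA.
- move=> j j'; case: (fintype.split_ordP j) => k ->; [|case: (fintype.split_ordP k) => l ->].
  + move=> e; have -> : j' = lshift c (lshift b k) by apply: val_inj.
    by rewrite !tens_gauss_word_l !map_map_letter; apply: eq_map_map_letter.
  + move=> e; have -> : j' = lshift c (rshift a l) by apply: val_inj.
    rewrite tens_gauss_word_r !tens_gauss_word_l tens_gauss_word_r !map_map_letter.
    by apply: eq_map_map_letter.
  + move=> e; have -> : j' = rshift (a + b) l by apply: ord_inj; rewrite -e /= addnA.
    by rewrite !tens_gauss_word_r !map_map_letter; apply: eq_map_map_letter.
Qed.

Lemma tens1l_giso a b (F : gauss_diagram R a b) : giso (tens_gauss (id_gauss R 0) F) F.
Proof.
exists (fun x => match x with inr f => f | inl v => of_void _ v end); split.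
- by exists inr => //; do ?case.
- by do ?case.
- move=> j j'; case: (fintype.split_ordP j) => k -> e; first by case: k e.
  by have -> : j' = k by [apply: val_inj]; rewrite tens_last_r.
- move=> i i'; case: (fintype.split_ordP i) => k -> e; first by case: k e.
  have -> : i' = k by apply: val_inj.
  by rewrite tens_gauss_word_r map_map_letter map_map_letter_id.
Qed.

Lemma tens1r_giso a b (F : gauss_diagram R a b) : giso (tens_gauss F (id_gauss R 0)) F.
Proof.
exists (fun x => match x with inl f => f | inr v => of_void _ v end); split.
- by exists inl => //; do ?case.
- by do ?case.
- move=> j j'; case: (fintype.split_ordP j) => k -> e; last by case: k e.
  by have -> : j' = k by [apply: val_inj]; rewrite tens_last_l.
- move=> i i'; case: (fintype.split_ordP i) => k -> e; last by case: k e.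
  have -> : i' = k by apply: val_inj.
  by rewrite tens_gauss_word_l map_map_letter map_map_letter_id.
Qed.

Lemma braid_nat_giso a b c d (F : gauss_diagram R a c) (G : gauss_diagram R b d) :
  giso (comp_gauss (sym_gauss R c d) (tens_gauss F G))
       (comp_gauss (tens_gauss G F) (sym_gauss R a b)).
Proof.
exists (fun x => match x with
  | inl (inl f) => inr (inr f) | inl (inr g) => inr (inl g) | inr v => of_void _ v end); split.
- by exists (fun x => match x with
  | inr (inl f) => inl (inr f) | inr (inr g) => inl (inl g) | inl v => of_void _ v end);
  do ?case.
- by do ?case.
- move=> j j' /val_inj <-; rewrite !comp_last !sym_last.
  case: (fintype.split_ordP j) => k ->.
    by rewrite swap_lshift tens_last_r tens_last_l swap_lshift.
  by rewrite swap_rshift tens_last_l tens_last_r swap_rshift.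
- move=> i i' /val_inj <-; rewrite !comp_gauss_word !sym_gauss_word glinv_sym cats0 /=.
  case: (fintype.split_ordP i) => k ->.
    rewrite swap_lshift tens_gauss_word_l tens_gauss_word_r !map_map_letter.
    by apply: eq_map_map_letter.
  rewrite swap_rshift tens_gauss_word_l tens_gauss_word_r !map_map_letter.
  by apply: eq_map_map_letter.
Qed.

Lemma braidK_giso a b :
  giso (comp_gauss (sym_gauss R b a) (sym_gauss R a b)) (id_gauss R (a + b)).
Proof.
exists (fun x => match x with inl v => v | inr v => v end); split.
- by exists inl; do ?case.
- by do ?case.
- by move=> j j' /val_inj <-; rewrite comp_last !sym_last swap_ordK.
- by move=> i i' _; rewrite comp_gauss_word !sym_gauss_word id_gauss_word.
Qed.

(** D represents the cast of the product of a symmetry with an identity. There are no chords and all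
    words are empty, so the content is an equality of permutations, in which the gluing of D is read
    in nat. *)
Lemma hexagon_giso a b c (D : gauss_diagram R ((a + b) + c) (b + (a + c))) :
  giso (tens_gauss (sym_gauss R a b) (id_gauss R c)) D ->
  giso (sym_gauss R a (b + c))
       (comp_gauss (tens_gauss (id_gauss R b) (sym_gauss R a c)) D).
Proof.
case=> f [[g _ gK] _ fl fw].
exists (fun v : void => of_void _ v); split.
- have gD (x : gchord D) : void by case: (g x).
  exists (fun x => match x with inl c => gD c | inr (inl v) => v | inr (inr v) => v end).
    by case.
  by move=> [x|[[]|[]]]; case: (gD x).
- by case.
- move=> j j' e; rewrite sym_last comp_last [nat_of_ord (swap_ord _)]/= e {j e}.
  (* The end point lies in the block of b, of c or of a, in this order. *)
  case: (fintype.split_ordP j') => k ->; [|case: (fintype.split_ordP k) => l ->].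
  + rewrite tens_last_l id_last -(fl (lshift c (lshift a k)) (lshift _ k)) //.
    rewrite tens_last_l sym_last swap_lshift /= addnC modn_small //.
    rewrite [(b + c + a)%N]addnC ltn_add2l.
    exact: leq_trans (ltn_ord k) (leq_addr _ _).
  + have e : rshift (b + a) l = rshift b (rshift a l) :> nat by rewrite /= addnA.
    rewrite tens_last_r sym_last swap_lshift -(fl _ _ e) tens_last_r id_last /=.
    rewrite addnC addnA [(b + c + a)%N]addnC addnA [(a + b)%N]addnC modn_small //.
    by rewrite ltn_add2l.
  + rewrite tens_last_r sym_last swap_rshift.
    rewrite -(fl (lshift c (rshift b l)) (rshift _ (lshift _ l))) //.
    rewrite tens_last_l sym_last swap_rshift /= addnA addnAC modnDl modn_small //.
    exact: leq_trans (ltn_ord l) (leq_addl _ _).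
- have Dw i : gauss_word D i = [::].
    rewrite (fw i i erefl); case: (fintype.split_ordP i) => k ->.
      by rewrite tens_gauss_word_l sym_gauss_word.
    by rewrite tens_gauss_word_r id_gauss_word.
  move=> i i' _; rewrite sym_gauss_word comp_gauss_word Dw /=.
  case: (fintype.split_ordP (glinv D i')) => k ->.
    by rewrite tens_gauss_word_l id_gauss_word.
  by rewrite tens_gauss_word_r sym_gauss_word.
Qed.

Lemma gauss_ssmc : is_ssmc (GDXC R).
Proof.
split.
- move=> a b c d h g f; have [H ->] := gcls_surj h; have [G ->] := gcls_surj g.
  have [F ->] := gcls_surj f; rewrite !gcompE; exact/giso_cls/compA_giso.
- move=> a b f; have [F ->] := gcls_surj f.
  by rewrite gidE gcompE; exact/giso_cls/comp1l_giso.
- move=> a b f; have [F ->] := gcls_surj f.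
  by rewrite gidE gcompE; exact/giso_cls/comp1r_giso.
- by move=> a b; rewrite !gidE gtensE; exact/giso_cls/tens1_giso.
- move=> a b c a' b' c' g f g' f'; have [G ->] := gcls_surj g; have [F ->] := gcls_surj f.
  have [G' ->] := gcls_surj g'; have [F' ->] := gcls_surj f'.
  rewrite (gcompE G F) (gcompE G' F') !gtensE.
  apply: etrans _ (esym (gcompE (tens_gauss G G') (tens_gauss F F'))).
  exact/giso_cls/tens_comp_giso.
- exact: addnA.
- exact: add0n.
- exact: addn0.
- move=> a b c a' b' c' f g h ea eb; have [F ->] := gcls_surj f.
  have [G ->] := gcls_surj g; have [H ->] := gcls_surj h.
  by rewrite !gtensE; exact/giso_cast/tensA_giso.
- move=> a b f ea eb; have [F ->] := gcls_surj f.
  by rewrite gidE gtensE; exact/giso_cast/tens1l_giso.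
- move=> a b f ea eb; have [F ->] := gcls_surj f.
  by rewrite gidE gtensE; exact/giso_cast/tens1r_giso.
- move=> a b c d f g; have [F ->] := gcls_surj f; have [G ->] := gcls_surj g.
  rewrite !gbraidE !gtensE; apply: etrans (gcompE (sym_gauss R c d) (tens_gauss F G)) _.
  apply: etrans _ (esym (gcompE (tens_gauss G F) (sym_gauss R a b))).
  exact/giso_cls/braid_nat_giso.
- move=> a b; rewrite !gbraidE; apply: etrans (gcompE (sym_gauss R b a) (sym_gauss R a b)) _.
  exact/giso_cls/braidK_giso.
- move=> a b c e1 e2 e3; rewrite !gbraidE !gidE !gtensE.
  have [D isoD] := giso_ex (tens_gauss (sym_gauss R a b) (id_gauss R c)) erefl e3.
  rewrite (giso_cast erefl e3 isoD).
  apply: etrans _ (esym (gcompE (tens_gauss (id_gauss R b) (sym_gauss R a c)) D)).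
  exact/giso_cast/hexagon_giso.
Qed.

End GaussCategory.

(** * Strands of XC-tangle diagrams *)

(** The half-edge by which a straight path leaves after arriving at q. In this form [xstep] is an
    equation, and uniqueness of successors and of predecessors follows from injectivity of the
    attaching maps. *)
Definition after (I O B C : Type) (q : port O B C) : option (port I B C) :=
  match q with
  | Endp _ => None
  | Biv b => Some (Biv b)
  | Crs c s => Some (Crs c (~~ s))
  end.

Arguments after {I O B C} q.

Section StrandTheory.
Variables (I O : finType) (G : xgraph I O).

Lemma xstepP (e e' : xedge G) : reflect (after (xtgt e) = Some (xsrc e')) (xstep e e').
Proof.
rewrite /xstep; case: (xtgt e) (xsrc e') => [i|[b|[c s]]] [j|[b'|[c' s']]] /=;
  try (by constructor); apply: (iffP idP) => //.
- by move=> /eqP->.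
- by case=> ->.
- by case/andP=> /eqP-> /eqP->.
- by case=> -> ->; rewrite !eqxx.
Qed.

Lemma after_inj (B C : Type) (p q : port O B C) (x : port I B C) :
  after p = Some x -> after q = Some x -> p = q.
Proof.
case: p => [j|[b|[c s]]] //= [<-]; case: q => [j'|[b'|[c' s']]] //=.
  by case=> ->.
by case=> -> /(congr1 negb); rewrite !negbK => ->.
Qed.

Definition terminal (e : xedge G) := after (xtgt e) = None :> option (port I _ _).

Lemma terminal_step e e' : terminal e -> ~ xstep e e'.
Proof. by rewrite /terminal => t /xstepP; rewrite t. Qed.

Lemma Endp_terminal (e : xedge G) j : xtgt e = Endp j -> terminal e.
Proof. by rewrite /terminal => ->. Qed.

Lemma initial_step (e e' : xedge G) i : xsrc e' = Endp i -> ~ xstep e e'.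
Proof. by move=> h /xstepP; rewrite h; case: (xtgt e) => [j|[b|[c s]]]. Qed.

Hypothesis srcI : injective (@xsrc I O G).

Lemma xstep_det e e1 e2 : xstep e e1 -> xstep e e2 -> e1 = e2 :> xedge G.
Proof. by move=> /xstepP h1 /xstepP; rewrite h1 => -[/srcI]. Qed.

(* A path ending at a terminal edge cannot be prolonged, so every other path
   from the same edge is a prefix of it. *)
Lemma path_prefix e s s' : path (@xstep I O G) e s -> path (@xstep I O G) e s' ->
  terminal (last e s') -> exists t, s' = s ++ t.
Proof.
elim: s s' e => [|x s ih] s' e; first by move=> _ _ _; exists s'.
case: s' => [|x' s'] /=; first by move=> /andP[h _] _ /terminal_step/(_ h).
move=> /andP[h p] /andP[h' p']; rewrite -(xstep_det h h') in p' *.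
by move=> /(ih _ _ p p')[t ->]; exists t.
Qed.

Lemma path_det e s s' : path (@xstep I O G) e s -> path (@xstep I O G) e s' ->
  terminal (last e s) -> terminal (last e s') -> s = s'.
Proof.
move=> p p' ts ts'; have [[|x t] e'] := path_prefix p p' ts'; first by rewrite e' cats0.
by move: p'; rewrite e' cat_path /= => /and3P[_ /(terminal_step ts)].
Qed.

Lemma strand_uniq i s j s' j' :
  @is_strand I O G i s j -> @is_strand I O G i s' j' -> s = s' /\ j = j'.
Proof.
case: s s' => [|e s] [|e' s'] //= [h1 h2 h3] [h1' h2' h3'].
have ee : e = e' by apply: srcI; rewrite h1 h1'.
subst e'; have es := path_det h2 h2' (Endp_terminal h3) (Endp_terminal h3').
by subst s'; split=> //; move: h3'; rewrite h3 => -[].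
Qed.

(** A return to e would give two terminating paths from e, the whole one and the part after the
    return. Determinism equates them, contrary to their lengths. *)
Lemma path_notin e s : path (@xstep I O G) e s -> terminal (last e s) -> e \notin s.
Proof.
move=> p t; apply/negP => h; case/splitPr: h p t => s1 s2.
rewrite cat_path last_cat /= => /and3P[p1 h p2] t.
have : s2 = s1 ++ e :: s2.
  by apply: (path_det p2) => //; rewrite ?cat_path ?last_cat /= ?p1 ?h.
by move/(congr1 size); rewrite size_cat /=; lia.
Qed.

Lemma strand_nodup i s j : @is_strand I O G i s j -> uniq s.
Proof.
case: s => //= e s [_ p /Endp_terminal t].
elim: s e p t => //= x s ih e /andP[h p] t; rewrite (ih x) // andbT.
by apply: (@path_notin e (x :: s)) => //=; rewrite h.
Qed.

Hypothesis tgtI : injective (@xtgt I O G).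

Lemma xstep_codet e e1 e2 : xstep e1 e -> xstep e2 e -> e1 = e2 :> xedge G.
Proof. by move=> /xstepP h1 /xstepP h2; apply: tgtI; apply: after_inj h1 h2. Qed.

(** Both paths are run backwards from the common edge: predecessors are unique, and an edge leaving
    an initial vertex has none. *)
Lemma path_start p x i q y i' :
  xsrc x = Endp i -> xsrc y = Endp i' ->
  path (@xstep I O G) x p -> path (@xstep I O G) y q -> last x p = last y q -> x = y.
Proof.
move=> sx sy; elim/last_ind: p q => [|p z ih] q; case/lastP: q => [|q w] //=.
- by rewrite rcons_path last_rcons => _ /andP[_ h] e; move: h; rewrite -e => /(initial_step sx).
- by rewrite rcons_path last_rcons => /andP[_ h] _ e; move: h; rewrite e => /(initial_step sy).
rewrite !rcons_path !last_rcons => /andP[hp h1] /andP[hq h2] e; rewrite e in h1.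
exact: ih hp hq (xstep_codet h1 h2).
Qed.

Lemma strand_start i s j i' s' j' e :
  @is_strand I O G i s j -> @is_strand I O G i' s' j' -> e \in s -> e \in s' -> i = i'.
Proof.
case: s s' => [|x s] [|y s'] //= [hx px _] [hy py _] hs hs'.
have [p pp lp] : exists2 p, path (@xstep I O G) x p & last x p = e.
  by case/splitPl: hs px => s1 s2 <-; rewrite cat_path => /andP[p1 _]; exists s1.
have [q pq lq] : exists2 q, path (@xstep I O G) y q & last y q = e.
  by case/splitPl: hs' py => s1 s2 <-; rewrite cat_path => /andP[p1 _]; exists s1.
have exy := path_start hx hy pp pq (etrans lp (esym lq)).
by move: hy; rewrite -exy hx => -[].
Qed.

Lemma strand_prev i s j p e : @is_strand I O G i s j ->
  onth s p.+1 = Some e -> exists e1, onth s p = Some e1 /\ xstep e1 e.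
Proof.
case: s => [//|x s] [_ pth _] h; have lt : (p.+1 < size (x :: s))%N by rewrite -onthTE h.
exists (nth x (x :: s) p); split; first by rewrite onthE (nth_map x) // ltnW.
have /(sortedP x)/(_ p lt) : sorted (@xstep I O G) (x :: s) := pth.
by rewrite (onth_nth x _ _ _ h).
Qed.

Lemma strand_head i s j e : @is_strand I O G i s j -> onth s 0 = Some e -> xsrc e = Endp i.
Proof. by case: s => //= x s [h _ _] [<-]. Qed.

End StrandTheory.

Section Diagrams.
Variables (I O : finType) (G : xgraph I O).
Hypothesis GP : is_diagram G.

Definition strand (i : I) : seq (xedge G) := sval (cid (strand_from GP i)).
Definition strand_end (i : I) : O := sval (cid (svalP (cid (strand_from GP i)))).

Lemma strandP i : @is_strand I O G i (strand i) (strand_end i).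
Proof. exact: svalP (cid (svalP (cid (strand_from GP i)))). Qed.

Lemma diag_srcI : injective (@xsrc I O G). Proof. exact/bij_inj/diag_src. Qed.
Lemma diag_tgtI : injective (@xtgt I O G). Proof. exact/bij_inj/diag_tgt. Qed.

Lemma strand_eq i s j : @is_strand I O G i s j -> s = strand i /\ j = strand_end i.
Proof. by move=> h; apply: strand_uniq (diag_srcI) _ _ _ _ _ h (strandP i). Qed.

(** Some strand contains e by definition of a diagram; a strand never repeats an edge, and two
    strands sharing one have the same start. *)
Lemma strand_once e : once strand e.
Proof.
have [i [s [j [h es]]]] := diag_strand GP e.
have [hs _] := strand_eq h; rewrite {}hs in h es.
apply: (@once_at _ _ _ _ i) => i'; rewrite count_uniq_mem; last first.
  exact: (strand_nodup diag_srcI (strandP i')).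
congr nat_of_bool; apply/idP/eqP => [h'|->//].
exact: (strand_start diag_tgtI (strandP i') (strandP i) h' es).
Qed.

(** Strands with the same end share their last edge, hence their start. *)
Lemma strand_end_bij : bijective strand_end.
Proof.
apply: inj_surj_bij => [i i' e|j]; last first.
  have [i [s h]] := strand_to GP j; exists i.
  by have [_ ->] := strand_eq h.
have := strandP i; have := strandP i'; rewrite -e.
case Es' : (strand i') => [//|x' s'] hs'; case Es : (strand i) => [//|x s] hs.
apply: (@strand_start _ _ _ diag_tgtI _ _ _ _ _ _ (last x s) hs hs').
  exact: mem_last.
have -> : last x s = last x' s'; last exact: mem_last.
by have [_ _ h] := hs; have [_ _ h'] := hs'; apply: (diag_tgtI); rewrite h h'.
Qed.

Lemma strand_word_once (l : letter (xcross G)) e :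
  (forall e', count_mem l (edge_word e') = (e' == e)) ->
  once (fun i => strand_word (strand i)) l.
Proof.
move=> h; apply: eq_once (strand_once e) => i.
by rewrite count_flatten_map -sum_count_eq; apply: eq_bigr.
Qed.

Lemma edge_word_count e' (l : letter (xcross G)) :
  l \notin [:: Rplus; Rminus] ->
  count_mem l (edge_word e') =
    nat_of_bool
      (if xtgt e' is Crs c s then (if s == xsign c then Over c else Under c) == l else false).
Proof.
rewrite !inE negb_or => /andP[/negbTE lp /negbTE lm].
rewrite /edge_word count_cat (_ : count_mem l (if _ then _ else _) = 0%N); last first.
  by do 2?case: ifP => _ //=; rewrite eq_sym ?lp ?lm.
by case: (xtgt e') => [j|[b|[c s]]] //=; rewrite addn0.
Qed.

(** The letter is written by the only edge that arrives at the slot s of c. Overpass and underpass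
    are the two values of s, which is why they are treated together. *)
Lemma strand_word_once_pass c s :
  once (fun i => strand_word (strand i)) (if s == xsign c then Over c else Under c).
Proof.
have [g gK Kg] := diag_tgt GP; apply: (@strand_word_once _ (g (Crs c s))) => e'.
rewrite edge_word_count; last by case: ifP.
congr nat_of_bool; apply/idP/eqP => [|->]; last by rewrite Kg eqxx.
case E : (xtgt e') => [j|[b|[c' s']]] //; rewrite -[e']gK E => h; congr (g _).
move: h; case: ifP => [/eqP->|/negbT h];
  case: ifP => [/eqP->|/negbT h'] // /eqP[ec]; subst c' => //.
by clear E; congr (Crs c _); case: s s' (xsign c) h h' => [] [] [].
Qed.

Lemma strand_word_once_over c : once (fun i => strand_word (strand i)) (Over c).
Proof. by have := strand_word_once_pass c (xsign c); rewrite eqxx. Qed.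

Lemma strand_word_once_under c : once (fun i => strand_word (strand i)) (Under c).
Proof.
by have := strand_word_once_pass c (~~ xsign c); case: (xsign c).
Qed.

End Diagrams.

(** * Words and edge data read off a graph *)

(** Variant of [gauss_diagram_of] asking for one suitable strand from each i instead of speaking of
    all strands; uniqueness of strands makes the two agree on diagrams. It applies to any graph and
    to words over any set of labels. *)
Definition spells (I O : finType) (G : xgraph I O) (C : Type) (s : C -> bool)
    (last : O -> I) (W : I -> seq (letter C)) : Prop :=
  exists f : xcross G -> C,
    [/\ bijective f, (forall c, s (f c) = xsign c) &
        forall i, exists t j, [/\ @is_strand I O G i t j, last j = i &
           W i = map (map_letter f) (strand_word t)]].

Lemma gauss_diagram_ofP (R : realType) m n (T : tangle_diagram m n)
    (D : gauss_diagram R m n) :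
  gauss_diagram_of T D <-> spells T (@gsign _ _ _ D) (glast D) (gauss_word D).
Proof.
split=> -[f [fb fs h]]; exists f; split=> // i.
  have [j [s h']] := strand_from (tgraphP T) i.
  by exists j, s; have [] := h _ _ _ h'.
move=> s j hs; have [t [k [ht hl hw]]] := h i.
by have [-> ->] := strand_uniq (diag_srcI (tgraphP T)) hs ht.
Qed.

Lemma tangle_gauss (R : realType) m n (T : tangle_diagram m n) :
  exists D : gauss_diagram R m n, gauss_diagram_of T D.
Proof.
have TP := tgraphP T; have [l [lb lK Kl]] := bij_inv (strand_end_bij TP).
have [D [f [fb fs fl fw]]] := realize_gauss R (@xsign _ _ T) lb
  (strand_word_once_over TP) (strand_word_once_under TP).
exists D; apply/gauss_diagram_ofP; exists f; split=> // i.
by exists (strand TP i), (strand_end TP i); split; [exact: strandP|rewrite fl lK|].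
Qed.

Definition relabel (I B C B' C' : Type) (fb : B -> B') (fc : C -> C') :
    port I B C -> port I B' C' :=
  port_map (fun i => Endp i) fb fc.

Lemma relabel_bij (I B C B' C' : Type) (fb : B -> B') (fc : C -> C') :
  bijective fb -> bijective fc -> bijective (@relabel I _ _ _ _ fb fc).
Proof.
case=> b' bK Kb [c' cK Kc].
by exists (@relabel I _ _ _ _ b' c') => -[i|[b|[c s]]]; rewrite /relabel /= ?bK ?cK ?Kb ?Kc.
Qed.

Lemma after_relabel (I O : finType) (B C B' C' : Type)
    (fb : B -> B') (fc : C -> C') (q : port O B C) :
  after (relabel fb fc q) = omap (@relabel I _ _ _ _ fb fc) (after q).
Proof. by case: q => [i|[b|[c s]]]. Qed.

Section Isomorphisms.
Variables (I O : finType).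
Implicit Types G H : xgraph I O.

Section IsoMap.
Variables (G H : xgraph I O) (fe : xedge G -> xedge H) (fb : xbiv G -> xbiv H)
  (fc : xcross G -> xcross H).
Hypothesis hs : forall c, xsign (fc c) = xsign c.
Hypothesis hr : forall e, xrot (fe e) = xrot e.
Hypothesis hsrc : forall e, xsrc (fe e) = relabel fb fc (xsrc e).
Hypothesis htgt : forall e, xtgt (fe e) = relabel fb fc (xtgt e).

Lemma iso_strand i s j : @is_strand I O G i s j -> @is_strand I O H i (map fe s) j.
Proof.
apply: is_strand_map => [e e'|e he|e he].
- by move=> /xstepP h; apply/xstepP; rewrite htgt hsrc after_relabel h.
- by rewrite hsrc he.
- by rewrite htgt he.
Qed.

Lemma iso_strand_word s : strand_word (map fe s) = map (map_letter fc) (strand_word s).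
Proof.
rewrite /strand_word -map_comp map_flatten_map; congr flatten; apply: eq_map => e /=.
rewrite /edge_word hr htgt map_cat; congr (_ ++ _); first by do 2?case: ifP.
by case: (xtgt e) => [i|[b|[c b]]] //=; rewrite hs; case: ifP.
Qed.

End IsoMap.

Lemma xiso_spells G H C (s : C -> bool) last W :
  xiso G H -> spells G s last W -> spells H s last W.
Proof.
case=> fe [fb [fc [[eb bb cb] hs hr hsrc htgt]]] [f [fbij fs h]].
have [gc [gcb fcK gcK]] := bij_inv cb.
exists (f \o gc); split; first exact: bij_comp.
  by move=> c /=; rewrite fs -hs gcK.
move=> i; have [t [j [ht hl hw]]] := h i.
exists (map fe t), j; split=> //; first exact: (iso_strand hsrc htgt ht).
rewrite (iso_strand_word hs hr htgt) map_map_letter hw.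
by apply: eq_map_map_letter => c /=; rewrite fcK.
Qed.

Lemma xiso_diagram G H : xiso G H -> is_diagram G -> is_diagram H.
Proof.
move=> iso GP; have [fe [fb [fc [[eb bb cb] hs hr hsrc htgt]]]] := iso.
have [ge [geb feK geK]] := bij_inv eb; split.
- by move=> e; rewrite -(geK e) hr; apply: (diag_rot GP).
- apply: (@eq_bij _ _ (relabel fb fc \o (@xsrc _ _ G \o ge))); last first.
    by move=> e; rewrite /= -[in RHS](geK e) hsrc.
  exact: bij_comp (relabel_bij _ bb cb) (bij_comp (diag_src GP) geb).
- apply: (@eq_bij _ _ (relabel fb fc \o (@xtgt _ _ G \o ge))); last first.
    by move=> e; rewrite /= -[in RHS](geK e) htgt.
  exact: bij_comp (relabel_bij _ bb cb) (bij_comp (diag_tgt GP) geb).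
- move=> e; have [i [s [j [h es]]]] := diag_strand GP (ge e).
  exists i, (map fe s), j; split; first exact: (iso_strand hsrc htgt h).
  by rewrite -(geK e) map_f.
Qed.

End Isomorphisms.

(* What a strand word forgets of an edge is whether it carries a letter at all
   and which final vertex it ends at. *)
Definition edge_data (I O : finType) (G : xgraph I O) (C : Type) (f : xcross G -> C)
    (e : xedge G) : int * port O unit C :=
  (xrot e, relabel (fun=> tt) f (xtgt e)).

Definition spells_data (I O : finType) (G : xgraph I O) (C : Type) (s : C -> bool)
    (E : I -> seq (int * port O unit C)) : Prop :=
  exists f : xcross G -> C,
    [/\ bijective f, (forall c, s (f c) = xsign c) &
        forall i, exists t j, @is_strand I O G i t j /\ E i = map (edge_data f) t].

(** Edges are matched by their places on the strands and crossings by their labels. The data hide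
    the names of bivalent vertices and say nothing of sources; both are recovered from the matching
    of edges. *)
Lemma spells_data_iso (I O : finType) (G H : xgraph I O) (C : Type) (s : C -> bool)
    (E : I -> seq (int * port O unit C)) :
  is_diagram G -> is_diagram H -> spells_data G s E -> spells_data H s E -> xiso G H.
Proof.
move=> GP HP [f [fb fs hG]] [g [gb gs hH]].
have eG i : E i = map (edge_data f) (strand GP i).
  by have [t [j [ht ->]]] := hG i; have [-> _] := strand_eq GP ht.
have eH i : E i = map (edge_data g) (strand HP i).
  by have [t [j [ht ->]]] := hH i; have [-> _] := strand_eq HP ht.
pose al := aligned (strand GP) (strand HP).
have sz i : size (strand GP i) = size (strand HP i).
  by have /(congr1 size) := eH i; rewrite eG !size_map.
have ald e e' : al e e' -> edge_data f e = edge_data g e'.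
  case=> i [p [h h']]; have := congr1 (fun s => onth s p) (eH i).
  by rewrite eG !onth_map h h' /= => /Some_inj.
have tot e : exists e', al e e' := aligned_total (strand_once GP) sz e.
have sur e : exists e', al e' e := aligned_surj (strand_once HP) sz e.
have fun_ e e1 e2 : al e e1 -> al e e2 -> e1 = e2 :=
  @aligned_fun _ _ _ _ _ (strand_once GP) e e1 e2.
have inj_ e e1 e2 : al e1 e -> al e2 e -> e1 = e2.
  by move=> h1 h2; exact: (aligned_inj (strand_once HP) h1 h2).
have [fe [feb fea]] := rel_bij tot sur fun_ (fun e1 e2 e => @inj_ e e1 e2).
have [g' [gb' gK gK']] := bij_inv gb.
pose fc := g' \o f; have fcb : bijective fc by apply: bij_comp.
(* Bivalent vertices correspond when the unique edges entering them do. *)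
pose rb b b' := exists e e', [/\ al e e', xtgt e = Biv b & xtgt e' = Biv b'].
have [gG gGK KgG] := diag_tgt GP; have [gH gHK KgH] := diag_tgt HP.
have [] := @rel_bij _ _ rb.
- move=> b; have [e' h] := tot (gG (Biv b)).
  have := ald _ _ h; rewrite /edge_data KgG => -[_].
  case E' : (xtgt e') => [j|[b'|[c s']]] //= _.
  by exists b', (gG (Biv b)), e'.
- move=> b; have [e h] := sur (gH (Biv b)).
  have := ald _ _ h; rewrite /edge_data KgH => -[_].
  case E' : (xtgt e) => [j|[b'|[c s']]] //= _.
  by exists b', e, (gH (Biv b)).
- move=> b b1 b2 [e [e1 [h t t1]]] [e' [e2 [h' t' t2]]].
  have ee : e = e' by apply: (diag_tgtI GP); rewrite t t'.
  by subst e'; have ee := fun_ _ _ _ h h'; subst e2; move: t2; rewrite t1 => -[].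
- move=> b1 b2 b [e1 [e [h t1 t]]] [e2 [e' [h' t2 t']]].
  have ee : e = e' by apply: (diag_tgtI HP); rewrite t t'.
  by subst e'; have ee := inj_ _ _ _ h h'; subst e2; move: t2; rewrite t1 => -[].
move=> hb [hbb hbr].
have tgt_al e e' : al e e' -> xtgt e' = relabel hb fc (xtgt e).
  move=> h; have := ald _ _ h; rewrite /edge_data => -[_].
  case t : (xtgt e) => [j|[b|[c s1]]]; case t' : (xtgt e') => [j'|[b'|[c' s1']]] //=.
  - by case=> ->.
  - move=> _; have [e1 [e2 [h1 t1 t2]]] := hbr b.
    have ee : e = e1 by apply: (diag_tgtI GP); rewrite t t1.
    by subst e1; have ee := fun_ _ _ _ h h1; subst e2; move: t2; rewrite t' => -[->].
  - by case=> ec ->; rewrite /relabel /= /fc /= ec gK.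
exists fe, hb, fc; split=> // [c|e|e|e].
- by rewrite -gs /fc /= gK' fs.
- by have [] := ald _ _ (fea e).
(* The source of an edge is the initial vertex of its strand or is determined by the target of the
   preceding edge, which has already been matched. *)
- have [i [[|p] [h h']]] := fea e.
    by rewrite (strand_head (strandP GP i) h) (strand_head (strandP HP i) h').
  have [e1 [h1 /xstepP s1]] := strand_prev (strandP GP i) h.
  have [e2 [h2 /xstepP s2]] := strand_prev (strandP HP i) h'.
  have a12 : al e1 e2 by exists i, p.
  by move: s2; rewrite (tgt_al _ _ a12) after_relabel s1 => -[].
- exact: tgt_al (fea e).
Qed.

(** * Tangle diagrams with the same words *)

(** Common to subdivision and to the filling of holes: each edge of a path is replaced by an edge
    followed by a possibly empty tail. *)
Lemma path_expand (A B : Type) (r : rel A) (r' : rel B) (h : A -> B) (t : A -> seq B) :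
  (forall e, path r' (h e) (t e)) ->
  (forall e e', r e e' -> r' (last (h e) (t e)) (h e')) ->
  forall e s, path r e s ->
    path r' (h e) (t e ++ flatten [seq h x :: t x | x <- s]) /\
    last (h e) (t e ++ flatten [seq h x :: t x | x <- s])
      = last (h (last e s)) (t (last e s)).
Proof.
move=> ht hr e s; elim: s e => [|x s ih] e /=; first by rewrite cats0.
by move=> /andP[hx /ih[p l]]; rewrite cat_path last_cat /= ht hr //= p.
Qed.

(** * Subdivision of an edge *)

Section Splitting.
Variables (I O : finType) (G : xgraph I O) (e0 : xedge G) (a b : int).

Local Notation H := (xsplit e0 a b).
Definition split_tail (e : xedge G) : seq (xedge H) := if e == e0 then [:: None] else [::].
Definition split_edge (e : xedge G) : seq (xedge H) := Some e :: split_tail e.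

Lemma split_last_tgt e :
  xtgt (last (Some e : xedge H) (split_tail e)) = port_map (fun j => Endp j) some id (xtgt e).
Proof. by rewrite /split_tail; case: eqP => [->|/eqP/negbTE ne] //=; rewrite ne. Qed.

Lemma split_strand i s j : @is_strand I O G i s j ->
  @is_strand I O H i (flatten (map split_edge s)) j.
Proof.
case: s => //= e s [he p t].
have [] := @path_expand _ _ (@xstep I O G) (@xstep I O H) (fun e => Some e) split_tail _ _ e s p.
- by move=> e'; rewrite /split_tail; case: eqP => //= ->; rewrite /xstep /= eqxx.
- move=> e1 e2 /xstepP h; apply/xstepP; rewrite split_last_tgt after_relabel h /=.
  by case: (xsrc e2) => [?|[?|[? ?]]].
move=> p' l'; split=> //; first by rewrite he.
by move: l' => /= ->; apply: etrans (split_last_tgt _) _; rewrite t.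
Qed.

Hypothesis GP : is_diagram G.

Lemma split_diagram : `|a| <= 1 -> `|b| <= 1 -> is_diagram H.
Proof.
move=> a1 b1; split.
- by case=> [e|] //=; case: eqP => // _; apply: (diag_rot GP).
- have [g gK Kg] := diag_src GP.
  exists (fun p : port I (option (xbiv G)) (xcross G) => match p with
    | Endp i => Some (g (Endp i)) | Biv None => None
    | Biv (Some b) => Some (g (Biv b)) | Crs c s => Some (g (Crs c s)) end).
    by case=> [e|] //=; case E : (xsrc e) => [i|[b'|[c s]]] /=; rewrite -E gK.
  by case=> [i|[[b'|]|[c s]]] //=; rewrite Kg.
- have [g gK Kg] := diag_tgt GP; pose k p : option (xedge G) :=
    if g p == e0 then None else Some (g p).
  exists (fun p : port O (option (xbiv G)) (xcross G) => match p with
    | Endp i => k (Endp i) | Biv None => Some e0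
    | Biv (Some b) => k (Biv b) | Crs c s => k (Crs c s) end).
    case=> [e|] /=; first case: eqP => [->//|/eqP/negbTE ne].
      by case E : (xtgt e) => [i|[b'|[c s]]] /=; rewrite -E /k gK ne.
    by case E : (xtgt e0) => [i|[b'|[c s]]] /=; rewrite -E /k gK eqxx.
  by case=> [i|[[b'|]|[c s]]] /=; rewrite ?eqxx // /k; case: ifP => [/eqP<-|->]; rewrite Kg.
- move=> e; pose e' := if e is Some e then e else e0.
  have [i [s [j [hs es]]]] := diag_strand GP e'.
  exists i, (flatten (map split_edge s)), j; split; first exact: split_strand.
  apply/flattenP; exists (split_edge e'); first exact: map_f.
  by rewrite /e' /split_edge; case: e {e' es} => [e|]; rewrite !inE ?eqxx //= /split_tail eqxx.
Qed.

Lemma split_data_other (C : Type) (f : xcross G -> C) s : e0 \notin s ->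
  map (@edge_data I O H C f) (flatten (map split_edge s)) = map (edge_data f) s.
Proof.
elim: s => //= e s ih; rewrite inE negb_or => /andP[ne /ih].
rewrite /split_edge /split_tail /edge_data /= eq_sym (negbTE ne) /= => ->.
by congr ((_, _) :: _); case: (xtgt e) => [?|[?|[? ?]]].
Qed.

Lemma split_data_at (C : Type) (f : xcross G -> C) s1 s2 : uniq (s1 ++ e0 :: s2) ->
  map (@edge_data I O H C f) (flatten (map split_edge (s1 ++ e0 :: s2))) =
  map (edge_data f) s1 ++ (a, Biv tt) :: (b, (edge_data f e0).2) :: map (edge_data f) s2.
Proof.
rewrite cat_uniq /= negb_or => /and3P[_ /andP[n1 _] /andP[n2 _]].
rewrite map_cat flatten_cat map_cat split_data_other //=; congr (_ ++ _).
rewrite /split_tail eqxx /= split_data_other // /edge_data /= eqxx /=.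
by congr (_ :: (_, _) :: _); case: (xtgt e0) => [?|[?|[? ?]]].
Qed.

End Splitting.

(** * Common refinements of sequences of edge data *)

Section Refinement.
Variables (O : eqType) (C : eqType) (s : C -> bool).
Notation datum := (int * port O unit C)%type.

(** A step mirrors a subdivision by Omega0r: the new bivalent vertex is the target of the first
    half, and the second half inherits the old target. The bounds on a and b keep the subdivided
    graph a diagram. *)
Inductive refine : seq datum -> seq datum -> Prop :=
| refine_refl w : refine w w
| refine_step u c x t a b w : a + b = c -> `|a| <= 1 -> `|b| <= 1 ->
    refine (u ++ (a, Biv tt) :: (b, x) :: t) w -> refine (u ++ (c, x) :: t) w.

Lemma refine_trans w1 w2 w3 : refine w1 w2 -> refine w2 w3 -> refine w1 w3.
Proof.
move=> h; elim: h w3 => {w1 w2} // u c x t a b w e ha hb _ ih w3 /ih.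
exact: refine_step.
Qed.

Lemma refine_cons y w w' : refine w w' -> refine (y :: w) (y :: w').
Proof.
elim=> {w w'} [w|u c x t a b w e ha hb _ ih]; first exact: refine_refl.
by rewrite -cat_cons; apply: refine_step e ha hb _; rewrite cat_cons.
Qed.

Lemma refine_split c x t a b : a + b = c -> `|a| <= 1 -> `|b| <= 1 ->
  refine ((c, x) :: t) ((a, Biv tt) :: (b, x) :: t).
Proof. by move=> e ha hb; apply: (@refine_step [::] c x t a b) => //; apply: refine_refl. Qed.

Definition datum_word (y : datum) : seq (letter C) :=
  (if y.1 == 1 then [:: Rplus] else if y.1 == -1 then [:: Rminus] else [::])
  ++ match y.2 with
     | Crs c b => [:: if b == s c then Over c else Under c]
     | _ => [::]
     end.

Definition data_word (w : seq datum) : seq (letter C) := flatten (map datum_word w).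

(** The shape of the data of a strand: a final vertex is reached by the last edge and by no
    other. *)
Fixpoint ends_at (j : O) (w : seq datum) : bool :=
  if w is y :: w' then
    if y.2 is Endp j' then (j' == j) && nilp w' else ends_at j w'
  else false.

Definition bounded (y : datum) : bool := `|y.1| <= 1.

(** Such an edge writes at most one letter: with a nonzero rotation number it leads to a bivalent
    vertex, hence not to a crossing. *)
Definition single (y : datum) : bool :=
  bounded y && ((y.1 == 0) || (y.2 == Biv tt)).

Lemma data_word_cons y w : data_word (y :: w) = datum_word y ++ data_word w.
Proof. by []. Qed.

(** An edge that carries a rotation and leads to a crossing or a final vertex is cut into one that
    carries the rotation and one of rotation number 0. The rotation comes first because its letter
    precedes that of the crossing. *)
Lemma refine_single j w : all bounded w -> ends_at j w ->
  exists v, [/\ refine w v, all single v, data_word v = data_word w & ends_at j v].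
Proof.
elim: w => [//|y w ih] /= /andP[hy hw] he.
have [v [r hv e1 e2]] : exists v, [/\ refine w v, all single v, data_word v = data_word w &
    if y.2 is Endp j' then (j' == j) && nilp v else ends_at j v].
  case: y.2 he => [j' /andP[-> /nilP->]|p /(ih hw)//].
  by exists [::]; split=> //; apply: refine_refl.
case hn : ((y.1 == 0) || (y.2 == Biv tt)).
  exists (y :: v); split; first exact: refine_cons.
  - by rewrite /= /single hy hn hv.
  - by rewrite !data_word_cons e1.
  - by move: e2; rewrite /=; case: y.2.
exists ((y.1, Biv tt) :: (0, y.2) :: v); split.
- apply: refine_trans (refine_cons _ r) _; rewrite [y in y :: v]surjective_pairing.
  by apply: refine_split; rewrite ?addr0.
- by have hy1 : `|y.1| <= 1 := hy; rewrite /= /single /bounded /= ?eqxx ?orbT hy1 ?normr0 hv.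
- rewrite !data_word_cons e1 catA; congr (_ ++ _); rewrite /datum_word /=.
  by rewrite cats0.
- by move: e2; rewrite /=; case: y.2.
Qed.

Lemma pass_inj c c' b b' :
  (if b == s c then Over c else Under c) = (if b' == s c' then Over c' else Under c') ->
  c = c' /\ b = b'.
Proof.
case: eqP => h; case: eqP => h' // [e]; subst c'; split=> //; first by rewrite h h'.
by case: b b' (s c) h h' => [] [] [].
Qed.

(** The letter determines the edge: a rotation letter forces a bivalent target, and a crossing
    letter forces rotation number 0 and names the slot. *)
Lemma single_word_inj y y' : single y -> single y' -> y != (0, Biv tt) -> y' != (0, Biv tt) ->
  (if y.2 is Endp _ then false else true) -> (if y'.2 is Endp _ then false else true) ->
  exists l l', [/\ datum_word y = [:: l], datum_word y' = [:: l'] & l = l' -> y = y'].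
Proof.
have rotP (r : int) : `|r| <= 1 -> r != 0 -> r = 1 \/ r = -1 by lia.
case: y y' => [r x] [r' x']; rewrite /single /bounded /datum_word /=.
move=> /andP[hr hx] /andP[hr' hx'].
case: x hx => [//|[[]|[c b]]] hx ne; case: x' hx' => [//|[[]|[c' b']]] hx' ne' _ _.
- have [|->|->] := rotP r hr; first by apply: contra ne => /eqP->.
    have [|->|->] := rotP r' hr'; first by apply: contra ne' => /eqP->.
      by exists Rplus, Rplus.
    by exists Rplus, Rminus.
  have [|->|->] := rotP r' hr'; first by apply: contra ne' => /eqP->.
    by exists Rminus, Rplus.
  by exists Rminus, Rminus.
- move: hx'; rewrite orbF => /eqP->.
  have [|->|->] := rotP r hr; first by apply: contra ne => /eqP->.
    by eexists _, _; split=> //=; case: ifP.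
  by eexists _, _; split=> //=; case: ifP.
- move: hx; rewrite orbF => /eqP->.
  have [|->|->] := rotP r' hr'; first by apply: contra ne' => /eqP->.
    by eexists _, _; split=> //=; case: ifP.
  by eexists _, _; split=> //=; case: ifP.
- move: hx hx'; rewrite !orbF => /eqP-> /eqP->.
  by eexists _, _; split=> //= /pass_inj[-> ->].
Qed.

(* Both sides are brought to a common refinement by inserting trivial edges;
   no edge is ever removed. *)
Lemma refine_confluent j w w' : all single w -> all single w' -> ends_at j w -> ends_at j w' ->
  data_word w = data_word w' -> exists v, refine w v /\ refine w' v.
Proof.
have [N] := ubnP (size w + size w')%N; elim: N w w' => // N ih [//|y w] [//|y' w'].
have pad z t : single z -> refine (z :: t) ((0, Biv tt) :: z :: t).
  move=> /andP[hz _]; case: z hz => r x hz.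
  by apply: refine_split; rewrite ?add0r.
rewrite ltnS => sz hyw hyw'; have /andP[hy hw] := hyw; have /andP[hy' hw'] := hyw'.
move=> he he' ew; have sz1 : (size w + size (y' :: w') < N)%N by exact: sz.
have sz2 : (size (y :: w) + size w' < N)%N by move: sz; rewrite /= addnS.
have sz3 : (size w + size w' < N)%N by move: sz; rewrite /=; lia.
case: (eqVneq y (0, Biv tt)) => [ey|ny].
  subst y; have [v [r1 r2]] := ih w (y' :: w') sz1 hw hyw' he he' ew.
  exists ((0, Biv tt) :: v); split; first exact: refine_cons.
  by apply: refine_trans (pad _ _ hy') _; apply: refine_cons.
case: (eqVneq y' (0, Biv tt)) => [ey|ny'].
  subst y'; have [v [r1 r2]] := ih (y :: w) w' sz2 hyw hw' he he' ew.
  exists ((0, Biv tt) :: v); split; last exact: refine_cons.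
  by apply: refine_trans (pad _ _ hy) _; apply: refine_cons.
(* Neither head is trivial any more. A final edge writes no letter while every other head writes
   one, so final edges face each other; two heads that are not final are equal because their letters
   are. *)
case E : (if y.2 is Endp _ then false else true); last first.
  have y0 : y.1 = 0.
    by move: hy; rewrite /single; case: y.2 E => // j' _ /andP[_]; rewrite orbF => /eqP.
  have Wy : datum_word y = [::] by rewrite /datum_word y0 /=; case: y.2 E.
  have wn : w = [::] by move: he; rewrite /=; case: y.2 E => // j' _ /andP[_ /nilP].
  have ey : y.2 = Endp j by move: he; rewrite /=; case: y.2 E => // j' _ /andP[/eqP->].
  case E' : (if y'.2 is Endp _ then false else true).
    have [l [l' [_ h _]]] := @single_word_inj y' y' hy' hy' ny' ny' E' E'.
    by move: ew; rewrite !data_word_cons wn Wy h.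
  have y0' : y'.1 = 0.
    by move: hy'; rewrite /single; case: y'.2 E' => // j' _ /andP[_]; rewrite orbF => /eqP.
  have wn' : w' = [::] by move: he'; rewrite /=; case: y'.2 E' => // j' _ /andP[_ /nilP].
  have ey' : y'.2 = Endp j by move: he'; rewrite /=; case: y'.2 E' => // j' _ /andP[/eqP->].
  have -> : y' = y by rewrite [y]surjective_pairing [y']surjective_pairing y0 y0' ey ey'.
  by rewrite wn wn'; exists [:: y]; split; apply: refine_refl.
case E' : (if y'.2 is Endp _ then false else true); last first.
  have y0' : y'.1 = 0.
    by move: hy'; rewrite /single; case: y'.2 E' => // j' _ /andP[_]; rewrite orbF => /eqP.
  have Wy' : datum_word y' = [::] by rewrite /datum_word y0' /=; case: y'.2 E'.
  have wn' : w' = [::] by move: he'; rewrite /=; case: y'.2 E' => // j' _ /andP[_ /nilP].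
  have [l [l' [_ h _]]] := @single_word_inj y y hy hy ny ny E E.
  by move: ew; rewrite !data_word_cons wn' Wy' h.
have [l [l' [h h' hl]]] := single_word_inj hy hy' ny ny' E E'.
move: ew; rewrite !data_word_cons h h' /= => -[/hl ey ew]; subst y'.
have {}he : ends_at j w by move: he; rewrite /=; case: y.2 E.
have {}he' : ends_at j w' by move: he'; rewrite /=; case: y.2 E'.
have [v [r1 r2]] := ih w w' sz3 hw hw' he he' ew.
by exists (y :: v); split; apply: refine_cons.
Qed.

Lemma data_word_confluent j w w' : all bounded w -> all bounded w' ->
  ends_at j w -> ends_at j w' -> data_word w = data_word w' ->
  exists v, refine w v /\ refine w' v.
Proof.
move=> b b' e e' ew; have [v [r hs hw he]] := refine_single b e.
have [v' [r' hs' hw' he']] := refine_single b' e'.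
have [|z [hz hz']] := refine_confluent hs hs' he he'; first by rewrite hw hw'.
by exists z; split; [apply: refine_trans r hz|apply: refine_trans r' hz'].
Qed.

End Refinement.

Section SpellsData.
Variables (I O : finType) (G : xgraph I O) (C : eqType) (s : C -> bool) (f : xcross G -> C).
Hypothesis fs : forall c, s (f c) = xsign c.

Lemma edge_data_word e : datum_word s (edge_data f e) = map (map_letter f) (edge_word e).
Proof.
rewrite /datum_word /edge_word map_cat /=; congr (_ ++ _); first by do 2?case: ifP.
by case: (xtgt e) => [j|[b|[c b]]] //=; rewrite fs; case: ifP.
Qed.

Lemma strand_data_word t :
  data_word s (map (edge_data f) t) = map (map_letter f) (strand_word t).
Proof.
rewrite /data_word -map_comp map_flatten_map; congr flatten; apply: eq_map => e.
exact: edge_data_word.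
Qed.

Lemma strand_ends_at i t j : @is_strand I O G i t j -> ends_at j (map (edge_data f) t).
Proof.
case: t => // e t [_ p l]; elim: t e p l => [|x t ih] e /=.
  by move=> _ ->; rewrite /= eqxx.
move=> /andP[/xstepP h p] l; move: (ih x p l) => /= ->.
by rewrite /edge_data /=; case: (xtgt e) h => [?|[?|[? ?]]].
Qed.

End SpellsData.

Lemma xiso_refl (I O : finType) (G : xgraph I O) : xiso G G.
Proof.
exists id, id, id; split=> //; first by split; exists id.
- by move=> e; case: (xsrc e) => [?|[?|[? ?]]].
- by move=> e; case: (xtgt e) => [?|[?|[? ?]]].
Qed.

Lemma xiso_equiv m n (T T' : tangle_diagram m n) : xiso T T' -> tangle_equiv T T'.
Proof. by move=> h; apply: rst_step; apply: move_iso. Qed.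

Lemma map_cat_inv (A B : Type) (g : A -> B) w u y t :
  map g w = u ++ y :: t ->
  exists w1 x w2, [/\ w = w1 ++ x :: w2, map g w1 = u, g x = y & map g w2 = t].
Proof.
elim: u w => [|z u ih] [|x w] //= [].
  by move=> <- <-; exists [::], x, w.
by move=> <- /ih[w1 [x' [w2 [-> <- <- <-]]]]; exists (x :: w1), x', w2.
Qed.

(** * Diagrams with equal words are equivalent *)

Section SameWords.
Variables (m n : nat) (C : eqType) (s : C -> bool).
Notation data := ('I_m -> seq (int * port 'I_n unit C)).
Implicit Types (T : tangle_diagram m n) (E V : data).

(** The edge standing at the chosen place is subdivided. As an edge occurs only once on the strands,
    all other places are left alone. *)
Lemma split_data T E i u c x t a b :
  spells_data T s E -> E i = u ++ (c, x) :: t -> a + b = c -> `|a| <= 1 -> `|b| <= 1 ->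
  exists T1 : tangle_diagram m n, tangle_equiv T T1 /\
    spells_data T1 s (fun i' => if i' == i then u ++ (a, Biv tt) :: (b, x) :: t else E i').
Proof.
move=> [f [fb fs h]] hi eab ha hb; have TP := tgraphP T.
have hE i' : E i' = map (edge_data f) (strand TP i').
  by have [t' [j [ht ->]]] := h i'; have [<- _] := strand_eq TP ht.
have [t1 [e0 [t2 [et e1 e2 e3]]]] := map_cat_inv (etrans (esym (hE i)) hi).
pose T1 := TangleDiagram (split_diagram e0 TP ha hb); exists T1; split.
  apply: rst_sym; apply: rst_step; apply: (@move_Om0r _ _ T1 T e0 a b).
    by rewrite eab; case: e2.
  exact: xiso_refl.
exists f; split=> // i'; exists (flatten (map (split_edge e0 a b) (strand TP i'))),
  (strand_end TP i').
split; first exact: split_strand (strandP TP i').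
case: eqP => [->|ne].
  rewrite et split_data_at; last first.
    by rewrite -et; apply: (strand_nodup (diag_srcI TP) (strandP TP i)).
  by rewrite e1 e2 e3.
rewrite split_data_other; first exact: hE.
apply/negP => he; apply: ne; apply: (once_mem_uniq (strand_once TP e0) he).
by rewrite et mem_cat inE eqxx orbT.
Qed.

Lemma refine_data_at T E i v : spells_data T s E -> refine (E i) v ->
  exists T1 : tangle_diagram m n, tangle_equiv T T1 /\
    spells_data T1 s (fun i' => if i' == i then v else E i').
Proof.
move=> hT hr; move ew : (E i) hr => w hr; elim: hr T E ew hT => {w v}.
  move=> w T E ew hT; exists T; split; first exact: rst_refl.
  by rewrite (_ : (fun _ => _) = E) //; apply/funext => i'; case: eqP => // ->.
move=> u c x t a b w eab ha hb _ ih T E ew hT.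
have [T1 [h1 hT1]] := split_data hT ew eab ha hb.
have [|T2 [h2 hT2]] := ih T1 _ _ hT1; first by rewrite eqxx.
exists T2; split; first exact: rst_trans h1 h2.
rewrite (_ : (fun _ => _) =
  (fun i' => if i' == i then w else if i' == i then u ++ (a, Biv tt) :: (b, x) :: t else E i')) //.
by apply/funext => i'; case: eqP.
Qed.

Lemma refine_data T E V : spells_data T s E -> (forall i, refine (E i) (V i)) ->
  exists T1 : tangle_diagram m n, tangle_equiv T T1 /\ spells_data T1 s V.
Proof.
move=> hT hr.
(* The strands are refined one at a time, along an enumeration of their indices. *)
suff [T1 [h1 hT1]] : exists T1 : tangle_diagram m n, tangle_equiv T T1 /\
    spells_data T1 s (fun i => if i \in enum 'I_m then V i else E i).
  exists T1; split=> //.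
  by rewrite (_ : V = (fun i => if i \in enum 'I_m then V i else E i)) //;
    apply/funext => i; rewrite mem_enum.
elim: (enum 'I_m) => [|i l [T1 [h1 hT1]]].
  by exists T; split=> //; apply: rst_refl.
have [|T2 [h2 hT2]] := @refine_data_at T1 _ i (V i) hT1.
  by case: ifP => // _; apply: refine_refl.
exists T2; split; first exact: rst_trans h1 h2.
rewrite (_ : (fun i => _) =
  (fun i' => if i' == i then V i else if i' \in l then V i' else E i')) //.
by apply/funext => i'; rewrite inE; case: eqP => // ->.
Qed.

(** Injectivity of [last] makes the strands of T and T' with the same start end at the same vertex.
    Their data then have a common refinement, and the two refined diagrams are isomorphic since they
    have the same data. *)
Lemma spells_equiv T T' (last : 'I_n -> 'I_m) (W : 'I_m -> seq (letter C)) :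
  injective last -> spells T s last W -> spells T' s last W -> tangle_equiv T T'.
Proof.
move=> lI [f [fb fs h]] [f' [fb' fs' h']].
have TP := tgraphP T; have TP' := tgraphP T'.
pose E i := map (edge_data f) (strand TP i); pose E' i := map (edge_data f') (strand TP' i).
have hE : spells_data T s E.
  by exists f; split=> // i; exists (strand TP i), (strand_end TP i); split=> //; apply: strandP.
have hE' : spells_data T' s E'.
  by exists f'; split=> // i; exists (strand TP' i), (strand_end TP' i); split=> //; apply: strandP.
have hV i : exists v, refine (E i) v /\ refine (E' i) v.
  have [t [j [ht hl hw]]] := h i; have [et ej] := strand_eq TP ht.
  have [t' [j' [ht' hl' hw']]] := h' i; have [et' ej'] := strand_eq TP' ht'.
  have ejj : j' = j by apply: lI; rewrite hl hl'.
  apply: (@data_word_confluent _ _ s j).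
  - by apply/allP => _ /mapP[e _ ->]; apply: (diag_rot TP).
  - by apply/allP => _ /mapP[e _ ->]; apply: (diag_rot TP').
  - by rewrite /E -et; apply: strand_ends_at ht.
  - by rewrite /E' -et'; apply: strand_ends_at; rewrite -ejj; apply: ht'.
  - by rewrite /E /E' -et -et' (strand_data_word fs) (strand_data_word fs') -hw -hw'.
have [V hVV] := boolp.choice hV.
have [T1 [h1 hT1]] := refine_data hE (fun i => (hVV i).1).
have [T2 [h2 hT2]] := refine_data hE' (fun i => (hVV i).2).
apply: rst_trans h1 (rst_trans _ _ _ _ _ _ (rst_sym _ _ _ _ h2)).
exact/xiso_equiv/(spells_data_iso (tgraphP T1) (tgraphP T2) hT1 hT2).
Qed.

End SameWords.

(** * Filling holes *)

Section EdgeWords.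
Variables (I O : finType) (G : xgraph I O).

Definition rot_word (C : Type) (r : int) : seq (letter C) :=
  if r == 1 then [:: Rplus] else if r == -1 then [:: Rminus] else [::].

Definition pass_word (e : xedge G) : seq (letter (xcross G)) :=
  if xtgt e is Crs c s then [:: if s == xsign c then Over c else Under c] else [::].

Lemma edge_wordE e : edge_word e = rot_word _ (xrot e) ++ pass_word e.
Proof. by []. Qed.

Lemma map_rot_word (C C' : Type) (f : C -> C') r :
  map (map_letter f) (rot_word C r) = rot_word C' r.
Proof. by rewrite /rot_word; do 2?case: ifP. Qed.

Lemma strand_word_flatten (A : Type) (g : A -> seq (xedge G)) s :
  strand_word (flatten (map g s)) = flatten (map (fun x => strand_word (g x)) s).
Proof. by rewrite /strand_word flatten_flatten_map. Qed.

End EdgeWords.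

Section Plugging.
Variables (m n k : nat) (K : xgraph ('I_m + 'I_k)%type ('I_n + 'I_k)%type)
  (L : xgraph 'I_k 'I_k).
Local Notation P := (xplug K L).

(* Edges of K that follow each other when a hole is jumped over. *)
Definition hole_after (B C : Type) (q : port ('I_n + 'I_k) B C) :
    option (port ('I_m + 'I_k) B C) :=
  match q with
  | Endp (inl _) => None
  | Endp (inr j) => Some (Endp (inr j))
  | Biv b => Some (Biv b)
  | Crs c s => Some (Crs c (~~ s))
  end.

Definition kstep (e e' : xedge K) : bool := hole_after (xtgt e) == Some (xsrc e').

(** The part in K of a strand of the filled graph. Jumping from the entry of hole j to its exit
    reflects the assumption [lsP] that the j-th strand of the filling runs from j to j. *)
Definition is_kstrand (i : 'I_m) (s : seq (xedge K)) (j : 'I_n) : Prop :=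
  if s is e :: s' then
    [/\ xsrc e = Endp (inl i), path kstep e s' & xtgt (last e s') = Endp (inl j)]
  else False.

Variable ls : 'I_k -> seq (xedge L).
Hypothesis lsP : forall j, @is_strand _ _ L j (ls j) j.

Definition plug_tail (e : xedge K) : seq (xedge P) :=
  if xtgt e is Endp (inr j) then map inr (ls j) else [::].
Definition plug_edge (e : xedge K) : seq (xedge P) := inl e :: plug_tail e.

Lemma plug_step_r f f' : xstep f f' -> @xstep _ _ P (inr f) (inr f').
Proof.
move=> /xstepP h; apply/xstepP; move: h => /=.
by case: (xtgt f) => [i|[b|[c s]]] //= [<-].
Qed.

Lemma plug_step_enter e j f : xtgt e = Endp (inr j) -> xsrc f = Endp j ->
  @xstep _ _ P (inl e) (inr f).
Proof. by move=> he hf; apply/xstepP; rewrite /= he hf. Qed.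

Lemma plug_tail_path e : path (@xstep _ _ P) (inl e) (plug_tail e).
Proof.
rewrite /plug_tail; case he : (xtgt e) => [[j|j]|[b|[c s]]] //=.
have := lsP j; case: (ls j) => //= f t [hf p _]; rewrite (plug_step_enter he hf) /=.
by rewrite path_map; apply: sub_path p => ? ?; apply: plug_step_r.
Qed.

Lemma plug_tail_last e e' : kstep e e' -> @xstep _ _ P (last (inl e) (plug_tail e)) (inl e').
Proof.
move=> /eqP h; apply/xstepP; move: h; rewrite /plug_tail.
case he : (xtgt e) => [[j|j]|[b|[c s]]] //=.
- have := lsP j; case: (ls j) => //= f t [_ _ hl] [<-] /=.
  by rewrite last_map /= hl.
- by case=> <-; rewrite he.
- by case=> <-; rewrite he.
Qed.

Lemma plug_strand i s j : is_kstrand i s j ->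
  @is_strand _ _ P i (flatten (map plug_edge s)) j.
Proof.
case: s => //= e s [he p t].
have [p' l'] := path_expand plug_tail_path plug_tail_last p.
split=> //; first by rewrite he.
by move: l' => /= ->; rewrite /plug_tail t /= t.
Qed.

Lemma plug_tgt_r f i : @xtgt _ _ P (inr f) = Endp i -> False.
Proof. by rewrite /=; case: (xtgt f) => [?|[?|[? ?]]]. Qed.

(** K itself is arbitrary, so its strands are extracted from those of the filled diagram by leaving
    out the edges of L. A path entering hole j has to follow [ls j] by determinism. The induction
    bounds the length, because the passage through a hole is removed in one piece. *)
Lemma kstrand_ex i : is_diagram P -> exists s j, is_kstrand i s j.
Proof.
move=> PP; have srcI := diag_srcI PP.
suff H N e s j : (size s < N)%N -> path (@xstep _ _ P) (inl e) s ->
    xtgt (last (inl e : xedge P) s) = Endp j ->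
    exists s', path kstep e s' /\ xtgt (last e s') = Endp (inl j).
  have [s [j]] := strand_from PP i; case: s => [//|[e|f] s] [he p t]; last first.
    by move: he => /=; case: (xsrc f) => [?|[?|[? ?]]].
  have [s' [p' t']] := H _ e s j (ltnSn _) p t.
  exists (e :: s'), j; split=> //.
  by move: he => /=; case: (xsrc e) => [[i'|i']|[?|[? ?]]] //= [->].
elim: N e s j => // N ih e [|[e'|f] s] j /=.
- move=> _ _ t; exists [::]; split=> //=.
  by move: t; case: (xtgt e) => [[j'|j']|[?|[? ?]]] //= [->].
- rewrite ltnS => sz /andP[h p] t; have [s' [p' t']] := ih e' s j sz p t.
  exists (e' :: s'); split=> //=; rewrite p' andbT; apply/eqP.
  move/xstepP: h => /=; case: (xtgt e) => [[j'|j']|[?|[? ?]]] //=.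
  + by case: (xsrc e') => [[?|?]|[?|[? ?]]].
  + by case: (xsrc e') => [[?|?]|[?|[? ?]]] //= [->].
  + by case: (xsrc e') => [[?|?]|[?|[? ?]]] //= [-> ->].
rewrite ltnS => sz /andP[h p] t.
have [j' [he hf]] : exists j', xtgt e = Endp (inr j') /\ xsrc f = Endp j'.
  move/xstepP: h => /=; case: (xtgt e) => [[j'|j']|[?|[? ?]]] //=;
    case: (xsrc f) => [?|[?|[? ?]]] //= [e1].
  by exists j'; rewrite e1.
have := lsP j'; case: (ls j') => //= g u [hg pg tg].
have fg : f = g.
  have : inr f = inr g :> xedge P by apply: srcI; rewrite /= hf hg.
  by case.
subst g.
have pu : path (@xstep _ _ P) (inr f) (map inr u).
  by rewrite path_map; apply: sub_path pg => ? ?; apply: plug_step_r.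
have {}t : @xtgt _ _ P (last (inr f : xedge P) s) = Endp j := t.
(* The rest of the path begins with the strand of L; it cannot stop there, as its last edge leads to
   an outer final vertex, so it goes on with the edge of K leaving the hole. *)
have [w ew] := path_prefix srcI pu p (Endp_terminal t).
move: t p sz; rewrite ew last_cat cat_path last_map => t /andP[_ p] sz.
case: w t p sz {ew} => [/plug_tgt_r//|[e'|f'] w] t /andP[hs p] sz; last first.
  move/xstepP: hs; rewrite /= tg /=.
  by case: (xsrc f') => [?|[?|[? ?]]].
have hs' : xsrc e' = Endp (inr j').
  move/xstepP: hs; rewrite /= tg /=.
  by case: (xsrc e') => [[?|?]|[?|[? ?]]] //= [->].
have [|s' [p' t']] := ih e' w j _ p t.
  by apply: leq_ltn_trans sz; rewrite size_cat /= addnS ltnW // ltnS leq_addl.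
exists (e' :: s'); split=> //=; rewrite p' andbT /kstep he hs' /=.
exact: eqxx.
Qed.

Definition hole_word (e : xedge K) : seq (letter (xcross K) + 'I_k) :=
  map inl (edge_word e) ++ if xtgt e is Endp (inr j) then [:: inr j] else [::].

(** The letters written by an edge are an arbitrary g, so that the computation also covers a filled
    graph in which an edge of the filling has been subdivided. *)
Lemma plug_fill (p : pattern k) (g : xedge P -> seq (letter (xcross K + plabel p))) :
  (forall e, g (inl e) = map (map_letter inl) (edge_word e)) ->
  (forall j, flatten (map g (map inr (ls j))) = map (map_letter inr) (tnth (pword p) j)) ->
  forall s, flatten (map g (flatten (map plug_edge s)))
    = fill_word p (flatten (map hole_word s)).
Proof.
move=> gl gr s; rewrite fill_wordE !flatten_flatten_map; congr flatten.
apply: eq_map => e; rewrite /hole_word map_cat flatten_cat -map_comp flatten_map_seq1.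
rewrite /plug_edge /= gl; congr (_ ++ _); rewrite /plug_tail.
by case: (xtgt e) => [[j|j]|[b|c]] //=; rewrite gr cats0.
Qed.

Lemma plug_edge_word_l e :
  @edge_word _ _ P (inl e) = map (map_letter inl) (edge_word e).
Proof.
rewrite !edge_wordE map_cat map_rot_word; congr (_ ++ _); rewrite /pass_word /=.
by case: (xtgt e) => [[j|j]|[b|[c s]]] //=; case: ifP.
Qed.

Lemma plug_edge_word_r f :
  @edge_word _ _ P (inr f) = map (map_letter inr) (edge_word f).
Proof.
rewrite !edge_wordE map_cat map_rot_word; congr (_ ++ _); rewrite /pass_word /=.
by case: (xtgt f) => [j|[b|[c s]]] //=; case: ifP.
Qed.

Lemma plug_strand_word (p : pattern k) (f : plabel p -> xcross L) s :
  (forall j, strand_word (ls j) = map (map_letter f) (tnth (pword p) j)) -> bijective f ->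
  @strand_word _ _ P (flatten (map plug_edge s)) =
    map (map_letter (fun x => match x with inl c => inl c | inr l => inr (f l) end))
      (fill_word p (flatten (map hole_word s))).
Proof.
move=> hf [f' fK Kf].
pose h (x : xcross K + xcross L) : xcross K + plabel p :=
  match x with inl c => inl c | inr l => inr (f' l) end.
rewrite -(@plug_fill p (fun x : xedge P => map (map_letter h) (@edge_word _ _ P x))).
- rewrite map_flatten_map; congr flatten; apply: eq_map => x.
  by rewrite /= map_map_letter map_map_letter_id // => -[c|l] //=; rewrite Kf.
- by move=> e; rewrite plug_edge_word_l map_map_letter; apply: eq_map_map_letter.
- move=> j; have -> : flatten [seq map (map_letter h) (@edge_word _ _ P x) | x <- map inr (ls j)]
      = map (map_letter (inr \o f')) (strand_word (ls j)).
    rewrite /strand_word map_flatten_map -map_comp; congr flatten; apply: eq_map => x.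
    by rewrite /= plug_edge_word_r map_map_letter.
  by rewrite hf map_map_letter; apply: eq_map_map_letter => c /=; rewrite fK.
Qed.

Variables (ks : 'I_m -> seq (xedge K)) (ke : 'I_m -> 'I_n).
Hypothesis ksP : forall i, is_kstrand i (ks i) (ke i).

(** An edge of the filling lies on some [ls j], and the edge of K entering hole j lies on a strand
    of K; the filled strand contains both. *)
Lemma plug_diagram : is_diagram L -> (forall e : xedge K, `|xrot e| <= 1) ->
  bijective (@xsrc _ _ K) -> bijective (@xtgt _ _ K) -> (forall e, exists i, e \in ks i) ->
  is_diagram P.
Proof.
move=> LP rK [gK gKK KgK] [hK hKK KhK] cov.
have [gL gLK KgL] := diag_src LP; have [hL hLK KhL] := diag_tgt LP; split.
- by case=> e /=; [apply: rK|apply: (diag_rot LP)].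
- exists (fun q : port 'I_m ((xbiv K + xbiv L) + ('I_k + 'I_k)) (xcross K + xcross L) =>
    match q with
    | Endp i => inl (gK (Endp (inl i)))
    | Biv (inr (inl j)) => inr (gL (Endp j))
    | Biv (inr (inr j)) => inl (gK (Endp (inr j)))
    | Biv (inl (inl b)) => inl (gK (Biv b)) | Biv (inl (inr b)) => inr (gL (Biv b))
    | Crs (inl c) s => inl (gK (Crs c s)) | Crs (inr c) s => inr (gL (Crs c s)) end).
    case=> e /=; first by case E : (xsrc e) => [[j|j]|[b|[c s]]] /=; rewrite -E gKK.
    by case E : (xsrc e) => [j|[b|[c s]]] /=; rewrite -E gLK.
  by case=> [i|[[[b|b]|[j|j]]|[[c|c] s]]] /=; rewrite ?KgK ?KgL.
- exists (fun q : port 'I_n ((xbiv K + xbiv L) + ('I_k + 'I_k)) (xcross K + xcross L) =>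
    match q with
    | Endp i => inl (hK (Endp (inl i)))
    | Biv (inr (inl j)) => inl (hK (Endp (inr j)))
    | Biv (inr (inr j)) => inr (hL (Endp j))
    | Biv (inl (inl b)) => inl (hK (Biv b)) | Biv (inl (inr b)) => inr (hL (Biv b))
    | Crs (inl c) s => inl (hK (Crs c s)) | Crs (inr c) s => inr (hL (Crs c s)) end).
    case=> e /=; first by case E : (xtgt e) => [[j|j]|[b|[c s]]] /=; rewrite -E hKK.
    by case E : (xtgt e) => [j|[b|[c s]]] /=; rewrite -E hLK.
  by case=> [i|[[[b|b]|[j|j]]|[[c|c] s]]] /=; rewrite ?KhK ?KhL.
- case=> [e|f].
    have [i hi] := cov e; exists i, (flatten (map plug_edge (ks i))), (ke i).
    split; first exact: plug_strand.
    by apply/flattenP; exists (plug_edge e); [apply: map_f|rewrite inE eqxx].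
  have [j [s [j' [hs fs]]]] := diag_strand LP f.
  have [es _] := strand_uniq (diag_srcI LP) hs (lsP j); subst s.
  have [i hi] := cov (hK (Endp (inr j))).
  exists i, (flatten (map plug_edge (ks i))), (ke i); split; first exact: plug_strand.
  apply/flattenP; exists (plug_edge (hK (Endp (inr j)))); first exact: map_f.
  by rewrite inE /plug_tail KhK map_f ?orbT.
Qed.

Hypothesis PP : is_diagram P.

Lemma kstrand_once e : once ks e.
Proof.
apply: eq_once (strand_once PP (inl e)) => i.
have [<- _] := strand_eq PP (plug_strand (ksP i)).
rewrite count_flatten_map -sum_count_eq; apply: eq_bigr => e' _.
rewrite /plug_edge /= [X in (_ + X)%N](_ : _ = 0%N) ?addn0; first by [].
rewrite /plug_tail; case: (xtgt e') => [[j|j]|[b|c]] //.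
by rewrite count_map; elim: (ls j).
Qed.

(** The symbol of hole j is written by the only edge of K entering it, and this edge occurs once on
    the strands of K. *)
Lemma kstrand_holes_once : holes_once (fun i => flatten (map hole_word (ks i))).
Proof.
apply/holes_onceP => j; have [g gK Kg] := diag_tgt PP.
have [e he] : exists e : xedge K, xtgt e = Endp (inr j).
  case E : (g (Biv (inr (inl j)))) => [e|f]; have := Kg (Biv (inr (inl j))); rewrite E /=.
    by case E' : (xtgt e) => [[?|?]|[?|[? ?]]] //= [<-]; exists e.
  by case: (xtgt f) => [?|[?|[? ?]]].
apply: eq_once (kstrand_once e) => i.
rewrite count_flatten_map -sum_count_eq; apply: eq_bigr => e' _.
rewrite /hole_word count_cat count_inr_inl add0n.
case: (eqVneq e' e) => [->|ne]; first by rewrite he /= eqxx.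
case E : (xtgt e') => [[j'|j']|[b|c]] //=; rewrite addn0; case: eqP => // -[ej].
case/negP: ne; apply/eqP; have : inl e' = inl e :> xedge P.
  by apply: (diag_tgtI PP); rewrite /= E he ej.
by case.
Qed.

End Plugging.

(** * From equivalences of tangles to equivalences of Gauss diagrams *)

Section TangleToGauss.
Variable R : realType.

Lemma spells_strand (m n : nat) (G : xgraph 'I_m 'I_n) (GP : is_diagram G)
    (D : gauss_diagram R m n) :
  spells G (@gsign _ _ _ D) (glast D) (gauss_word D) ->
  exists f : xcross G -> gchord D, [/\ bijective f, (forall c, gsign (f c) = xsign c) &
    forall i t j, @is_strand _ _ G i t j ->
      glast D j = i /\ gauss_word D i = map (map_letter f) (strand_word t)].
Proof.
move=> [f [fb fs h]]; exists f; split=> // i t j ht; have [t' [j' [ht' hl hw]]] := h i.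
by have [-> ->] := strand_uniq (diag_srcI GP) ht ht'.
Qed.

Lemma glast_eq (m n : nat) (D D' : gauss_diagram R m n) (e : 'I_m -> 'I_n) :
  (forall i, glast D (e i) = i) -> (forall i, glast D' (e i) = i) -> glast D =1 glast D'.
Proof.
move=> h h' j; have ej : e (glast D j) = j by apply: (bij_inj (glast_bij D)); rewrite h.
by rewrite -{2}ej h'.
Qed.

Lemma spells_giso (m n : nat) (G : xgraph 'I_m 'I_n) (D D' : gauss_diagram R m n) :
  is_diagram G ->
  spells G (@gsign _ _ _ D) (glast D) (gauss_word D) ->
  spells G (@gsign _ _ _ D') (glast D') (gauss_word D') -> giso D D'.
Proof.
move=> GP /(spells_strand GP)[f [fb fs h]] /(spells_strand GP)[f' [fb' fs' h']].
have [g [gb fK gK]] := bij_inv fb.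
exists (f' \o g); split; first exact: bij_comp.
- by move=> c; rewrite /= fs' -fs gK.
- move=> j j' /val_inj <-; congr nat_of_ord; move: j.
  apply: (@glast_eq _ _ _ _ (strand_end GP)) => i.
    by have [] := h _ _ _ (strandP GP i).
  by have [] := h' _ _ _ (strandP GP i).
- move=> i i' /val_inj <-; have [_ ->] := h _ _ _ (strandP GP i).
  have [_ ->] := h' _ _ _ (strandP GP i); rewrite map_map_letter.
  by apply: eq_map_map_letter => c /=; rewrite fK.
Qed.

Section Plug.
Variables (m n k : nat) (K : xgraph ('I_m + 'I_k)%type ('I_n + 'I_k)%type)
  (L : xgraph 'I_k 'I_k) (p : pattern k) (ls : 'I_k -> seq (xedge L))
  (f : plabel p -> xcross L) (ks : 'I_m -> seq (xedge K)) (ke : 'I_m -> 'I_n).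
Hypotheses (lsP : forall j, @is_strand _ _ L j (ls j) j) (fb : bijective f)
  (fs : forall x, xsign (f x) = psign x)
  (lw : forall j, strand_word (ls j) = map (map_letter f) (tnth (pword p) j))
  (ksP : forall i, is_kstrand i (ks i) (ke i)).

Lemma plug_reads (D : gauss_diagram R m n) : is_diagram (xplug K L) ->
  spells (xplug K L) (@gsign _ _ _ D) (glast D) (gauss_word D) ->
  (forall i, glast D (ke i) = i) /\
  gauss_reads D (@xsign _ _ K) (fun i => flatten (map (@hole_word _ _ _ K) (ks i))) p.
Proof.
move=> PP /(spells_strand PP)[g [gb gs h]].
have hi i := h _ _ _ (plug_strand lsP (ksP i)).
split=> [i|]; first by have [] := hi i.
pose h0 (x : xcross K + plabel p) : xcross K + xcross L :=
  match x with inl c => inl c | inr l => inr (f l) end.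
exists (g \o h0); split.
- apply: bij_comp gb _; exact: sum_bij (Bijective (fun=> erefl) (fun=> erefl)) fb.
- by move=> [c|l]; rewrite /= gs //= fs.
- move=> i; have [_ ->] := hi i; rewrite (plug_strand_word _ lw fb) map_map_letter.
  exact: eq_map_map_letter.
Qed.

End Plug.

Section Split.
Variables (I O : finType) (G : xgraph I O) (e0 : xedge G) (a b : int).

Lemma split_edge_word e : @strand_word _ _ (xsplit e0 a b) (split_edge e0 a b e) =
  (if e == e0 then rot_word _ a ++ rot_word _ b else rot_word _ (xrot e)) ++ pass_word e.
Proof.
rewrite /strand_word /split_edge /split_tail; case: (eqVneq e e0) => [->|ne] /=.
  rewrite !edge_wordE /pass_word /= eqxx /= !cats0 -catA; congr (_ ++ (_ ++ _)).
  by case: (xtgt e0) => [?|[?|[? ?]]].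
rewrite !edge_wordE /pass_word /= (negbTE ne) cats0; congr (_ ++ _).
by case: (xtgt e) => [?|[?|[? ?]]].
Qed.

End Split.

(** Additivity fails only for opposite nonzero numbers: subdividing a trivial edge then creates a
    cancelling pair of diamonds, which is where the additional rules on Gauss diagrams come from. *)
Lemma rot_word_add (C : Type) (a b : int) : `|a| <= 1 -> `|b| <= 1 -> `|a + b| <= 1 ->
  rot_word C a ++ rot_word C b = rot_word C (a + b) \/
  a + b = 0 /\ (rot_word C a ++ rot_word C b = [:: Rplus; Rminus] \/
                rot_word C a ++ rot_word C b = [:: Rminus; Rplus]).
Proof.
move=> ha hb; have [->|[->|->]] : a = 0 \/ a = 1 \/ a = -1 by lia.
- by move=> _; left; rewrite add0r.
- move=> hab; have [->|->] : b = 0 \/ b = -1 by lia.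
    by left; rewrite addr0 cats0.
  by right; split; [lia|left].
- move=> hab; have [->|->] : b = 0 \/ b = 1 by lia.
    by left; rewrite addr0 cats0.
  by right; split; [lia|right].
Qed.

Section SplitReads.
Variables (m n : nat) (T' : tangle_diagram m n) (e0 : xedge T').
Hypothesis TP' : is_diagram T'.

(** A hole takes the place of the rotation letters of e0. Filled with the empty word it gives a
    trivial edge, filled with a cancelling pair its subdivision. *)
Definition cut_word (e : xedge T') : seq (letter (xcross T') + 'I_1) :=
  (if e == e0 then [:: inr ord0] else [::]) ++
  map inl (if e == e0 then pass_word e else edge_word e).

Lemma cut_word_holes : holes_once (fun i => flatten (map cut_word (strand TP' i))).
Proof.
apply/holes_onceP => j; apply: eq_once (strand_once TP' e0) => i.
rewrite count_flatten_map -sum_count_eq; apply: eq_bigr => e _.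
by rewrite /cut_word count_cat count_inr_inl addn0 [j]ord1; case: eqP.
Qed.

Lemma cut_word_fill (p : pattern 1) (u : seq (letter (plabel p)))
    (f : xcross T' + plabel p -> xcross T') (g : xedge T' -> seq (letter (xcross T'))) s :
  (forall c, f (inl c) = c) -> tnth (pword p) ord0 = u ->
  (forall e, g e =
    (if e == e0 then map (map_letter (f \o inr)) u ++ pass_word e else edge_word e)) ->
  flatten (map g s) = map (map_letter f) (fill_word p (flatten (map cut_word s))).
Proof.
move=> fl pu ge; rewrite fill_wordE flatten_flatten_map map_flatten_map.
congr flatten; apply: eq_map => e; rewrite /= ge /cut_word map_cat flatten_cat map_cat.
have hl w : map (map_letter f) (flatten (map (fill_item p) (map inl w))) = w :> seq (letter _).
  rewrite -map_comp flatten_map_seq1 -[RHS](map_map_letter_id w fl) -map_comp.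
  by apply: eq_map => l /=; rewrite map_letter_comp.
rewrite hl; case: eqP => // _; congr (_ ++ _).
by rewrite /= cats0 pu map_map_letter.
Qed.

End SplitReads.

Lemma tangle_move_gauss m n (T T' : tangle_diagram m n) (D D' : gauss_diagram R m n) :
  tangle_move T T' -> gauss_diagram_of T D -> gauss_diagram_of T' D' -> gauss_equiv D D'.
Proof.
have TP := tgraphP T; have TP' := tgraphP T'.
move=> mv /gauss_diagram_ofP hD /gauss_diagram_ofP hD'.
case: mv => [iso|e a b eab iso|k p q K L L' pq hL hL' iso iso'].
- exact/giso_equiv/(spells_giso TP' (xiso_spells iso hD) hD').
- have SP := xiso_diagram iso TP.
  have [f [fb fs hf]] := spells_strand SP (xiso_spells iso hD).
  have [f' [fb' fs' hf']] := spells_strand TP' hD'.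
  have ha : `|a| <= 1 by have := diag_rot SP (Some e); rewrite /= eqxx.
  have hb : `|b| <= 1 by have := diag_rot SP None.
  have hab : `|a + b| <= 1 by rewrite eab; apply: (diag_rot TP').
  have fi i := hf _ _ _ (split_strand e a b (strandP TP' i)).
  have fi' i := hf' _ _ _ (strandP TP' i).
  have wD i : gauss_word D i = map (map_letter f)
      (flatten (map (fun x => (if x == e then rot_word _ a ++ rot_word _ b
          else rot_word _ (xrot x)) ++ pass_word x) (strand TP' i))).
    have [_ ->] := fi i; rewrite strand_word_flatten; congr (map _ (flatten _)).
    by apply: eq_map => x; rewrite split_edge_word.
  have wD' i : gauss_word D' i =
      map (map_letter f') (flatten (map (@edge_word _ _ T') (strand TP' i))).
    by have [_ ->] := fi' i.
  have el : glast D =1 glast D'.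
    by apply: (@glast_eq _ _ _ _ (strand_end TP')) => i; [case: (fi i)|case: (fi' i)].
  (* Either the words are unchanged and the two Gauss diagrams are isomorphic, or the subdivision is
     a cancellation rule read from right to left. *)
  have [er|[ab0 hr]] := @rot_word_add (xcross T') a b ha hb hab.
    have [g [gb fK gK]] := bij_inv fb.
    apply: giso_equiv; exists (f' \o g); split; first exact: bij_comp.
    + by move=> c; rewrite /= fs' -[in RHS](gK c) fs.
    + by move=> j j' /val_inj <-; rewrite el.
    + move=> i i' /val_inj <-; rewrite wD wD' map_map_letter.
      rewrite (@eq_map_map_letter _ _ ((f' \o g) \o f) f') => [|c /=]; last by rewrite fK.
      congr (map _ (flatten _)); apply: eq_map => x.
      by case: eqP => // ->; rewrite er eab.
  have e0 : xrot e = 0 by rewrite -eab.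
  pose j (x : xcross T' + void) : xcross T' := match x with inl c => c | inr v => of_void _ v end.
  have jb : bijective j by exists inl => // -[].
  have rD' : gauss_reads D' (@xsign _ _ T')
      (fun i => flatten (map (cut_word e) (strand TP' i))) cancel_none.
    exists (f' \o j); split; [exact: bij_comp|by case=> // c; rewrite /= fs'|] => i.
    rewrite wD' (@cut_word_fill _ _ _ e cancel_none [::] j (@edge_word _ _ T')) //.
      by rewrite map_map_letter.
    by move=> x; case: eqP => // ->; rewrite edge_wordE e0.
  case: hr => hr.
    apply: rst_step; apply: (gmove_rule rule_pm el (cut_word_holes e TP') _ rD').
    exists (f \o j); split; [exact: bij_comp|by case=> // c; rewrite /= fs|] => i.
    rewrite wD (@cut_word_fill _ _ _ e cancel_pm [:: Rplus; Rminus] j) //.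
      by rewrite map_map_letter.
    by move=> x; case: eqP => // ->; rewrite hr.
  apply: rst_step; apply: (gmove_rule rule_mp el (cut_word_holes e TP') _ rD').
  exists (f \o j); split; [exact: bij_comp|by case=> // c; rewrite /= fs|] => i.
  rewrite wD (@cut_word_fill _ _ _ e cancel_mp [:: Rminus; Rplus] j) //.
    by rewrite map_map_letter.
  by move=> x; case: eqP => // ->; rewrite hr.
have [f [fb fs hf]] := hL; have [f' [fb' fs' hf']] := hL'.
have [ls hls] := boolp.choice hf; have [ls' hls'] := boolp.choice hf'.
have lsP j := (hls j).1; have lsP' j := (hls' j).1.
have PP := xiso_diagram iso TP; have PP' := xiso_diagram iso' TP'.
(* The strands of K are found inside the filling by L, but they are strands of K alone and serve for
   the filling by L' too. *)
have /boolp.choice[ks /boolp.choice[ke ksP]] i := kstrand_ex lsP i PP.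
have [h r] := plug_reads lsP fb fs (fun j => (hls j).2) ksP PP (xiso_spells iso hD).
have [h' r'] := plug_reads lsP' fb' fs' (fun j => (hls' j).2) ksP PP' (xiso_spells iso' hD').
apply: rst_step; apply: (gmove_rule (rule_common pq) (glast_eq h h') _ r r').
exact: (kstrand_holes_once lsP ksP PP).
Qed.

Lemma tangle_equiv_gauss m n (T T' : tangle_diagram m n) (D D' : gauss_diagram R m n) :
  tangle_equiv T T' -> gauss_diagram_of T D -> gauss_diagram_of T' D' -> gauss_equiv D D'.
Proof.
move=> h; elim: h D D' => {T T'}
  [T T' mv D D'|T D D'|T T' _ ih D D' h h'|T1 T2 T3 _ ih1 _ ih2 D D' h h'].
- exact: tangle_move_gauss.
- move=> /gauss_diagram_ofP h /gauss_diagram_ofP h'.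
  exact: giso_equiv (spells_giso (tgraphP T) h h').
- exact: rst_sym (ih _ _ h' h).
- have [D2 h2] := tangle_gauss R T2.
  exact: rst_trans (ih1 _ _ h h2) (ih2 _ _ h2 h').
Qed.

End TangleToGauss.

(** * Tangle diagrams with prescribed words *)

Section CanonicalGraph.
Variables (m n k : nat) (ends : 'I_m -> 'I_n) (C : finType) (s : C -> bool)
  (W : 'I_m -> seq (letter C + 'I_k)).

Definition item_at (x : 'I_m * nat) : option (letter C + 'I_k) := onth (W x.1) x.2.

(** One edge for each item, and a last one leading to the final vertex: hence the successor of the
    length. *)
Definition canon_edges : seq ('I_m * nat) :=
  [seq (i, p) | i <- enum 'I_m, p <- iota 0 (size (W i)).+1].

Definition rot_at (x : 'I_m * nat) : int :=
  match item_at x with Some (inl Rplus) => 1 | Some (inl Rminus) => -1 | _ => 0 end.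

(** An edge carrying a rotation letter has no crossing or hole to lead to; it ends at a bivalent
    vertex named after the edge itself. *)
Definition canon_bivs : seq ('I_m * nat) := [seq x <- canon_edges | rot_at x != 0].

Lemma mem_canon_edges x : (x \in canon_edges) = (x.2 <= size (W x.1))%N.
Proof.
apply/allpairsPdep/idP => [[i [p [_ hp ->]]]|h]; first by rewrite mem_iota in hp.
by exists x.1, x.2; rewrite mem_enum mem_iota; split=> //; case: (x).
Qed.

(* The edge (i, p) leads to the p-th item of the i-th word. *)
Definition canon_port (x : 'I_m * nat) : port ('I_n + 'I_k) (seq_sub canon_bivs) C :=
  if insub x is Some b then Biv b else
  match item_at x with
  | Some (inl (Over c)) => Crs c (s c)
  | Some (inl (Under c)) => Crs c (~~ s c)
  | Some (inr j) => Endp (inr j)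
  | _ => Endp (inl (ends x.1))
  end.

(** Targets are chosen and sources follow: an edge starts where the straight path continues after
    its predecessor, a hole being jumped over. The default of [odflt] is never taken, since on
    existing edges the predecessor leads to an item and not to a final vertex. *)
Definition canon_graph : xgraph ('I_m + 'I_k)%type ('I_n + 'I_k)%type :=
  @XGraph _ _ (seq_sub canon_edges) (seq_sub canon_bivs) C s
    (fun e => rot_at (ssval e))
    (fun e => let: (i, p) := ssval e in
      if p is q.+1 then odflt (Endp (inl i)) (hole_after m (canon_port (i, q)))
      else Endp (inl i))
    (fun e => canon_port (ssval e)).

Hypotheses (W_hole : forall j, once W (inr j)) (W_over : forall c, once W (inl (Over c)))
  (W_under : forall c, once W (inl (Under c))) (ends_bij : bijective ends).

Lemma canon_portP (x : 'I_m * nat) : x \in canon_edges ->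
  match item_at x with
  | Some (inl (Over c)) => canon_port x = Crs c (s c)
  | Some (inl (Under c)) => canon_port x = Crs c (~~ s c)
  | Some (inr j) => canon_port x = Endp (inr j)
  | Some (inl _) => exists b, ssval b = x /\ canon_port x = Biv b
  | None => x.2 = size (W x.1) /\ canon_port x = Endp (inl (ends x.1))
  end.
Proof.
move=> hx; rewrite /canon_port; case: insubP => [b hb vb|].
  move: hb; rewrite mem_filter /rot_at => /andP[]; rewrite /item_at.
  by case: (onth _ _) => [[[c|c||]|j]|] //= _ _; exists b.
rewrite mem_filter hx andbT negbK /rot_at.
case E : (item_at x) => [[[c|c||]|j]|] //= _; split=> //.
apply/eqP; rewrite eqn_leq -mem_canon_edges hx /= -onthNE.
by move: E; rewrite /item_at => ->.
Qed.

(** Each slot is reached once: at crossings and holes because their symbols occur once, at bivalent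
    vertices because they are named by their edge, at final vertices because [ends] is bijective. *)
Lemma canon_port_unique q : exists x, [/\ x \in canon_edges, canon_port x = q &
  forall y, y \in canon_edges -> canon_port y = q -> y = x].
Proof.
have posE l : once W l -> exists x, [/\ x \in canon_edges, item_at x = Some l &
    forall y, item_at y = Some l -> y = x].
  move=> h; have [i [p hp]] := once_pos h; exists (i, p); split=> //.
    by rewrite mem_canon_edges /= ltnW // -onthTE hp.
  by move=> [i' p'] h'; have [/= -> ->] := once_uniq h h' hp.
case: q => [[j|j]|[b|[c t]]].
- have [g gK Kg] := ends_bij; exists (g j, size (W (g j))).
  have hx : (g j, size (W (g j))) \in canon_edges by rewrite mem_canon_edges.
  have h0 : item_at (g j, size (W (g j))) = None by rewrite /item_at onth_default.
  split=> //; first by have := canon_portP hx; rewrite h0 /= Kg => -[].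
  move=> y /canon_portP; case: (item_at y) => [[[c|c||]|j']|].
  + by move=> ->.
  + by move=> ->.
  + by case=> b [_ ->].
  + by case=> b [_ ->].
  + by move=> ->.
  + by case=> e -> [<-]; rewrite gK -e; case: (y).
- have [x [hx h u]] := posE _ (W_hole j); exists x; split=> //.
    by have := canon_portP hx; rewrite h.
  move=> y /canon_portP; case E : (item_at y) => [[[c|c||]|j']|].
  + by move=> ->.
  + by move=> ->.
  + by case=> b [_ ->].
  + by case=> b [_ ->].
  + by move=> -> [ej]; apply: u; rewrite E ej.
  + by case=> _ ->.
- exists (ssval b).
  have hb : ssval b \in canon_bivs := ssvalP b.
  have hx : ssval b \in canon_edges by move: hb; rewrite mem_filter => /andP[].
  split=> //; first by rewrite /canon_port valK.
  move=> y /canon_portP; case: (item_at y) => [[[c|c||]|j']|].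
  + by move=> ->.
  + by move=> ->.
  + by case=> b' [<- ->] [->].
  + by case=> b' [<- ->] [->].
  + by move=> ->.
  + by case=> _ ->.
have [x [hx h u]] : exists x, [/\ x \in canon_edges,
    item_at x = Some (inl (if t == s c then Over c else Under c)) &
    forall y, item_at y = Some (inl (if t == s c then Over c else Under c)) -> y = x].
  by apply: posE; case: ifP.
exists x; split=> //.
  have := canon_portP hx; rewrite h; case: eqP => [->//|ne ->].
  by congr (Crs c _); move: ne; clear; case: t (s c) => [] [].
move=> y /canon_portP; case E : (item_at y) => [[[d|d||]|j']|].
+ by move=> -> [ed et]; subst d t; apply: u; rewrite E eqxx.
+ by move=> -> [ed et]; subst d t; apply: u; rewrite E; case: (s c).
+ by case=> b' [_ ->].
+ by case=> b' [_ ->].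
+ by move=> ->.
+ by case=> _ ->.
Qed.

Lemma canon_tgt_bij : bijective (@xtgt _ _ canon_graph).
Proof.
apply: inj_surj_bij => [e e' /= h|q].
  have [x [_ _ u]] := canon_port_unique (canon_port (ssval e)).
  by apply: val_inj; rewrite /= (u _ (ssvalP e) erefl) (u _ (ssvalP e') (esym h)).
by have [x [hx <- _]] := canon_port_unique q; exists (SeqSub hx).
Qed.

Lemma hole_after_inj (B : Type) (q q' : port ('I_n + 'I_k) B C) r :
  hole_after m q = Some r -> hole_after m q' = Some r -> q = q'.
Proof.
case: q => [[j|j]|[b|[c t]]] //= [<-]; case: q' => [[j'|j']|[b'|[c' t']]] //= [].
- by move=> ->.
- by move=> ->.
- by move=> -> /(congr1 negb); rewrite !negbK => ->.
Qed.

Lemma canon_inner x : x \in canon_edges -> (x.2 < size (W x.1))%N ->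
  exists2 r, hole_after m (canon_port x) = Some r & forall i, r <> Endp (inl i).
Proof.
move=> hx; rewrite -onthTE -/(item_at x); have := canon_portP hx.
case: (item_at x) => [[[c|c||]|j']|] //.
- by move=> -> _; eexists.
- by move=> -> _; eexists.
- by move=> [b [_ ->]] _; eexists.
- by move=> [b [_ ->]] _; eexists.
- by move=> -> _; eexists; first by []; move=> i [].
Qed.

(** Away from the first edges, sources are targets transported by [hole_after], which is injective
    and never yields an outer initial vertex; bijectivity thus comes from that of the targets. *)
Lemma canon_src_bij : bijective (@xsrc _ _ canon_graph).
Proof.
have inner i q : (i, q.+1) \in canon_edges -> (i, q) \in canon_edges /\ (q < size (W i))%N.
  by rewrite !mem_canon_edges /= => h; split=> //; apply: ltnW.
apply: inj_surj_bij => [[[i p] hx] [[i' p'] hx']|q].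
  move=> /= h; apply: val_inj => /=; case: p p' hx hx' h => [|p] [|p'] hx hx' /=.
  - by case=> ->.
  - have [hy lt] := inner _ _ hx'; have [r -> hr] := canon_inner hy lt.
    by move=> /= h; case: (hr i).
  - have [hy lt] := inner _ _ hx; have [r -> hr] := canon_inner hy lt.
    by move=> /= h; case: (hr i').
  have [hy lt] := inner _ _ hx; have [r e hr] := canon_inner hy lt.
  have [hy' lt'] := inner _ _ hx'; have [r' e' hr'] := canon_inner hy' lt'.
  rewrite e e' /= => er; subst r'.
  have [x [_ _ u]] := canon_port_unique (canon_port (i, p)).
  have := u _ hy' (esym (hole_after_inj e e')).
  by rewrite -(u _ hy erefl) => -[-> ->].
have [[i ->]|[q' hq]] : (exists i, q = Endp (inl i)) \/
    exists q' : port ('I_n + 'I_k) (seq_sub canon_bivs) C, hole_after m q' = Some q.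
  case: q => [[i|j]|[b|[c t]]]; first by left; exists i.
  - by right; exists (Endp (inr j)).
  - by right; exists (Biv b).
  - by right; exists (Crs c (~~ t)); rewrite /= negbK.
  have hx : (i, 0%N) \in canon_edges by rewrite mem_canon_edges.
  by exists (SeqSub hx).
have [[i p] [hx e _]] := canon_port_unique q'.
have hx' : (i, p.+1) \in canon_edges.
  rewrite mem_canon_edges /= -onthTE -[onth _ _]/(item_at (i, p)).
  by have := canon_portP hx; case: item_at => // -[_ e']; move: hq; rewrite -e e'.
by exists (SeqSub hx'); rewrite /= e hq.
Qed.

Lemma canon_rot (e : xedge canon_graph) : `|xrot e| <= 1.
Proof. by rewrite /= /rot_at; case: item_at => [[[]|]|]. Qed.

Definition canon_strand (i : 'I_m) : seq (xedge canon_graph) :=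
  pmap insub [seq (i, p) | p <- iota 0 (size (W i)).+1].

Lemma canon_strand_val i :
  map (@ssval _ _) (canon_strand i) = [seq (i, p) | p <- iota 0 (size (W i)).+1].
Proof.
rewrite (pmap_filter (insubK _)); apply/all_filterP/allP => x /mapP[p].
by rewrite mem_iota => hp ->; rewrite isSome_insub mem_canon_edges.
Qed.

Lemma canon_strand_cover e : exists i, e \in canon_strand i.
Proof.
exists (ssval e).1; rewrite mem_pmap_sub; apply/mapP; exists (ssval e).2; last first.
  by rewrite -surjective_pairing.
by rewrite mem_iota; have := ssvalP e; rewrite mem_canon_edges.
Qed.

Lemma canon_kstrand i : is_kstrand i (canon_strand i) (ends i).
Proof.
have := canon_strand_val i; case: (canon_strand i) => //= e t [he ht].
pose r (x y : 'I_m * nat) := (y == (x.1, x.2.+1)) && (x.2 < size (W x.1))%N.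
have hr N a : (a + N <= size (W i))%N -> path r (i, a) [seq (i, p) | p <- iota a.+1 N] /\
    last (i, a) [seq (i, p) | p <- iota a.+1 N] = (i, (a + N)%N).
  elim: N a => [|N ih] a /=; first by rewrite addn0.
  rewrite -addSnnS => h; have [-> ->] := ih _ h; split=> //.
  by rewrite /r eqxx andbT /= (leq_trans _ h) // leq_addr.
have [p l] := hr (size (W i)) 0%N (leqnn _).
split; first by rewrite he.
- rewrite -he -ht path_map in p; apply: sub_path p => x y /andP[/eqP hy lt].
  have [r' e' _] := canon_inner (ssvalP x) lt.
  apply/eqP; rewrite /= hy; move: e'; case: (ssval x) => i' q' /= -> //.
- rewrite -he -ht last_map add0n in l; rewrite l.
  have hx : (i, size (W i)) \in canon_edges by rewrite mem_canon_edges.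
  have := canon_portP hx; rewrite /item_at /= onth_default //.
  by case=> _ ->.
Qed.

(** Places past the end contribute nothing, which absorbs the last edge of a strand, to which no
    item corresponds. *)
Lemma flatten_onth (T : Type) (w : seq T) N : (size w <= N)%N ->
  flatten [seq (if onth w p is Some l then [:: l] else [::]) | p <- iota 0 N] = w.
Proof.
elim: w N => [|l w ih] [|N] //= h.
  by elim: (iota 1 N) => //= p t; rewrite onth0n.
rewrite -[1%N]addn0 iotaDl -map_comp; congr cons; rewrite -[RHS](ih N h).
by congr flatten; apply: eq_map.
Qed.

Lemma canon_strand_word i :
  flatten (map (@hole_word _ _ _ canon_graph) (canon_strand i)) = W i.
Proof.
pose hw x := if item_at x is Some l then [:: l] else [::].
rewrite -[RHS](flatten_onth (leqnSn (size (W i)))).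
have -> : map (@hole_word _ _ _ canon_graph) (canon_strand i)
    = map hw (map (@ssval _ _) (canon_strand i)).
  rewrite -map_comp; apply: eq_map => e.
  rewrite /hole_word edge_wordE /pass_word /= /hw; have := canon_portP (ssvalP e).
  rewrite /rot_at; case: (item_at _) => [[[c|c||]|j']|].
  - by move=> ->; rewrite eqxx.
  - by move=> ->; case: (s c).
  - by case=> b [_ ->].
  - by case=> b [_ ->].
  - by move=> ->.
  - by case=> _ ->.
by rewrite canon_strand_val -map_comp.
Qed.

End CanonicalGraph.

(** * From equivalences of Gauss diagrams to equivalences of tangles *)

Section GaussToTangle.
Variable R : realType.

Lemma spells_relabel (I O : finType) (G : xgraph I O) (C C' : Type) (s : C -> bool)
    (s' : C' -> bool) (last last' : O -> I) (W : I -> seq (letter C)) (W' : I -> seq (letter C'))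
    (h : C -> C') :
  bijective h -> (forall c, s' (h c) = s c) -> last =1 last' ->
  (forall i, W' i = map (map_letter h) (W i)) ->
  spells G s last W -> spells G s' last' W'.
Proof.
move=> hb hs hl hW [f [fb fs H]]; exists (h \o f); split; first exact: bij_comp.
  by move=> c; rewrite /= hs fs.
move=> i; have [t [j [ht el ew]]] := H i; exists t, j; split=> //; first by rewrite -hl.
by rewrite hW ew map_map_letter.
Qed.

Section PlugCanonical.
Variables (m n k : nat) (ends : 'I_m -> 'I_n) (last : 'I_n -> 'I_m) (C : finType)
  (s : C -> bool) (W : 'I_m -> seq (letter C + 'I_k)).
Hypotheses (W_hole : forall j, once W (inr j)) (W_over : forall c, once W (inl (Over c)))
  (W_under : forall c, once W (inl (Under c))) (ends_bij : bijective ends)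
  (lastE : forall i, last (ends i) = i).
Local Notation K := (canon_graph ends s W).

Lemma plug_canon_diagram (L : xgraph 'I_k 'I_k) (ls : 'I_k -> seq (xedge L)) :
  is_diagram L -> (forall j, @is_strand _ _ L j (ls j) j) -> is_diagram (xplug K L).
Proof.
move=> LP lsP; apply: (plug_diagram lsP (canon_kstrand ends s W)) => //.
- exact: canon_rot.
- exact: canon_src_bij.
- exact: canon_tgt_bij.
- exact: canon_strand_cover.
Qed.

Lemma plug_canon_spells (L : tangle_diagram k k) (p : pattern k) :
  realizes L p -> spells (xplug K L)
    (fun x : C + plabel p => match x with inl c => s c | inr l => psign l end)
    last (fun i => fill_word p (W i)).
Proof.
case=> f [fb fs /boolp.choice[ls hls]]; have [g [gb fK gK]] := bij_inv fb.
exists (fun x : C + xcross L => match x with inl c => inl c | inr c => inr (g c) end); split.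
- exact: sum_bij (Bijective (fun=> erefl) (fun=> erefl)) gb.
- by case=> c //=; rewrite -fs gK.
move=> i; exists (flatten (map (plug_edge (K := K) ls) (canon_strand ends s W i))), (ends i).
split=> //; first exact: (plug_strand (fun j => (hls j).1) (canon_kstrand ends s W i)).
rewrite (plug_strand_word _ (fun j => (hls j).2) fb) canon_strand_word map_map_letter.
by rewrite map_map_letter_id // => -[c|l] //=; rewrite fK.
Qed.

End PlugCanonical.

Lemma glinv_bij m n (D : gauss_diagram R m n) : bijective (glinv D).
Proof. by exists (glast D); [apply: glinvK|apply: glastK]. Qed.

(** The canonical graph without holes, filled with the empty diagram: the case k = 0 of the
    construction used for the moves. *)
Lemma gauss_tangle m n (D : gauss_diagram R m n) :
  exists T : tangle_diagram m n, gauss_diagram_of T D.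
Proof.
pose W i : seq (letter (gchord D) + 'I_0) := map inl (gauss_word D i).
have Wl l : once (gauss_word D) l -> once W (inl l).
  by apply: eq_once => i; rewrite [RHS]count_map; apply: eq_count.
have Wh (j : 'I_0) : once W (inr j) by case: j.
have Wo c := Wl _ (gauss_word_once_over c).
have Wu c := Wl _ (gauss_word_once_under c).
pose p := @Pattern 0 void no_crossing [tuple].
have rp : realizes (id_diagram 0) p by exists id; split=> //; [exists id|case].
have PP : is_diagram (xplug (canon_graph (glinv D) (@gsign _ _ _ D) W) (id_graph 0)).
  by apply: (plug_canon_diagram _ Wh Wo Wu (glinv_bij D) (ls := fun=> [::]) (id_graphP 0)) => -[].
exists (TangleDiagram PP); apply/gauss_diagram_ofP.
have := plug_canon_spells (@gsign _ _ _ D) W (@glinvK _ _ _ D) rp.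
apply: (spells_relabel (h := fun x => match x with inl c => c | inr v => of_void _ v end)) => //.
- by exists inl => // -[].
- by case.
- move=> i; rewrite fill_wordE /W -map_comp flatten_map_seq1 map_map_letter.
  by rewrite map_map_letter_id.
Qed.

(** The words of a pattern are those of a Gauss diagram on k intervals, and a tangle for it is the
    filling. Identity gluing makes strand j run from j to j. *)
Lemma realize_pattern k (p : pattern k) :
  (forall c, once (fun j => tnth (pword p) j) (Over c)) ->
  (forall c, once (fun j => tnth (pword p) j) (Under c)) ->
  exists L : tangle_diagram k k, realizes L p.
Proof.
move=> po pu.
have [D [f [fb fs fl fw]]] := realize_gauss R (@psign _ p) (@id_bij k) po pu.
have [L /gauss_diagram_ofP[g [gb gs h]]] := gauss_tangle D.
have [g' [gb' gK gK']] := bij_inv gb.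
exists L, (g' \o f); split; first exact: bij_comp.
  by move=> x; rewrite /= -gs gK' fs.
move=> j; have [t [j' [ht hl hw]]] := h j.
have ej : j' = j by rewrite -hl fl.
exists t; split; first by rewrite -[X in is_strand _ _ X]ej.
by rewrite -map_map_letter -fw hw map_map_letter map_map_letter_id.
Qed.

Section ReadsOnce.
Variables (m n k : nat) (D : gauss_diagram R m n) (C : finType) (s : C -> bool)
  (W : 'I_m -> seq (letter C + 'I_k)) (p : pattern k).
Hypotheses (W1 : forall j, once W (inr j)) (rD : gauss_reads D s W p).

(** Renaming the labels by the bijection f does not change counts, and in a Gauss diagram each chord
    letter occurs once. *)
Lemma reads_sum l : l \notin [:: Rplus; Rminus] ->
  (\sum_i \sum_(x <- W i) count_mem l (fill_item p x) = 1)%N.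
Proof.
case: rD => f [fb _ fw] hl.
have : once (gauss_word D) (map_letter f l).
  case: l hl => //= c _; [exact: gauss_word_once_over|exact: gauss_word_once_under].
rewrite /once => <-; apply: eq_bigr => i _.
rewrite fw fill_wordE count_map -count_flatten_map; apply: eq_count => l' /=.
by rewrite (inj_eq (map_letter_inj (bij_inj fb))).
Qed.

Lemma reads_once_context l : l \notin [:: Rplus; Rminus] -> once W (inl l).
Proof.
move=> hl; have := @reads_sum (map_letter inl l); case: l hl => // c _ h;
  rewrite /once -{}h //; apply: eq_bigr => i _; rewrite -sum_count_eq;
  apply: eq_bigr => -[l|j] _ /=; rewrite ?addn0.
- by case: l.
- by rewrite count_map; elim: (tnth _ _) => //= -[].
- by case: l.
- by rewrite count_map; elim: (tnth _ _) => //= -[].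
Qed.

(** Letters labelled by the pattern come from the holes only, and each hole is used once. The
    property is thus inherited from any diagram reading the pattern instead of being checked rule by
    rule. *)
Lemma reads_once_pattern l : l \notin [:: Rplus; Rminus] ->
  once (fun j => tnth (pword p) j) l.
Proof.
move=> hl; have := @reads_sum (map_letter inr l); rewrite sum_once_inr //.
rewrite big1 ?add0n => [h|i _]; last first.
  by apply: big1_seq => -[l'|//] _ /=; case: l hl l' => [c|c||] // _ [].
rewrite /once -{}h; last by case: l hl.
apply: eq_bigr => j _; rewrite /= count_map; apply: eq_count => l' /=.
by rewrite (inj_eq (map_letter_inj (@inr_inj _ _))).
Qed.

End ReadsOnce.

Section Cancel.
Variables (m n : nat) (D D' : gauss_diagram R m n) (C : finType) (s : C -> bool)
  (W : 'I_m -> seq (letter C + 'I_1)) (w : seq (letter void)) (a b : int).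
Hypotheses (W1 : forall j, once W (inr j)) (el : glast D =1 glast D')
  (ab : a + b = 0) (a1 : `|a| <= 1) (b1 : `|b| <= 1)
  (wE : rot_word void a ++ rot_word void b = w).

(* The hole is filled with a single trivial edge, which is then split into two
   edges carrying opposite diamonds. *)
Lemma cancel_tangle (T T' : tangle_diagram m n) :
  gauss_reads D s W (@Pattern 1 void no_crossing [tuple w]) ->
  gauss_reads D' s W cancel_none ->
  gauss_diagram_of T D -> gauss_diagram_of T' D' -> tangle_equiv T T'.
Proof.
move=> rD rD' /gauss_diagram_ofP hT /gauss_diagram_ofP hT'.
have Wo c : once W (inl (Over c)) by apply: (reads_once_context rD').
have Wu c : once W (inl (Under c)) by apply: (reads_once_context rD').
pose K := canon_graph (glinv D) s W; pose ls (j : 'I_1) := [:: j : xedge (id_graph 1)].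
have lsP j : @is_strand _ _ (id_graph 1) j (ls j) j by [].
have PP : is_diagram (xplug K (id_graph 1)).
  exact: (plug_canon_diagram s W1 Wo Wu (glinv_bij D) (id_graphP 1) lsP).
have rn : realizes (id_diagram 1) cancel_none.
  by exists id; split=> //; [exists id|move=> j; exists (ls j); rewrite [j]ord1].
pose P := TangleDiagram PP.
have hP : spells P (@gsign _ _ _ D') (glast D') (gauss_word D').
  case: rD' => f [fb fs fw].
  apply: (spells_relabel fb fs el fw).
  exact: (plug_canon_spells s W (@glinvK _ _ _ D) rn).
pose e0 : xedge (xplug K (id_graph 1)) := inr ord0.
pose S := TangleDiagram (split_diagram e0 PP a1 b1).
have hS : spells S (@gsign _ _ _ D) (glast D) (gauss_word D).
  case: rD => f [fb fs fw]; exists f; split=> // i.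
  exists (flatten (map (split_edge e0 a b) (flatten (map (plug_edge (K := K) ls)
    (canon_strand (glinv D) s W i))))), (glinv D i); split; last 1 first.
  - rewrite fw strand_word_flatten; congr map; rewrite -[in LHS](canon_strand_word (glinv D) s W i).
    symmetry; apply: (@plug_fill _ _ _ K (id_graph 1) ls (@Pattern 1 void no_crossing [tuple w])).
      move=> e; apply: etrans (split_edge_word e0 a b (inl e)) _.
      exact: (@plug_edge_word_l _ _ _ K (id_graph 1) e).
    move=> j; rewrite [j]ord1 -wE map_cat !map_rot_word; apply: etrans (cats0 _) _.
    by apply: etrans (split_edge_word e0 a b e0) _; rewrite eqxx cats0.
  - apply: split_strand; exact: (plug_strand lsP (canon_kstrand (glinv D) s W i)).
  - exact: glinvK.
apply: rst_trans (spells_equiv (bij_inj (glast_bij D)) hT hS) _.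
apply: rst_trans _ (spells_equiv (bij_inj (glast_bij D')) hP hT').
by apply: rst_step; apply: (@move_Om0r _ _ S P e0 a b) => //; apply: xiso_refl.
Qed.

End Cancel.

(** For a common rule, one canonical graph of the surroundings W is filled with realizations of the
    two sides. The fillings differ by a single tangle move and have the words of D and D', hence are
    equivalent to T and T'. *)
Lemma gauss_move_tangle m n (D D' : gauss_diagram R m n) (T T' : tangle_diagram m n) :
  gauss_move D D' -> gauss_diagram_of T D -> gauss_diagram_of T' D' -> tangle_equiv T T'.
Proof.
move=> mv; case: (mv) => [/homeo_giso[f [fb fs fl fw]]|k p q C s W pq el /holes_onceP W1 rD rD'].
  move=> /gauss_diagram_ofP hT /gauss_diagram_ofP hT'.
  apply: (spells_equiv (bij_inj (glast_bij D')) _ hT').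
  apply: (spells_relabel fb fs _ _ hT); first exact: gauss_move_last.
  by move=> i; apply: fw.
case: k p q / pq W W1 rD rD' => [k p q pq||] W W1 rD rD'; last 2 first.
- exact: (@cancel_tangle _ _ _ _ _ _ _ _ 1 (-1) W1 el erefl erefl erefl erefl T T' rD rD').
- exact: (@cancel_tangle _ _ _ _ _ _ _ _ (-1) 1 W1 el erefl erefl erefl erefl T T' rD rD').
move=> /gauss_diagram_ofP hT /gauss_diagram_ofP hT'.
have [L hL] : exists L : tangle_diagram k k, realizes L p.
  by apply: realize_pattern => c; apply: (reads_once_pattern W1 rD).
have [L' hL'] : exists L : tangle_diagram k k, realizes L q.
  by apply: realize_pattern => c; apply: (reads_once_pattern W1 rD').
have Wo c : once W (inl (Over c)) by apply: (reads_once_context rD).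
have Wu c : once W (inl (Under c)) by apply: (reads_once_context rD).
pose K := canon_graph (glinv D) s W.
have PP (M : tangle_diagram k k) r : realizes M r -> is_diagram (xplug K M).
  case=> f [_ _ /boolp.choice[ls hls]].
  exact: (plug_canon_diagram s W1 Wo Wu (glinv_bij D) (tgraphP M) (fun j => (hls j).1)).
pose P := TangleDiagram (PP _ _ hL); pose P' := TangleDiagram (PP _ _ hL').
have hP : spells P (@gsign _ _ _ D) (glast D) (gauss_word D).
  case: rD => f [fb fs fw]; apply: (spells_relabel fb fs (fun=> erefl) fw).
  exact: (plug_canon_spells s W (@glinvK _ _ _ D) hL).
have hP' : spells P' (@gsign _ _ _ D') (glast D') (gauss_word D').
  case: rD' => f [fb fs fw]; apply: (spells_relabel fb fs el fw).
  exact: (plug_canon_spells s W (@glinvK _ _ _ D) hL').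
apply: rst_trans (spells_equiv (bij_inj (glast_bij D)) hT hP) _.
apply: rst_trans _ (spells_equiv (bij_inj (glast_bij D')) hP' hT').
by apply: rst_step; apply: (move_rule pq hL hL'); apply: xiso_refl.
Qed.

Lemma gauss_equiv_tangle m n (D D' : gauss_diagram R m n) (T T' : tangle_diagram m n) :
  gauss_equiv D D' -> gauss_diagram_of T D -> gauss_diagram_of T' D' -> tangle_equiv T T'.
Proof.
move=> h; elim: h T T' => {D D'}
  [D D' mv T T'|D T T'|D D' _ ih T T' h h'|D1 D2 D3 _ ih1 _ ih2 T T' h h'].
- exact: gauss_move_tangle.
- move=> /gauss_diagram_ofP h /gauss_diagram_ofP h'.
  exact: (spells_equiv (bij_inj (glast_bij D)) h h').
- exact: rst_sym (ih _ _ h' h).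
- have [T2 h2] := gauss_tangle D2.
  exact: rst_trans (ih1 _ _ h h2) (ih2 _ _ h2 h').
Qed.

End GaussToTangle.

(** * The isomorphism *)

Section OperationsOnDiagrams.
Variable R : realType.

Lemma id_gauss_diagram_of n : gauss_diagram_of (id_diagram n) (id_gauss R n).
Proof.
apply/gauss_diagram_ofP; exists id; split=> //; first by exists id.
by move=> i; exists [:: i], i; split=> //; rewrite id_gauss_word.
Qed.

Lemma sym_gauss_diagram_of n m : gauss_diagram_of (sym_diagram n m) (sym_gauss R n m).
Proof.
apply/gauss_diagram_ofP; exists id; split=> //; first by exists id.
move=> i; exists [:: i], (swap_ord i); split=> //; first by rewrite sym_last swap_ordK.
by rewrite sym_gauss_word.
Qed.

Section CompTens.
Variables (m n p q : nat).

Lemma comp_edge_word_l (G : xgraph 'I_m 'I_n) (H : xgraph 'I_n 'I_p) e :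
  @edge_word _ _ (comp_graph H G) (inl e) = map (map_letter inl) (edge_word e).
Proof.
rewrite !edge_wordE map_cat map_rot_word; congr (_ ++ _); rewrite /pass_word /=.
by case: (xtgt e) => [j|[b|[c s]]] //=; case: ifP.
Qed.

Lemma comp_edge_word_r (G : xgraph 'I_m 'I_n) (H : xgraph 'I_n 'I_p) e :
  @edge_word _ _ (comp_graph H G) (inr e) = map (map_letter inr) (edge_word e).
Proof.
rewrite !edge_wordE map_cat map_rot_word; congr (_ ++ _); rewrite /pass_word /=.
by case: (xtgt e) => [j|[b|[c s]]] //=; case: ifP.
Qed.

Lemma tens_edge_word_l (G : xgraph 'I_m 'I_n) (H : xgraph 'I_p 'I_q) e :
  @edge_word _ _ (tens_graph G H) (inl e) = map (map_letter inl) (edge_word e).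
Proof.
rewrite !edge_wordE map_cat map_rot_word; congr (_ ++ _); rewrite /pass_word /=.
by case: (xtgt e) => [j|[b|[c s]]] //=; case: ifP.
Qed.

Lemma tens_edge_word_r (G : xgraph 'I_m 'I_n) (H : xgraph 'I_p 'I_q) e :
  @edge_word _ _ (tens_graph G H) (inr e) = map (map_letter inr) (edge_word e).
Proof.
rewrite !edge_wordE map_cat map_rot_word; congr (_ ++ _); rewrite /pass_word /=.
by case: (xtgt e) => [j|[b|[c s]]] //=; case: ifP.
Qed.

Lemma tens_strand_l (G : xgraph 'I_m 'I_n) (H : xgraph 'I_p 'I_q) i t j :
  @is_strand _ _ G i t j ->
  @is_strand _ _ (tens_graph G H) (lshift p i) (map inl t) (lshift q j).
Proof.
apply: is_strand_map => [e1 e2|e /= ->|e /= ->] // /xstepP h; apply/xstepP; move: h => /=.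
by case: (xtgt e1) => [?|[b|[c s1]]] //= [<-].
Qed.

Lemma tens_strand_r (G : xgraph 'I_m 'I_n) (H : xgraph 'I_p 'I_q) i t j :
  @is_strand _ _ H i t j ->
  @is_strand _ _ (tens_graph G H) (rshift m i) (map inr t) (rshift n j).
Proof.
apply: is_strand_map => [e1 e2|e /= ->|e /= ->] // /xstepP h; apply/xstepP; move: h => /=.
by case: (xtgt e1) => [?|[b|[c s1]]] //= [<-].
Qed.

Lemma strand_word_map (I O I' O' : finType) (G : xgraph I O) (G' : xgraph I' O')
    (h : xedge G -> xedge G') (f : xcross G -> xcross G') t :
  (forall e, edge_word (h e) = map (map_letter f) (edge_word e)) ->
  strand_word (map h t) = map (map_letter f) (strand_word t).
Proof.
move=> hw; rewrite /strand_word -map_comp map_flatten_map; congr flatten.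
by apply: eq_map => e; rewrite /= hw.
Qed.

Lemma comp_gauss_diagram_of (T : tangle_diagram m n) (U : tangle_diagram n p)
    (D : gauss_diagram R m n) (E : gauss_diagram R n p) :
  gauss_diagram_of T D -> gauss_diagram_of U E ->
  gauss_diagram_of (comp_diagram U T) (comp_gauss E D).
Proof.
move=> /gauss_diagram_ofP[f [fb fs h]] /gauss_diagram_ofP[g [gb gs h']].
apply/gauss_diagram_ofP.
exists (fun x : xcross T + xcross U => match x with inl c => inl (f c) | inr c => inr (g c) end).
split; [exact: sum_bij|by case|] => i.
have [t [j [ht hl hw]]] := h i; have [u [l [hu hl' hw']]] := h' j.
exists (map inl t ++ map inr u), l; split; first exact: comp_strand ht hu.
  by rewrite comp_last hl' hl.
rewrite comp_gauss_word (glinv_eq hl) hw hw' !map_map_letter.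
have -> : @strand_word _ _ (comp_graph U T) (map inl t ++ map inr u)
    = map (map_letter inl) (strand_word t) ++ map (map_letter inr) (strand_word u).
  rewrite -(strand_word_map _ (@comp_edge_word_l T U)).
  rewrite -(strand_word_map _ (@comp_edge_word_r T U)).
  by rewrite /strand_word map_cat flatten_cat.
by rewrite map_cat !map_map_letter.
Qed.

Lemma tens_gauss_diagram_of (T : tangle_diagram m n) (U : tangle_diagram p q)
    (D : gauss_diagram R m n) (E : gauss_diagram R p q) :
  gauss_diagram_of T D -> gauss_diagram_of U E ->
  gauss_diagram_of (tens_diagram T U) (tens_gauss D E).
Proof.
move=> /gauss_diagram_ofP[f [fb fs h]] /gauss_diagram_ofP[g [gb gs h']].
apply/gauss_diagram_ofP.
exists (fun x : xcross T + xcross U => match x with inl c => inl (f c) | inr c => inr (g c) end).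
split; [exact: sum_bij|by case|] => i; case: (fintype.split_ordP i) => k ->.
- have [t [j [ht hl hw]]] := h k.
  exists (map inl t), (lshift q j); split; first exact: tens_strand_l.
    by rewrite tens_last_l hl.
  rewrite tens_gauss_word_l hw (strand_word_map _ (@tens_edge_word_l T U)) !map_map_letter.
  exact: eq_map_map_letter.
- have [t [j [ht hl hw]]] := h' k.
  exists (map inr t), (rshift n j); split; first exact: tens_strand_r.
    by rewrite tens_last_r hl.
  rewrite tens_gauss_word_r hw (strand_word_map _ (@tens_edge_word_r T U)) !map_map_letter.
  exact: eq_map_map_letter.
Qed.

End CompTens.

End OperationsOnDiagrams.

(** * The bijection on classes and the transport of structure *)

Section Isomorphism.
Variable R : realType.

Lemma tclsP m n (T T' : tangle_diagram m n) :
  cls (@tangle_equiv m n) T = cls (@tangle_equiv m n) T' <-> tangle_equiv T T'.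
Proof. exact: clsP erefl T T'. Qed.

(** A representative and a Gauss diagram of it are chosen; [PhiE] shows that the class does not
    depend on these choices. *)
Definition Phi m n (c : xc_tangle m n) : xc_gauss R m n :=
  cls (@gauss_equiv R m n) (sval (cid (tangle_gauss R (class_repr c)))).

Definition Psi m n (c : xc_gauss R m n) : xc_tangle m n :=
  cls (@tangle_equiv m n) (sval (cid (gauss_tangle (class_repr c)))).

Lemma PhiE m n (T : tangle_diagram m n) (D : gauss_diagram R m n) :
  gauss_diagram_of T D -> Phi (cls (@tangle_equiv m n) T) = cls (@gauss_equiv R m n) D.
Proof.
move=> h; rewrite /Phi; apply/gclsP; move: (cid _) => [D' h'].
apply: tangle_equiv_gauss h' h; exact/tclsP/class_reprK.
Qed.

Lemma PsiE m n (T : tangle_diagram m n) (D : gauss_diagram R m n) :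
  gauss_diagram_of T D -> Psi (cls (@gauss_equiv R m n) D) = cls (@tangle_equiv m n) T.
Proof.
move=> h; rewrite /Psi; apply/tclsP; move: (cid _) => [T' h'].
apply: gauss_equiv_tangle h' h; exact/gclsP/class_reprK.
Qed.

Lemma tcls_ex m n (c : xc_tangle m n) : exists (T : tangle_diagram m n) (D : gauss_diagram R m n),
  [/\ c = cls _ T, Phi c = cls _ D & gauss_diagram_of T D].
Proof.
have [D h] := tangle_gauss R (class_repr c); exists (class_repr c), D.
by split=> //; rewrite ?class_reprK // -{1}(class_reprK c) (PhiE h).
Qed.

Lemma PhiK m n (c : xc_tangle m n) : Psi (Phi c) = c.
Proof. by have [T [D [-> -> h]]] := tcls_ex c; rewrite (PsiE h). Qed.

Lemma PsiK m n (c : xc_gauss R m n) : Phi (Psi c) = c.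
Proof.
have [D ->] := gcls_surj c; have [T h] := gauss_tangle D.
by rewrite (PsiE h) (PhiE h).
Qed.

Lemma Phi_inj m n : injective (@Phi m n).
Proof. exact: can_inj (@PhiK m n). Qed.

(** Tangle moves are not followed through gluing. Injectivity of [Phi] reduces the claim to Gauss
    diagrams, where the operations are already known to descend to classes. *)
Lemma tangle_ops : TXC_operations_on_classes.
Proof.
split=> [m n p T2 T1|m n p q T1 T2]; apply: Phi_inj.
- have [D1 h1] := tangle_gauss R T1; have [D2 h2] := tangle_gauss R T2.
  rewrite (PhiE (comp_gauss_diagram_of h1 h2)) /=.
  have [D1' h1'] := tangle_gauss R (class_repr (cls (@tangle_equiv m n) T1)).
  have [D2' h2'] := tangle_gauss R (class_repr (cls (@tangle_equiv n p) T2)).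
  rewrite (PhiE (comp_gauss_diagram_of h1' h2')) -!gcompE.
  by rewrite -(PhiE h1) -(PhiE h2) -(PhiE h1') -(PhiE h2') !class_reprK.
- have [D1 h1] := tangle_gauss R T1; have [D2 h2] := tangle_gauss R T2.
  rewrite (PhiE (tens_gauss_diagram_of h1 h2)) /=.
  have [D1' h1'] := tangle_gauss R (class_repr (cls (@tangle_equiv m n) T1)).
  have [D2' h2'] := tangle_gauss R (class_repr (cls (@tangle_equiv p q) T2)).
  rewrite (PhiE (tens_gauss_diagram_of h1' h2')) -!gtensE.
  by rewrite -(PhiE h1) -(PhiE h2) -(PhiE h1') -(PhiE h2') !class_reprK.
Qed.

Lemma Phi_comp m n p (g : xc_tangle n p) (f : xc_tangle m n) :
  Phi (@Defs.comp TXC m n p g f) = @Defs.comp (GDXC R) m n p (Phi g) (Phi f).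
Proof.
have [T [D [-> -> h]]] := tcls_ex f; have [U [E [-> -> h']]] := tcls_ex g.
by rewrite tangle_ops.1 (PhiE (comp_gauss_diagram_of h h')) -gcompE.
Qed.

Lemma Phi_tens m n p q (f : xc_tangle m n) (g : xc_tangle p q) :
  Phi (@tens TXC m n p q f g) = @tens (GDXC R) m n p q (Phi f) (Phi g).
Proof.
have [T [D [-> -> h]]] := tcls_ex f; have [U [E [-> -> h']]] := tcls_ex g.
by rewrite tangle_ops.2 (PhiE (tens_gauss_diagram_of h h')) -gtensE.
Qed.

Lemma Phi_id n : Phi (@idm TXC n) = @idm (GDXC R) n.
Proof. exact: PhiE (id_gauss_diagram_of R n). Qed.

Lemma Phi_braid n m : Phi (@braid TXC n m) = @braid (GDXC R) n m.
Proof. exact: PhiE (sym_gauss_diagram_of R n m). Qed.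

Lemma Phi_cast m n m' n' (ea : m = m') (eb : n = n') (f : xc_tangle m n) :
  Phi (@cast_hom TXC m m' n n' ea eb f) = @cast_hom (GDXC R) m m' n n' ea eb (Phi f).
Proof. by case: _ / ea; case: _ / eb. Qed.

(** The functors are the identity on objects, so the casts in their axioms go along equalities of an
    object with itself, which proof irrelevance identifies with reflexivity. *)
Lemma cast_hom_id (C : smc_data) (a b : ob C) (ea : a = a) (eb : b = b) (f : Defs.hom a b) :
  cast_hom ea eb f = f.
Proof. by rewrite (Prop_irrelevance ea erefl) (Prop_irrelevance eb erefl). Qed.

Lemma tangle_ssmc : is_ssmc TXC.
Proof.
have G := gauss_ssmc R; split.
- move=> a b c d h g f; apply: Phi_inj; rewrite !Phi_comp; exact: (ssmc_compA G).
- move=> a b f; apply: Phi_inj; rewrite Phi_comp Phi_id; exact: (ssmc_comp1l G).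
- move=> a b f; apply: Phi_inj; rewrite Phi_comp Phi_id; exact: (ssmc_comp1r G).
- move=> a b; apply: Phi_inj; rewrite Phi_tens !Phi_id; exact: (ssmc_tens1 G).
- move=> a b c a' b' c' g f g' f'; apply: Phi_inj.
  rewrite Phi_tens !Phi_comp !Phi_tens; exact: (ssmc_tens_comp G).
- exact: addnA.
- exact: add0n.
- exact: addn0.
- move=> a b c a' b' c' f g h ea eb; apply: Phi_inj.
  rewrite Phi_cast !Phi_tens; exact: (ssmc_tensA G).
- move=> a b f ea eb; apply: Phi_inj; rewrite Phi_cast Phi_tens Phi_id; exact: (ssmc_tens1l G).
- move=> a b f ea eb; apply: Phi_inj; rewrite Phi_cast Phi_tens Phi_id; exact: (ssmc_tens1r G).
- move=> a b c d f g; apply: Phi_inj; rewrite !Phi_comp !Phi_tens !Phi_braid.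
  exact: (ssmc_braid_nat G).
- move=> a b; apply: Phi_inj; rewrite Phi_comp !Phi_braid Phi_id; exact: (ssmc_braidK G).
- move=> a b c e1 e2 e3; apply: Phi_inj.
  rewrite Phi_cast Phi_comp Phi_cast !Phi_tens !Phi_braid !Phi_id; exact: (ssmc_hexagon G).
Qed.

Lemma Phi_functor : is_ssm_functor (@SmcMap TXC (GDXC R) (fun n : nat => n) Phi).
Proof.
split=> //=.
- exact: Phi_id.
- exact: Phi_comp.
- by move=> a b c d f g e1 e2; rewrite cast_hom_id Phi_tens.
- by move=> a b e1 e2; rewrite cast_hom_id Phi_braid.
Qed.

Lemma Psi_functor : is_ssm_functor (@SmcMap (GDXC R) TXC (fun n : nat => n) Psi).
Proof.
split=> //=.
- by move=> a; apply: Phi_inj; rewrite PsiK Phi_id.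
- by move=> a b c g f; apply: Phi_inj; rewrite Phi_comp !PsiK.
- by move=> a b c d f g e1 e2; rewrite cast_hom_id; apply: Phi_inj; rewrite Phi_tens !PsiK.
- by move=> a b e1 e2; rewrite cast_hom_id; apply: Phi_inj; rewrite Phi_braid PsiK.
Qed.

Lemma Phi_isomorphism : is_ssm_isomorphism (@SmcMap TXC (GDXC R) (fun n : nat => n) Phi).
Proof.
split; first exact: Phi_functor.
exists (@SmcMap (GDXC R) TXC (fun n : nat => n) Psi); split; first exact: Psi_functor.
- by split=> // a b f e1 e2; rewrite cast_hom_id /= PhiK.
- by split=> // a b f e1 e2; rewrite cast_hom_id /= PsiK.
Qed.

End Isomorphism.

Theorem theorem3p4 (R : realType) :
  [/\ TXC_operations_on_classes, is_ssmc TXC,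
      GDXC_operations_on_classes R, is_ssmc (GDXC R) &
      (forall (m n : nat) (T : tangle_diagram m n),
         exists D : gauss_diagram R m n, gauss_diagram_of T D) /\
      exists Phi : forall m n : nat, xc_tangle m n -> xc_gauss R m n,
        (forall (m n : nat) (T : tangle_diagram m n) (D : gauss_diagram R m n),
           gauss_diagram_of T D ->
           Phi m n (cls (@tangle_equiv m n) T) = cls (@gauss_equiv R m n) D) /\
        @is_ssm_isomorphism TXC (GDXC R)
          (@SmcMap TXC (GDXC R) (fun n : nat => n) Phi)].
Proof.
split; [exact: tangle_ops R|exact: tangle_ssmc R|exact: gauss_ops|exact: gauss_ssmc|].
split; first exact: tangle_gauss.
exists (@Phi R); split; [exact: PhiE|exact: Phi_isomorphism].
Qed.
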